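(* Let $\mathcal H$ and $\mathcal H'$ be separable Hilbert spaces, let $\alpha\in(0,2)$, and let $(\mathbf X,\mathbf Y)$ be a pair of random variables with values in $\mathcal H\times\mathcal H'$. Let $\mathrm{dcov}_\alpha(\mathbf X,\mathbf Y)$ denote any one of the following four quantities, under the indicated moment condition: (1) $\mathrm{dcov}^*_\alpha(\mathbf X,\mathbf Y)$, assuming $\mathbb E\|\mathbf X\|^{2\alpha}<\infty$ and $\mathbb E\|\mathbf Y\|^{2\alpha}<\infty$; (2) $\widehat{\mathrm{dcov}}_\alpha(\mathbf X,\mathbf Y)$, assuming $\mathbb E\|\mathbf X\|^{\alpha}<\infty$ and $\mathbb E\|\mathbf Y\|^{\alpha}<\infty$; (3) $\widetilde{\mathrm{dcov}}_\alpha(\mathbf X,\mathbf Y)$, assuming $\mathbb E\|\mathbf X\|^{\alpha}<\infty$ and $\mathbb E\|\mathbf Y\|^{\alpha}<\infty$; (4) $\mathrm{dcov}^{\mathsf H}_\alpha(\mathbf X,\mathbf Y)$, without any moment condition. Then $\mathrm{dcov}_\alpha(\mathbf X,\mathbf Y)=0$ if and only if $\mathbf X$ and $\mathbf Y$ are independent.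
   Context: Hilbert spaces have real scalars; $\|\cdot\|$ is the Hilbert norm and $d(\mathbf x,\mathbf x')=\|\mathbf x-\mathbf x'\|$. Let $(\mathbf X_i,\mathbf Y_i)$, $i\ge1$, be independent copies of $(\mathbf X,\mathbf Y)$. $\mathrm{dcov}^*_\alpha(\mathbf X,\mathbf Y):=\mathbb E[d(\mathbf X_1,\mathbf X_2)^\alpha d(\mathbf Y_1,\mathbf Y_2)^\alpha]+\mathbb E[d(\mathbf X_1,\mathbf X_2)^\alpha]\,\mathbb E[d(\mathbf Y_1,\mathbf Y_2)^\alpha]-2\,\mathbb E[d(\mathbf X_1,\mathbf X_2)^\alpha d(\mathbf Y_1,\mathbf Y_3)^\alpha]$. $\widehat{\mathrm{dcov}}_\alpha(\mathbf X,\mathbf Y):=\frac14\mathbb E[\widehat X_\alpha\widehat Y_\alpha]$, where $\widehat X_\alpha:=d(\mathbf X_1,\mathbf X_2)^\alpha-d(\mathbf X_2,\mathbf X_3)^\alpha+d(\mathbf X_3,\mathbf X_4)^\alpha-d(\mathbf X_4,\mathbf X_1)^\alpha$ and $\widehat Y_\alpha$ is defined in the same way with $\mathbf Y_i$. $\widetilde{\mathrm{dcov}}_\alpha(\mathbf X,\mathbf Y):=\mathbb E[\widetilde X_\alpha\widetilde Y_\alpha]$, where $\widetilde X_\alpha:=\mathbb E(\widehat X_\alpha\mid\mathbf X_1,\mathbf X_2)$ and $\widetilde Y_\alpha:=\mathbb E(\widehat Y_\alpha\mid\mathbf Y_1,\mathbf Y_2)$. $\mathrm{dcov}^{\mathsf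 H}_\alpha$: fix orthonormal bases $(\mathbf e_i)_i$ of $\mathcal H$ and $(\mathbf e'_j)_j$ of $\mathcal H'$, and i.i.d. $N(0,1)$ random variables $\xi_i$, $1\le i\le\dim\mathcal H$, and $\eta_j$, $1\le j\le\dim\mathcal H'$ (finitely or countably infinitely many), all independent of each other and of $(\mathbf X,\mathbf Y)$; write $\boldsymbol\xi=(\xi_i)_i$, $\boldsymbol\eta=(\eta_j)_j$, $\boldsymbol\xi\cdot\mathbf x:=\sum_i\langle\mathbf x,\mathbf e_i\rangle\xi_i$ and $\boldsymbol\eta\cdot\mathbf y:=\sum_j\langle\mathbf y,\mathbf e'_j\rangle\eta_j$ (a.s. convergent sums). With $c_\alpha:=\alpha2^{\alpha/2}/\Gamma(1-\alpha/2)$, $$\mathrm{dcov}^{\mathsf H}_\alpha(\mathbf X,\mathbf Y):=c_\alpha^2\int_0^\infty\!\!\int_0^\infty\mathbb E\Bigl|\mathbb E\bigl(e^{\mathrm ir\boldsymbol\xi\cdot\mathbf X+\mathrm is\boldsymbol\eta\cdot\mathbf Y}\mid\boldsymbol\xi,\boldsymbol\eta\bigr)-\mathbb E\bigl(e^{\mathrm ir\boldsymbol\xi\cdot\mathbf X}\mid\boldsymbol\xi\bigr)\mathbb E\bigl(e^{\mathrm is\boldsymbol\eta\cdot\mathbf Y}\mid\boldsymbol\eta\bigr)\Bigr|^2\frac{dr\,ds}{r^{\alpha+1}s^{\alpha+1}}\in[0,\infty].$$ *)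

(* Defs.v *)
From HB Require Import structures.
From mathcomp Require Import all_boot all_order all_algebra.
From mathcomp Require Import sesquilinear complex.
From mathcomp Require Import all_classical all_reals all_analysis.
Set Implicit Arguments.
Unset Strict Implicit.
Unset Printing Implicit Defensive.
Import Order.TTheory GRing.Theory Num.Theory.
Import numFieldNormedType.Exports.
Local Open Scope classical_set_scope.
Local Open Scope ring_scope.

HB.mixin Record NormedModule_isHilbert (R : realType) H
    & CompleteNormedModule R H := {
  inner : {dot H for (@idfun R)} ;
  inner_norm : forall x : H, inner x x = `|x| ^+ 2 }.

#[short(type="hilbertType")]
HB.structure Definition Hilbert (R : realType) :=
  {H of NormedModule_isHilbert R H & CompleteNormedModule R H}.

Definition separable (T : topologicalType) :=
  exists2 D : set T, countable D & dense D.

Definition borel (H : ptopologicalType) := g_sigma_algebraType (@open H).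

(* The dimension of a separable Hilbert space: [Some n] is n, [None] is
   countably infinite. Basis vectors are numbered from 0. *)
Definition in_dim (d : option nat) (i : nat) : bool :=
  if d is Some n then (i < n)%N else true.

Definition lin_span (R : realType) (H : hilbertType R) (d : option nat)
    (e : nat -> H) : set H :=
  [set x | exists (n : nat) (a : nat -> R),
     x = \sum_(0 <= i < n | in_dim d i) a i *: e i].

(* The values e i with i outside the dimension are irrelevant. *)
Definition orthonormal_basis (R : realType) (H : hilbertType R)
    (d : option nat) (e : nat -> H) : Prop :=
  (forall i j, in_dim d i -> in_dim d j -> inner (e i) (e j) = (i == j)%:R) /\
  closure (lin_span d e) = setT.

Section probability.
Context d (T : measurableType d) (R : realType).
Implicit Types (P : probability T R) (G : set (set T)).

Definition pair_fun (A B : Type) (X : T -> A) (Y : T -> B) : T -> A * B :=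
  fun w => (X w, Y w).

Definition independent_RV P dA (A : measurableType dA) dB
    (B : measurableType dB) (X : {RV P >-> A}) (Y : {RV P >-> B}) : Prop :=
  forall U V, measurable U -> measurable V ->
    P (X @^-1` U `&` Y @^-1` V) = (P (X @^-1` U) * P (Y @^-1` V))%E.

Definition mutually_independent P (I : eqType) (D : set I)
    (F : I -> set (set T)) : Prop :=
  forall (J : seq I) (E : I -> set T), uniq J ->
    (forall i, i \in J -> D i /\ F i (E i)) ->
    P (\big[setI/setT]_(i <- J) E i) = (\prod_(i <- J) P (E i))%E.

Definition sigma_pair dA (A : measurableType dA) dB (B : measurableType dB)
    (X : T -> A) (Y : T -> B) : set (set T) :=
  g_sigma_algebra_preimage (pair_fun X Y).

Definition sigma_seq (D : set nat) (xi : nat -> T -> R) : set (set T) :=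
  <<s \bigcup_(i in D) g_sigma_algebra_preimage (xi i) >>.

Definition is_cond_exp P G (Z W : T -> R) : Prop :=
  [/\ forall B, measurable B -> G (W @^-1` B),
      P.-integrable setT (EFin \o W) &
      forall A, G A ->
        (\int[P]_(w in A) (W w)%:E = \int[P]_(w in A) (Z w)%:E)%E].

(* A version of E(Z | G); it exists, and is a.s. unique, when G is a
   sub-sigma-algebra and Z is integrable. *)
Definition cond_exp P G (Z : T -> R) : T -> R :=
  xget (cst 0) [set W | is_cond_exp P G Z W].

Definition ccond_exp P G (Z : T -> R[i]) : T -> R[i] :=
  fun w => Complex (cond_exp P G (fun w' => complex.Re (Z w')) w)
                   (cond_exp P G (fun w' => complex.Im (Z w')) w).

Definition moment P (H : normedModType R) (X : {RV P >-> borel H}) (p : R) :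
    \bar R :=
  'E_P[fun w => (`|X w : H| `^ p)%R]%E.

End probability.

Definition same_law (R : realType) dT (T : measurableType dT)
    (P : probability T R) dS (S : measurableType dS) (Q : probability S R)
    dA (A : measurableType dA) (f : T -> A) (g : S -> A) : Prop :=
  forall U, measurable U -> P (f @^-1` U) = Q (g @^-1` U).

(* The product sigma-algebra used for the pairs is the Borel one of H * H' when
   H and H' are separable. The copies may live on another probability space. *)
Definition independent_copies (R : realType) (H H' : normedModType R)
    dT (T : measurableType dT) (P : probability T R)
    (X : {RV P >-> borel H}) (Y : {RV P >-> borel H'})
    dS (S : measurableType dS) (Q : probability S R)
    (Xs : nat -> {RV Q >-> borel H}) (Ys : nat -> {RV Q >-> borel H'}) : Prop :=
  (forall i, same_law P Q (pair_fun X Y) (pair_fun (Xs i) (Ys i))) /\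
  mutually_independent Q setT (fun i => sigma_pair (Xs i) (Ys i)).

Section dcov.
Context (R : realType) (H H' : normedModType R) (alpha : R).
Context dS (S : measurableType dS) (Q : probability S R).
Local Open Scope ereal_scope.

(* The copies X_1, X_2, X_3, X_4 have indices 0, 1, 2, 3. *)
Definition dist_pow (K : normedModType R) (Z : nat -> {RV Q >-> borel K})
    (i j : nat) : S -> R :=
  (fun w => `|(Z i w : K) - (Z j w : K)| `^ alpha)%R.

Definition hat (K : normedModType R) (Z : nat -> {RV Q >-> borel K}) : S -> R :=
  (fun w => dist_pow Z 0 1 w - dist_pow Z 1 2 w
          + dist_pow Z 2 3 w - dist_pow Z 3 0 w)%R.

Definition tilde (K : normedModType R) (Z : nat -> {RV Q >-> borel K}) :
    S -> R :=
  cond_exp Q (sigma_pair (Z 0%N) (Z 1%N)) (hat Z).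

Variables (X : nat -> {RV Q >-> borel H}) (Y : nat -> {RV Q >-> borel H'}).

Definition dcov_star : \bar R :=
  'E_Q[fun w => (dist_pow X 0 1 w * dist_pow Y 0 1 w)%R]
  + 'E_Q[dist_pow X 0 1] * 'E_Q[dist_pow Y 0 1]
  - 2%:E * 'E_Q[fun w => (dist_pow X 0 1 w * dist_pow Y 0 2 w)%R].

Definition dcov_hat : \bar R :=
  (4^-1)%:E * 'E_Q[fun w => (hat X w * hat Y w)%R].

Definition dcov_tilde : \bar R := 'E_Q[fun w => (tilde X w * tilde Y w)%R].

End dcov.

Definition Gamma (R : realType) (x : R) : R :=
  \int[lebesgue_measure]_(t in `]0, +oo[) (t `^ (x - 1) * expR (- t)).

Definition c_alpha (R : realType) (alpha : R) : R :=
  alpha * 2 `^ (alpha / 2) / Gamma (1 - alpha / 2).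

Definition expi (R : realType) (t : R) : R[i] := Complex (cos t) (sin t).

Section dcovH.
Context (R : realType) (H H' : hilbertType R) (alpha : R).
Context dS (S : measurableType dS) (Q : probability S R).
Variables (X : {RV Q >-> borel H}) (Y : {RV Q >-> borel H'}).
Variables (dim : option nat) (e : nat -> H) (xi : nat -> {RV Q >-> R}).
Variables (dim' : option nat) (e' : nat -> H') (eta : nat -> {RV Q >-> R}).

Definition standard_normal (Z : {RV Q >-> R}) : Prop :=
  forall A, measurable A -> distribution Q Z A = normal_prob 0 1 A.

(* The index None stands for the pair (X, Y). *)
Definition gaussian_setup : Prop :=
  [/\ forall i, in_dim dim i -> standard_normal (xi i),
      forall j, in_dim dim' j -> standard_normal (eta j) &
      mutually_independent Q
        [set k : option (nat + nat) | match k with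
         | None => True
         | Some (inl i) => in_dim dim i
         | Some (inr j) => in_dim dim' j
         end]
        (fun k => match k with
         | None => sigma_pair X Y
         | Some (inl i) => g_sigma_algebra_preimage (xi i)
         | Some (inr j) => g_sigma_algebra_preimage (eta j)
         end)].

(* The series converges a.s.; [limn] is 0 where it does not converge. *)
Definition gauss_dot (K : hilbertType R) (dm : option nat) (b : nat -> K)
    (g : nat -> {RV Q >-> R}) (x : K) (w : S) : R :=
  limn (fun n => \sum_(0 <= i < n | in_dim dm i) inner x (b i) * g i w).

Definition sigma_xi := sigma_seq [set i | in_dim dim i] xi.
Definition sigma_eta := sigma_seq [set j | in_dim dim' j] eta.
Definition sigma_xi_eta := <<s sigma_xi `|` sigma_eta >>.
Definition xiX (w : S) : R := gauss_dot dim e xi (X w) w.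
Definition etaY (w : S) : R := gauss_dot dim' e' eta (Y w) w.

Definition cond_diff (r s : R) (w : S) : R[i] :=
  ccond_exp Q sigma_xi_eta (fun w' => expi (r * xiX w' + s * etaY w')) w
  - ccond_exp Q sigma_xi (fun w' => expi (r * xiX w')) w
    * ccond_exp Q sigma_eta (fun w' => expi (s * etaY w')) w.

Definition dcovH : \bar R :=
  ((c_alpha alpha ^+ 2)%:E *
   \int[lebesgue_measure]_(s in `]0%R, +oo[)
     \int[lebesgue_measure]_(r in `]0%R, +oo[)
       ('E_Q[fun w => (ComplexField.Normc.normc (cond_diff r s w) ^+ 2)%R]
        * ((r `^ (alpha + 1) * s `^ (alpha + 1))^-1)%:E))%E.

End dcovH.

(* Main.v *)
Require Import Defs.
From HB Require Import structures.
From mathcomp Require Import all_boot all_order all_algebra.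
From mathcomp Require Import sesquilinear.
From mathcomp Require Import all_classical all_reals all_analysis.
From mathcomp Require Import measurable_realfun ring lra zify.
Set Implicit Arguments.
Unset Strict Implicit.
Unset Printing Implicit Defensive.
Import Order.TTheory GRing.Theory Num.Theory.
Import numFieldNormedType.Exports.
Local Open Scope classical_set_scope.
Local Open Scope ring_scope.


(** Put b = alpha/2 and k_t(x,y) = e^(-t|x-y|^2). All four parts reduce to one fact about Gaussian
    kernels: if k_t(X,a) and k_s(Y,c) are uncorrelated for all t, s > 0 and all centres a, c, then X
    and Y are independent ([indep_gaussk]). Indeed a product of two Gaussians is a multiple of a
    Gaussian, so Gaussians and constants span an algebra. Since (1 - v^n)^(n 2^n) tends to the
    indicator of v < 1/2, bounded limits of elements of this algebra include the indicators of
    finite intersections of complements of closed balls, and these sets generate the Borel sets of a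
    separable space ([gaussk_determining]).

    Parts (1)-(3). Let hat4 h be h(x0,x1) - h(x1,x2) + h(x2,x3) - h(x3,x0). The integral of (1 -
    e^(-l e^u)) e^(-bu) over u is C l^b with C > 0 ([Rintegral_mix]). For l = |x-y|^2 the constant 1
    cancels in hat4, so hat4 of |x-y|^alpha is -1/C times the mixture over u of hat4 k_(e^u). Hence
    the expectation of the product of the two hats is C^(-2) times the double mixture of G(u,v), the
    expected product of hat4 k_(e^u) at four copies of X and hat4 k_(e^v) at four copies of Y. The
    product of two Gaussian kernels is positive semidefinite by Schur's theorem, and a
    Cauchy-Schwarz argument for it gives that G is at least the square of 2 cov(k(X,a), k(Y,c))
    ([gauss_cov_sqr_le]). If the double mixture of the nonnegative G vanishes, continuity makes G
    vanish one variable at a time, and with it all covariances ([centered_dcov0_indep]).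

    With alpha-moments only, the raw expansion of the product of the hats cannot be integrated term
    by term. Positivity of k_t also yields |hat4| <= 2 |x0-x2|^b |x1-x3|^b for the power alpha
    ([normr_hat4_dpow]). Averaging over x2 and x3 bounds the doubly centred distance by 2 m(x) m(y),
    where m(x) = E|x-X|^b and m(X) is square integrable. Since hat4 does not see the centring, the
    expansion is carried out with centred distances: every term is integrable and only the terms
    with twice the same pair of indices survive. So (2) and (3) both equal [centered_dcov], which is
    zero under independence because it factors into zero means. With moments of order 2 alpha the
    raw expansion is legitimate and (1) equals (2).

    Part (4). Conditioning on xi and eta means integrating over the law of (X,Y) with the Gaussian
    variables frozen ([is_cond_exp_freeze]). The mean squared modulus is continuous in (r,s), so a
    zero double integral makes the covariance of e^(ir xi.X) and e^(is eta.Y), for frozen xi and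
    eta, vanish almost surely for all r, s > 0. Multiplying the resulting factorization by e^(i(xi.a
    + eta.c)) and integrating out the Gaussian variables, with E e^(i xi.z) = e^(-|z|^2/2), gives
    uncorrelated Gaussian kernels again ([cov0_gaussian]). The series xi.z converges almost surely
    by Kolmogorov's maximal inequality ([kolmogorov_cvg]), and its variance is |z|^2 by Parseval
    ([fourier_sqr_cvg]). *)

(** * Integrals of real-valued functions *)

Section real_integral.
Context d (T : measurableType d) (R : realType) (mu : {measure set T -> \bar R}).
Implicit Types f g : T -> R.

Lemma integrable_le f g : measurable_fun setT f ->
  mu.-integrable setT (EFin \o g) -> (forall x, `|f x| <= g x) ->
  mu.-integrable setT (EFin \o f).
Proof.
move=> mf ig fg; apply: le_integrable ig => //; first exact/measurable_EFinP.
by move=> x _ /=; rewrite lee_fin (le_trans (fg x))// ler_norm.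
Qed.

Lemma integrable_measurable f : mu.-integrable setT (EFin \o f) ->
  measurable_fun setT f.
Proof. by move=> /measurable_int /measurable_EFinP. Qed.

Lemma integrableN_EFin f : mu.-integrable setT (EFin \o f) ->
  mu.-integrable setT (EFin \o (fun x => - f x)).
Proof.
move=> intf; rewrite (_ : _ \o _ = \- (EFin \o f))%E; last exact/funext.
exact: integrableN.
Qed.

Lemma integrableD_EFin f g : mu.-integrable setT (EFin \o f) ->
  mu.-integrable setT (EFin \o g) ->
  mu.-integrable setT (EFin \o (fun x => f x + g x)).
Proof.
move=> intf intg.
rewrite (_ : _ \o _ = (EFin \o f) \+ (EFin \o g))%E; last exact/funext.
exact: integrableD.
Qed.

Lemma integrableB_EFin f g : mu.-integrable setT (EFin \o f) ->
  mu.-integrable setT (EFin \o g) ->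
  mu.-integrable setT (EFin \o (fun x => f x - g x)).
Proof. by move=> intf /integrableN_EFin; exact: integrableD_EFin. Qed.

Lemma integrableZ_EFin a f : mu.-integrable setT (EFin \o f) ->
  mu.-integrable setT (EFin \o (fun x => a * f x)).
Proof.
move=> intf; rewrite (_ : _ \o _ = (fun x => a%:E * (EFin \o f) x))%E; last first.
  exact/funext.
exact: integrableZl.
Qed.

Lemma integrable_sum_EFin (I : eqType) (s : seq I) (F : I -> T -> R) :
  (forall i, i \in s -> mu.-integrable setT (EFin \o F i)) ->
  mu.-integrable setT (EFin \o (fun x => \sum_(i <- s) F i x)).
Proof.
elim: s => [|i s IH] intF.
  under [X in _ \o X]eq_fun do rewrite big_nil.
  exact: integrable0.
under [X in _ \o X]eq_fun do rewrite big_cons.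
apply: integrableD_EFin; first by apply: intF; exact: mem_head.
by apply: IH => j js; apply: intF; rewrite inE js orbT.
Qed.

Lemma Rintegral_sum (I : eqType) (s : seq I) (F : I -> T -> R) :
  (forall i, i \in s -> mu.-integrable setT (EFin \o F i)) ->
  \int[mu]_x (\sum_(i <- s) F i x) = \sum_(i <- s) \int[mu]_x F i x.
Proof.
elim: s => [|i s IH] intF.
  under eq_Rintegral do rewrite big_nil.
  by rewrite big_nil Rintegral_cst// mul0r.
have intFs j : j \in s -> mu.-integrable setT (EFin \o F j).
  by move=> js; apply: intF; rewrite inE js orbT.
under eq_Rintegral do rewrite big_cons.
rewrite big_cons RintegralD// ?IH//; last exact: integrable_sum_EFin.
by apply: intF; exact: mem_head.
Qed.

Lemma RintegralN f : mu.-integrable setT (EFin \o f) ->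
  \int[mu]_x (- f x) = - \int[mu]_x f x.
Proof.
move=> intf; under eq_Rintegral do rewrite -mulN1r.
by rewrite RintegralZl// mulN1r.
Qed.

Lemma EFin_Rintegral f : mu.-integrable setT (EFin \o f) ->
  (\int[mu]_x (f x)%:E = (\int[mu]_x f x)%:E)%E.
Proof. by move=> intf; rewrite /Rintegral fineK//; exact: integrable_fin_num. Qed.

Lemma ge0_integrable_EFin f : measurable_fun setT f -> (forall x, 0 <= f x) ->
  (\int[mu]_x (f x)%:E < +oo)%E -> mu.-integrable setT (EFin \o f).
Proof.
move=> mf f0 foo; apply/integrableP; split; first exact/measurable_EFinP.
by under eq_integral => x _ do rewrite /= ger0_norm//.
Qed.

Lemma ae_dominated_cvg (f_ : nat -> T -> R) f g :
  (forall n, measurable_fun setT (f_ n)) -> measurable_fun setT f ->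
  {ae mu, forall x, f_ n x @[n --> \oo] --> f x} ->
  mu.-integrable setT (EFin \o g) -> (forall n x, `|f_ n x| <= g x) ->
  \int[mu]_x f_ n x @[n --> \oo] --> \int[mu]_x f x.
Proof.
move=> mf_ mf cvf ig fg.
have [|||||intf _ cvi] := @dominated_convergence _ _ _ mu setT measurableT
  (fun n => EFin \o f_ n) (EFin \o f) (EFin \o g).
- by move=> n; exact/measurable_EFinP.
- exact/measurable_EFinP.
- apply: filterS cvf => x cvx _ /=.
  exact/cvg_EFin/cvx/nearW.
- by [].
- by apply: aeW => x n _; rewrite lee_fin.
by apply: fine_cvg; rewrite -EFin_Rintegral.
Qed.

Lemma dominated_cvg (f_ : nat -> T -> R) f g :
  (forall n, measurable_fun setT (f_ n)) ->
  (forall x, f_ n x @[n --> \oo] --> f x) ->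
  mu.-integrable setT (EFin \o g) -> (forall n x, `|f_ n x| <= g x) ->
  \int[mu]_x f_ n x @[n --> \oo] --> \int[mu]_x f x.
Proof.
move=> mf_ cvf ig fg; apply: ae_dominated_cvg ig fg => //; last exact: aeW.
by apply: measurable_fun_cvg => // x _; exact: cvf.
Qed.

(** The sets over which [f] integrates to zero form a Dynkin system: complements use that the total
    integral is zero, disjoint unions use countable additivity. *)
Lemma Rintegral_pi_lambda f (G : set (set T)) : setI_closed G ->
  G `<=` measurable -> mu.-integrable setT (EFin \o f) ->
  \int[mu]_x f x = 0 -> (forall A, G A -> \int[mu]_(x in A) f x = 0) ->
  forall A, <<s G >> A -> \int[mu]_(x in A) f x = 0.
Proof.
move=> GI Gm intf f0 Gf0.
suff: <<s G >> `<=` [set A | measurable A /\ \int[mu]_(x in A) f x = 0].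
  by move=> sub A /sub[].
have intA A : measurable A -> mu.-integrable A (EFin \o f).
  by move=> mA; exact: integrableS intf.
apply: lambda_system_subset => //.
- apply/dynkin_lambda_system; split => //.
  + move=> A [mA A0]; split; first exact: measurableC.
    have dA : [disjoint A & ~` A]%classic by rewrite disj_set2E setICr.
    have intAC : mu.-integrable (A `|` ~` A) (EFin \o f) by rewrite setUv.
    have := Rintegral_setU mA (measurableC mA) intAC dA.
    by rewrite setUv f0 [X in _ = X + _]A0 add0r => <-.
  + move=> F tF FP; have mF n := (FP n).1; split.
      exact: bigcup_measurable.
    rewrite /Rintegral integral_bigcup//; last exact/intA/bigcup_measurable.
    rewrite eseries0// => n _ _.
    have := (FP n).2; rewrite /Rintegral => Fn0.
    by rewrite -[LHS]fineK ?Fn0//; exact/integrable_fin_num/intA.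
- by move=> A GA; split; [exact: Gm|exact: Gf0].
Qed.

Lemma Rintegral_eq0 f : (forall x, 0 <= f x) ->
  mu.-integrable setT (EFin \o f) -> \int[mu]_x f x = 0 ->
  {ae mu, forall x, f x = 0}.
Proof.
move=> f0 intf if0.
have mf := integrable_measurable intf.
have mEf : measurable_fun setT (EFin \o f) by exact/measurable_EFinP.
have [+ _] := ae_eq_integral_abs mu measurableT mEf.
have -> : (\int[mu]_x `|(EFin \o f) x| = 0)%E.
  under eq_integral => x _ do rewrite /= ger0_norm//.
  by rewrite EFin_Rintegral// if0.
by move=> /(_ erefl); apply: filterS => x /(_ I) /= [].
Qed.

End real_integral.

Lemma measurable_preimage dS (S : measurableType dS) dA (A : measurableType dA)
    (U : S -> A) (B : set A) :
  measurable_fun setT U -> measurable B -> measurable (U @^-1` B).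
Proof. by move=> mU mB; rewrite -[X in measurable X]setTI; exact: mU. Qed.

Lemma measurable_integral_pushforward dS (S : measurableType dS) dA
    (A : measurableType dA) (R : realType) (mu : {measure set S -> \bar R})
    (U : S -> A) (f : A -> \bar R) :
  measurable_fun setT U -> measurable_fun setT f ->
  (\int[pushforward mu U]_x f x = \int[mu]_w f (U w))%E.
Proof.
move=> mU mf; rewrite [LHS]integralE [RHS]integralE.
congr (_ - _)%E.
  rewrite (ge0_integral_pushforward mU)//; last exact: measurable_funepos.
  by apply: eq_integral => x _; rewrite /= !funeposE.
rewrite (ge0_integral_pushforward mU)//; last exact: measurable_funeneg.
by apply: eq_integral => x _; rewrite /= !funenegE.
Qed.

(** * Independence and Fubini's theorem *)

Section independence.
Context dS (S : measurableType dS) (R : realType) (Q : probability S R).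

Lemma integrable_bounded (f : S -> R) (M : R) : measurable_fun setT f ->
  (forall x, `|f x| <= M) -> Q.-integrable setT (EFin \o f).
Proof.
move=> mf fM; apply: (integrable_le mf _ fM).
by apply/finite_measure_integrable_cst; rewrite /cst.
Qed.

Lemma integrable_probability_cst (r : R) : Q.-integrable setT (EFin \o (fun=> r)).
Proof. exact: (@integrable_bounded _ `|r|). Qed.

Lemma Rintegral_probability_cst (r : R) : \int[Q]_x r = r.
Proof. by rewrite Rintegral_cst// [X in fine X]probability_setT mulr1. Qed.

Lemma EFin_probability (A : set S) : measurable A -> Q A = (fine (Q A))%:E.
Proof. by move=> mA; rewrite fineK// fin_num_measure. Qed.

Lemma eq_integral_EFin (A : set S) (f g : S -> R) : measurable A ->
  Q.-integrable setT (EFin \o f) -> Q.-integrable setT (EFin \o g) ->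
  \int[Q]_(x in A) f x = \int[Q]_(x in A) g x ->
  (\int[Q]_(x in A) (f x)%:E = \int[Q]_(x in A) (g x)%:E)%E.
Proof.
move=> mA intf intg fg.
have intfA : Q.-integrable A (EFin \o f) by exact: integrableS intf.
have intgA : Q.-integrable A (EFin \o g) by exact: integrableS intg.
rewrite -[LHS]fineK; last exact: integrable_fin_num intfA.
rewrite -[RHS]fineK; last exact: integrable_fin_num intgA.
by congr EFin.
Qed.

Lemma Rintegral_indicI (A B : set S) : measurable A -> measurable B ->
  \int[Q]_(x in A) (\1_B x : R) = fine (Q (A `&` B)).
Proof. by move=> mA mB; rewrite /Rintegral integral_indic// setIC. Qed.

(** Independence from [D] says that the indicator of [D] minus its probability integrates to zero
    over each event, which is the situation of [Rintegral_pi_lambda]. *)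
Lemma indep_half (G : set (set S)) (D : set S) :
  setI_closed G -> G `<=` measurable -> measurable D ->
  (forall C, G C -> Q (C `&` D) = (Q C * Q D)%E) ->
  forall C, <<s G >> C -> Q (C `&` D) = (Q C * Q D)%E.
Proof.
move=> GI Gm mD GD C GC.
have sGm : <<s G >> `<=` measurable.
  by apply: smallest_sub => //; exact: sigma_algebra_measurable.
pose f x : R := \1_D x - fine (Q D).
have int1 : Q.-integrable setT (EFin \o \1_D).
  by apply: (@integrable_bounded _ 1) => // x; rewrite indicE; case: (_ \in _);
    rewrite ?normr1// normr0.
have intc : Q.-integrable setT (EFin \o (fun _ => fine (Q D))).
  exact: (@integrable_bounded _ `|fine (Q D)|).
have intf : Q.-integrable setT (EFin \o f) by exact: integrableB_EFin.
have fE A : measurable A ->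
    \int[Q]_(x in A) f x = fine (Q (A `&` D)) - fine (Q D) * fine (Q A).
  move=> mA; rewrite RintegralB//; [|exact: integrableS int1|exact: integrableS intc].
  by rewrite Rintegral_indicI// Rintegral_cst.
have H A : measurable A ->
    \int[Q]_(x in A) f x = 0 <-> Q (A `&` D) = (Q A * Q D)%E.
  move=> mA; rewrite fE// [Q (A `&` D)]EFin_probability; last exact: measurableI.
  rewrite (EFin_probability mA) (EFin_probability mD) -EFinM/=.
  split=> [/eqP|[->]]; last by rewrite mulrC subrr.
  by rewrite subr_eq0 => /eqP ->; rewrite mulrC.
apply/H; first exact: sGm.
apply: Rintegral_pi_lambda GC => //.
  by apply/H => //; rewrite setTI probability_setT mul1e.
by move=> A GA; apply/H; [exact: Gm|exact: GD].
Qed.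

(* Independence of generating pi-systems extends to the generated sigma-algebras. *)
Lemma indep_g_sigma (G1 G2 : set (set S)) :
  setI_closed G1 -> setI_closed G2 -> G1 `<=` measurable -> G2 `<=` measurable ->
  (forall C D, G1 C -> G2 D -> Q (C `&` D) = (Q C * Q D)%E) ->
  forall C D, <<s G1 >> C -> <<s G2 >> D -> Q (C `&` D) = (Q C * Q D)%E.
Proof.
move=> G1I G2I G1m G2m H C D GC GD.
have sG2m : <<s G2 >> `<=` measurable.
  by apply: smallest_sub => //; exact: sigma_algebra_measurable.
apply: indep_half GC => //; first exact: sG2m.
move=> {}C GC; rewrite setIC muleC; apply: indep_half GD => //; first exact: G1m.
by move=> {}D GD; rewrite setIC muleC; exact: H.
Qed.

(** Stated for bare functions rather than bundled random variables, so that it applies to pairs,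
    compositions, and the identity map onto the same space with a smaller sigma-algebra; the last
    expresses independence from a sigma-algebra. *)
Definition indep dA (A : measurableType dA) dB (B : measurableType dB)
    (U : S -> A) (V : S -> B) :=
  forall C D, measurable C -> measurable D ->
    Q (U @^-1` C `&` V @^-1` D) = (Q (U @^-1` C) * Q (V @^-1` D))%E.

Lemma indepC dA (A : measurableType dA) dB (B : measurableType dB)
    (U : S -> A) (V : S -> B) : indep U V -> indep V U.
Proof. by move=> UV C D mC mD; rewrite setIC muleC UV. Qed.

Lemma indep_comp dA (A : measurableType dA) dB (B : measurableType dB)
    dA' (A' : measurableType dA') dB' (B' : measurableType dB')
    (U : S -> A) (V : S -> B) (f : A -> A') (g : B -> B') :
  measurable_fun setT f -> measurable_fun setT g ->
  indep U V -> indep (f \o U) (g \o V).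
Proof.
move=> mf mg UV C D mC mD.
exact: (UV _ _ (measurable_preimage mf mC) (measurable_preimage mg mD)).
Qed.

Section rectangles.
Context dA (A : measurableType dA) dB (B : measurableType dB).

Definition rectangles (U : S -> A) (V : S -> B) : set (set S) :=
  [set E | exists C D, [/\ measurable C, measurable D & E = U @^-1` C `&` V @^-1` D]].

Lemma setI_closed_rectangles (U : S -> A) (V : S -> B) :
  setI_closed (rectangles U V).
Proof.
move=> _ _ [C [D [mC mD ->]]] [C' [D' [mC' mD' ->]]].
exists (C `&` C'), (D `&` D'); split; try exact: measurableI.
by rewrite !preimage_setI setIACA.
Qed.

Lemma rectangles_measurable (U : S -> A) (V : S -> B) :
  measurable_fun setT U -> measurable_fun setT V ->
  rectangles U V `<=` measurable.
Proof.
by move=> mU mV _ [C [D [mC mD ->]]]; apply: measurableI; exact: measurable_preimage.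
Qed.

Lemma preimage_pair_g_sigma (U : S -> A) (V : S -> B) (E : set (A * B)) :
  measurable E -> <<s rectangles U V >> ((fun w => (U w, V w)) @^-1` E).
Proof.
rewrite measurable_prod_measurableType => mE.
have -> : <<s rectangles U V >> = preimage_set_system setT (fun w => (U w, V w))
    (<<s [set C `*` D | C in measurable & D in measurable] >>).
  rewrite -g_sigma_preimageE; congr (<<s _ >>); apply/seteqP; split.
    move=> _ [C [D [mC mD ->]]]; exists (C `*` D).
      by exists C => //; exists D.
    by rewrite setTI; apply/seteqP; split.
  move=> _ [_ [C mC [D mD <-]] <-]; exists C, D; split => //.
  by rewrite setTI; apply/seteqP; split.
by exists E => //; rewrite setTI.
Qed.

End rectangles.

Lemma indep_pair dA (A : measurableType dA) dB (B : measurableType dB)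
    dA' (A' : measurableType dA') dB' (B' : measurableType dB')
    (U : S -> A) (V : S -> B) (U' : S -> A') (V' : S -> B') :
  measurable_fun setT U -> measurable_fun setT V ->
  measurable_fun setT U' -> measurable_fun setT V' ->
  (forall C D C' D', measurable C -> measurable D -> measurable C' ->
     measurable D' -> Q ((U @^-1` C `&` V @^-1` D) `&` (U' @^-1` C' `&` V' @^-1` D')) =
     (Q (U @^-1` C `&` V @^-1` D) * Q (U' @^-1` C' `&` V' @^-1` D'))%E) ->
  indep (fun w => (U w, V w)) (fun w => (U' w, V' w)).
Proof.
move=> mU mV mU' mV' H C D mC mD.
apply: (@indep_g_sigma (rectangles U V) (rectangles U' V')).
- exact: setI_closed_rectangles.
- exact: setI_closed_rectangles.
- exact: rectangles_measurable.
- exact: rectangles_measurable.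
- move=> _ _ [C1 [D1 [mC1 mD1 ->]]] [C2 [D2 [mC2 mD2 ->]]]; exact: H.
- exact: preimage_pair_g_sigma.
- exact: preimage_pair_g_sigma.
Qed.

Section fubini.
Context dA (A : measurableType dA) dB (B : measurableType dB).
Variables (U : S -> A) (V : S -> B).
Hypotheses (mU : measurable_fun setT U) (mV : measurable_fun setT V).
Hypothesis UV : indep U V.

Let Um : {mfun S >-> A} := mfun_Sub (mem_set mU).
Let Vm : {mfun S >-> B} := mfun_Sub (mem_set mV).
Let mW : measurable_fun setT (fun w => (U w, V w)).
Proof. exact: measurable_fun_pair. Qed.
Let Wm : {mfun S >-> (A * B)%type} := mfun_Sub (mem_set mW).

Let joint_law (E : set (A * B)) : measurable E ->
  (distribution Q Um \x distribution Q Vm)%E E = distribution Q Wm E.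
Proof.
move=> mE; apply: product_measure_unique => // C D mC mD; exact: UV.
Qed.

(** Independence makes the joint law the product of the marginal laws, so Tonelli applies. Both
    integrals are taken over [Q] itself, the second sample point playing an independent copy. *)
Lemma ge0_integral_indep (f : A * B -> \bar R) :
  measurable_fun setT f -> (forall x, 0 <= f x)%E ->
  (\int[Q]_w f (U w, V w) = \int[Q]_w \int[Q]_w' f (U w, V w'))%E.
Proof.
move=> mf f0.
transitivity (\int[distribution Q Wm]_x f x)%E.
  by rewrite ge0_integral_pushforward.
transitivity (\int[distribution Q Um \x distribution Q Vm]_x f x)%E.
  by apply: eq_measure_integral => E mE _; exact/esym/joint_law.
rewrite fubini_tonelli1// ge0_integral_pushforward//=; last 2 first.
- exact: measurable_fun_fubini_tonelli_F.
- by move=> x _; exact: integral_ge0.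
apply: eq_integral => w _ /=; rewrite /fubini_F ge0_integral_pushforward//=.
exact: measurableT_comp.
Qed.

Lemma integrable_indep_law (f : A * B -> R) : measurable_fun setT f ->
  Q.-integrable setT (EFin \o (fun w => f (U w, V w))) ->
  (distribution Q Um \x distribution Q Vm)%E.-integrable setT (EFin \o f).
Proof.
move=> mf /integrableP[_ foo]; apply/integrableP; split; first exact/measurable_EFinP.
rewrite (@eq_measure_integral _ _ _ _ (distribution Q Wm)); last first.
  by move=> E mE _; exact: joint_law.
rewrite ge0_integral_pushforward//.
by apply: measurableT_comp => //; exact/measurable_EFinP.
Qed.

Lemma Rintegral_indep (f : A * B -> R) : measurable_fun setT f ->
  Q.-integrable setT (EFin \o (fun w => f (U w, V w))) ->
  \int[Q]_w f (U w, V w) = \int[Q]_w \int[Q]_w' f (U w, V w').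
Proof.
move=> mf intf; have intp := integrable_indep_law mf intf.
have mEf : measurable_fun setT (EFin \o f) by exact/measurable_EFinP.
rewrite {1}/Rintegral.
have -> : (\int[Q]_w (f (U w, V w))%:E = \int[distribution Q Wm]_x (EFin \o f) x)%E.
  by rewrite integral_pushforward.
rewrite -(@eq_measure_integral _ _ _ _ _ (distribution Q Um \x distribution Q Vm)%E); last first.
  by move=> E mE _; exact: joint_law.
rewrite -integral12_prod_meas1//; congr fine.
have intF := integrable_fubini_F intp.
have mF := measurable_fubini_F intp.
(* The inner integral may be infinite on a null set, where [fine] replaces it by 0; hence an almost
   everywhere comparison. *)
transitivity (\int[distribution Q Um]_x (fine (fubini_F (distribution Q Vm) (EFin \o f) x))%:E)%E.
  apply: ae_eq_integral => //.
    by apply/measurable_EFinP; exact: measurableT_comp.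
  have := integrable_ae measurableT intF.
  by apply: filterS => x /(_ I) fx _; rewrite fineK.
rewrite measurable_integral_pushforward//; last first.
  by apply/measurable_EFinP; exact: measurableT_comp.
apply: eq_integral => w _; congr EFin; congr fine.
rewrite /fubini_F measurable_integral_pushforward//.
exact: measurableT_comp.
Qed.

Lemma measurable_Rintegral_indep (f : A * B -> R) : measurable_fun setT f ->
  Q.-integrable setT (EFin \o (fun w => f (U w, V w))) ->
  measurable_fun setT (fun x => \int[Q]_w' f (x, V w')).
Proof.
move=> mf intf; have intp := integrable_indep_law mf intf.
have mEf : measurable_fun setT (EFin \o f) by exact/measurable_EFinP.
have := measurable_fubini_F intp.
rewrite (_ : fubini_F _ _ = fun x => \int[Q]_w' (f (x, V w'))%:E)%E; last first.
  apply/funext => x; rewrite /fubini_F measurable_integral_pushforward//.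
  exact: measurableT_comp.
by move=> mF; exact: measurableT_comp.
Qed.

Lemma integrable_Rintegral_indep (f : A * B -> R) : measurable_fun setT f ->
  Q.-integrable setT (EFin \o (fun w => f (U w, V w))) ->
  Q.-integrable setT (EFin \o (fun w => \int[Q]_w' f (U w, V w'))).
Proof.
move=> mf intf; have intp := integrable_indep_law mf intf.
have mEf : measurable_fun setT (EFin \o f) by exact/measurable_EFinP.
have mI := measurable_Rintegral_indep mf intf.
apply/integrableP; split.
  by apply/measurable_EFinP; exact: (measurableT_comp mI).
have /integrableP[_] := integrable_fubini_F intp.
rewrite measurable_integral_pushforward//; last first.
  by apply: measurableT_comp => //; exact: measurable_fubini_F intp.
apply: le_lt_trans; apply: ge0_le_integral => //.
- apply: measurableT_comp => //; apply/measurable_EFinP.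
  exact: (measurableT_comp mI).
- apply: measurableT_comp => //; apply: measurableT_comp => //.
  exact: measurable_fubini_F intp.
move=> w _ /=; rewrite /fubini_F measurable_integral_pushforward//; last first.
  exact: measurableT_comp.
have fine_le (y : \bar R) : (`|(fine y)%:E| <= `|y|)%E.
  by case: y => [r||] //=; rewrite leey.
exact: fine_le.
Qed.

Lemma ge0_integrable_indep (f : A * B -> R) : measurable_fun setT f ->
  (forall x, 0 <= f x) ->
  (\int[Q]_w \int[Q]_w' (f (U w, V w'))%:E < +oo)%E ->
  Q.-integrable setT (EFin \o (fun w => f (U w, V w))).
Proof.
move=> mf f0 foo; apply: ge0_integrable_EFin => //.
  exact: (measurableT_comp mf).
have mEf : measurable_fun setT (EFin \o f) by exact/measurable_EFinP.
have f0' x : (0 <= (EFin \o f) x)%E by rewrite lee_fin.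
by rewrite (ge0_integral_indep mEf f0').
Qed.

End fubini.

Lemma integrableM_indep dA (A : measurableType dA) dB (B : measurableType dB)
    (U : S -> A) (V : S -> B) (f : A -> R) (g : B -> R) :
  measurable_fun setT U -> measurable_fun setT V -> indep U V ->
  measurable_fun setT f -> measurable_fun setT g ->
  Q.-integrable setT (EFin \o (fun w => f (U w))) ->
  Q.-integrable setT (EFin \o (fun w => g (V w))) ->
  Q.-integrable setT (EFin \o (fun w => f (U w) * g (V w))).
Proof.
move=> mU mV UV mf mg intf intg.
have mfg : measurable_fun setT (fun x : A * B => f x.1 * g x.2).
  by apply: measurable_funM; exact: measurableT_comp.
have mnfg : measurable_fun setT (fun x : A * B => `|f x.1 * g x.2|).
  exact: measurableT_comp.
suff intn : Q.-integrable setT (EFin \o (fun w => `|f (U w) * g (V w)|)).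
  apply: (integrable_le _ intn) => //.
  by apply: measurable_funM; exact: measurableT_comp.
apply: (ge0_integrable_indep mU mV UV
  (f := fun x => `|f x.1 * g x.2|)) => //=.
have inf' := integrable_norm intf; have ing' := integrable_norm intg.
rewrite (_ : (\int[Q]_w _ = \int[Q]_w (`|f (U w)| * \int[Q]_w' `|g (V w')|)%:E)%E); last first.
  apply: eq_integral => w _.
  under eq_integral do rewrite normrM EFinM.
  rewrite integralZl//.
  by rewrite EFin_Rintegral.
under eq_integral do rewrite EFinM.
rewrite integralZr//.
by rewrite EFin_Rintegral // -EFinM ltry.
Qed.

Lemma RintegralM_indep dA (A : measurableType dA) dB (B : measurableType dB)
    (U : S -> A) (V : S -> B) (f : A -> R) (g : B -> R) :
  measurable_fun setT U -> measurable_fun setT V -> indep U V ->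
  measurable_fun setT f -> measurable_fun setT g ->
  Q.-integrable setT (EFin \o (fun w => f (U w))) ->
  Q.-integrable setT (EFin \o (fun w => g (V w))) ->
  \int[Q]_w (f (U w) * g (V w)) = \int[Q]_w f (U w) * \int[Q]_w g (V w).
Proof.
move=> mU mV UV mf mg intf intg.
rewrite (Rintegral_indep mU mV UV (f := fun x => f x.1 * g x.2))//=.
- under eq_Rintegral do rewrite RintegralZl//.
  by rewrite RintegralZr.
- by apply: measurable_funM; exact: measurableT_comp.
- exact: integrableM_indep.
Qed.

End independence.

(** * Transfer of integrals between equal laws *)

Section same_law.
Context dS (S : measurableType dS) dS' (S' : measurableType dS') (R : realType).
Context (P : probability S R) (Q : probability S' R).
Context dA (A : measurableType dA) (U : S -> A) (V : S' -> A).
Hypotheses (mU : measurable_fun setT U) (mV : measurable_fun setT V).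
Hypothesis UV : same_law P Q U V.

Lemma same_law_integral (f : A -> \bar R) : measurable_fun setT f ->
  (\int[P]_w f (U w) = \int[Q]_w f (V w))%E.
Proof.
move=> mf; rewrite -(measurable_integral_pushforward P mU mf).
rewrite -(measurable_integral_pushforward Q mV mf).
by apply: eq_measure_integral => E mE _; exact: UV.
Qed.

Lemma same_law_Rintegral (f : A -> R) : measurable_fun setT f ->
  \int[P]_w f (U w) = \int[Q]_w f (V w).
Proof.
move=> mf; rewrite /Rintegral (@same_law_integral (EFin \o f))//.
exact/measurable_EFinP.
Qed.

Lemma same_law_integrable (f : A -> R) : measurable_fun setT f ->
  P.-integrable setT (EFin \o (fun w => f (U w))) ->
  Q.-integrable setT (EFin \o (fun w => f (V w))).
Proof.
move=> mf /integrableP[_ foo]; apply/integrableP; split.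
  by apply/measurable_EFinP; exact: measurableT_comp.
rewrite -(@same_law_integral (fun x => `|(f x)%:E|%E))//.
by apply: measurableT_comp => //; exact/measurable_EFinP.
Qed.

End same_law.

(** * Existence and uniqueness of conditional expectations *)

Section conditional_expectation.
Context d (T : measurableType d) (R : realType) (Q : probability T R).
Variable G : set (set T).
Hypotheses (sG : sigma_algebra setT G) (Gm : G `<=` measurable).

Definition sub_measurable (W : T -> R) := forall B, measurable B -> G (W @^-1` B).

Let TG := g_sigma_algebraType G.

Let measTG (A : set T) : @measurable _ TG A = G A.
Proof.
rewrite propeqE; split; last by move=> GA; exact: sub_sigma_algebra.
by move=> mA; apply: mA; split.
Qed.

Lemma sub_measurableP (W : T -> R) :
  sub_measurable W <-> measurable_fun setT (W : TG -> R).
Proof.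
split=> [mW _ B mB|mW B mB]; first by rewrite setTI measTG; exact: mW.
by rewrite -measTG -[X in measurable X]setTI; exact: mW.
Qed.

Lemma sub_measurable_measurable (W : T -> R) :
  sub_measurable W -> measurable_fun setT W.
Proof. by move=> mW _ B mB; rewrite setTI; apply: Gm; exact: mW. Qed.

(** The difference is measurable for [G] and integrates to zero over the event where it is
    nonnegative and over the complement, so its absolute value has integral zero. *)
Lemma is_cond_exp_unique (Z W W' : T -> R) :
  is_cond_exp Q G Z W -> is_cond_exp Q G Z W' -> {ae Q, forall w, W w = W' w}.
Proof.
move=> [mW iW eW] [mW' iW' eW'].
pose f w := W w - W' w.
have mf : sub_measurable f.
  apply/sub_measurableP; apply: measurable_funB; exact/sub_measurableP.
have intf : Q.-integrable setT (EFin \o f) by exact: integrableB_EFin.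
have mfT := integrable_measurable intf.
have f0 A : G A -> \int[Q]_(w in A) f w = 0.
  move=> GA; have mA := Gm GA.
  rewrite RintegralB//; [|exact: integrableS iW|exact: integrableS iW'].
  by rewrite /Rintegral eW// eW'// subrr.
have Gp : G (f @^-1` `[0, +oo[) by exact: mf.
have Gn : G (~` (f @^-1` `[0, +oo[)).
  by rewrite -setTD; case: sG => _ + _; apply.
have intn : Q.-integrable setT (EFin \o (fun w => `|f w|)) by exact: integrable_norm.
have nf0 : \int[Q]_w `|f w| = 0.
  have mp := Gm Gp; have mn := Gm Gn.
  rewrite -(setUv (f @^-1` `[0, +oo[)) Rintegral_setU//; last 2 first.
  - by rewrite setUv.
  - by rewrite disj_set2E setICr.
  rewrite (_ : \int[Q]_(w in f @^-1` _) _ = \int[Q]_(w in f @^-1` `[0, +oo[) f w); last first.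
    apply: eq_Rintegral => w; rewrite inE/= in_itv/= andbT => fw.
    by rewrite ger0_norm.
  rewrite (_ : \int[Q]_(w in ~` _) _ = \int[Q]_(w in ~` (f @^-1` `[0, +oo[)) (- 1 * f w)); last first.
    apply: eq_Rintegral => w; rewrite inE/= in_itv/= andbT => /negP.
    by rewrite -ltNge mulN1r => fw; rewrite ltr0_norm.
  rewrite RintegralZl//; last exact: integrableS intf.
  by rewrite !f0// mulr0 addr0.
have := Rintegral_eq0 (fun w => normr_ge0 (f w)) intn nf0.
by apply: filterS => w /eqP; rewrite normr_eq0 subr_eq0 => /eqP.
Qed.

Lemma cond_exp_ae (Z W : T -> R) :
  is_cond_exp Q G Z W -> {ae Q, forall w, cond_exp Q G Z w = W w}.
Proof.
move=> cW; rewrite /cond_exp; case: xgetP => [V _ cV|/(_ W)//].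
exact: is_cond_exp_unique cV cW.
Qed.

(** Radon-Nikodym: the charge A -> integral of [Z] over A, restricted to [G], has a density with
    respect to the restriction of [Q]. Restriction is implemented as pushforward along the identity
    map into [TG]. *)
Lemma is_cond_exp_exists (Z : T -> R) : Q.-integrable setT (EFin \o Z) ->
  exists W, is_cond_exp Q G Z W.
Proof.
move=> intZ; have mZ := integrable_measurable intZ.
have mid : measurable_fun setT (id : T -> TG).
  by move=> _ A mA; rewrite setTI; apply: Gm; rewrite -measTG.
pose idm : {mfun T >-> TG} := mfun_Sub (mem_set mid).
pose QG : probability TG R := distribution Q idm.
pose nu_ := pushforward (induced_charge intZ) idm : {charge set TG -> \bar R}.
pose nu := nu_ mid.
have numu : nu `<< QG.
  apply/null_content_dominatesP => A mA QA0.
  rewrite /nu/= /pushforward/= /induced_charge/=.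
  have mA' : measurable (idm @^-1` A) by apply: Gm; rewrite -measTG.
  apply: null_set_integral => //.
  exact: measurable_funS (measurable_int _ intZ).
have irn : QG.-integrable setT (Radon_Nikodym nu QG) by exact: Radon_Nikodym_integrable.
have frn x : Radon_Nikodym nu QG x \is a fin_num by exact: Radon_Nikodym_fin_num.
have mrn := measurable_int _ irn.
pose W (w : T) : R := fine (Radon_Nikodym nu QG w).
have mW : measurable_fun setT (W : TG -> R) by exact: measurableT_comp.
have WE w : (W w)%:E = Radon_Nikodym nu QG w by rewrite fineK.
have iWG : QG.-integrable setT (EFin \o (W : TG -> R)).
  by rewrite (_ : _ \o _ = Radon_Nikodym nu QG)//; apply/funext => w; rewrite /= WE.
have mEW : measurable_fun setT (EFin \o (W : TG -> R)) by exact/measurable_EFinP.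
have iW : Q.-integrable setT (EFin \o W).
  apply/integrableP; split.
    apply/measurable_EFinP/sub_measurable_measurable.
    exact/sub_measurableP.
  have /integrableP[_] := iWG.
  rewrite ge0_integral_pushforward//.
  exact: measurableT_comp.
exists W; split => //; first exact/sub_measurableP.
move=> A GA; have mA : measurable (A : set TG) by rewrite measTG.
have mA' : measurable A := Gm GA.
transitivity (nu A); last by [].
rewrite (Radon_Nikodym_integral numu mA).
under [RHS]eq_integral do rewrite -WE.
have iWA : Q.-integrable (idm @^-1` A) ((EFin \o (W : TG -> R)) \o idm).
  exact: integrableS iW.
exact: (esym (integral_pushforward mid mEW iWA mA)).
Qed.

Lemma cond_expP (Z : T -> R) : Q.-integrable setT (EFin \o Z) ->
  is_cond_exp Q G Z (cond_exp Q G Z).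
Proof.
by move=> /is_cond_exp_exists[W cW]; rewrite /cond_exp; case: xgetP => [|/(_ W)//].
Qed.

Lemma measurable_cond_exp (Z : T -> R) : Q.-integrable setT (EFin \o Z) ->
  measurable_fun setT (cond_exp Q G Z).
Proof. by move=> /cond_expP[mW _ _]; exact: sub_measurable_measurable. Qed.

End conditional_expectation.

(** * Inner products and positive semidefinite kernels *)

Section inner_product.
Context (R : realType) (H : hilbertType R).
Implicit Types x y z : H.

Lemma innerC x y : inner x y = inner y x.
Proof. by rewrite hermC/= expr0 mul1r. Qed.

Lemma innerDl x y z : inner (x + y) z = inner x z + inner y z.
Proof. by rewrite linearDl. Qed.

Lemma innerDr x y z : inner z (x + y) = inner z x + inner z y.
Proof. by rewrite linearDr. Qed.

Lemma innerNl x y : inner (- x) y = - inner x y.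
Proof. by rewrite linearNl. Qed.

Lemma innerNr x y : inner x (- y) = - inner x y.
Proof. by rewrite linearNr. Qed.

Lemma innerZl a x y : inner (a *: x) y = a * inner x y.
Proof. by rewrite linearZl_LR. Qed.

Lemma innerZr a x y : inner x (a *: y) = a * inner x y.
Proof. by rewrite innerC innerZl innerC. Qed.

Definition innerE := (innerDl, innerDr, innerNl, innerNr, innerZl, innerZr).

Lemma sqr_normD x y : `|x + y| ^+ 2 = `|x| ^+ 2 + 2 * inner x y + `|y| ^+ 2.
Proof. by rewrite -!inner_norm !innerE (innerC y x); ring. Qed.

Lemma sqr_normB x y : `|x - y| ^+ 2 = `|x| ^+ 2 - 2 * inner x y + `|y| ^+ 2.
Proof. by rewrite -!inner_norm !innerE (innerC y x); ring. Qed.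

End inner_product.

Section positive_semidefinite_kernels.
Context (R : realType).

(** The list stands for a finite signed combination of point masses, repetitions allowed; the form
    is its squared norm in the space with reproducing kernel [K]. *)
Definition quad_form (Z : Type) (K : Z -> Z -> R) (l : seq (R * Z)) : R :=
  \sum_(p <- l) \sum_(q <- l) p.1 * q.1 * K p.2 q.2.

Definition psd (Z : Type) (K : Z -> Z -> R) := forall l, 0 <= quad_form K l.

Lemma psd_comp (Z W : Type) (f : W -> Z) (K : Z -> Z -> R) :
  psd K -> psd (fun w w' => K (f w) (f w')).
Proof.
move=> psdK l; have := psdK [seq (p.1, f p.2) | p <- l].
by rewrite /quad_form big_map; under eq_bigr do rewrite big_map.
Qed.

Lemma psd_scale (Z : Type) (f : Z -> R) (K : Z -> Z -> R) :
  psd K -> psd (fun z z' => f z * f z' * K z z').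
Proof.
move=> psdK l; have := psdK [seq (p.1 * f p.2, p.2) | p <- l].
rewrite /quad_form big_map; under eq_bigr do rewrite big_map/=.
congr (_ <= _); apply: eq_bigr => p _; apply: eq_bigr => q _.
by rewrite /=; ring.
Qed.

Lemma psdZ (Z : Type) (a : R) (K : Z -> Z -> R) :
  0 <= a -> psd K -> psd (fun z z' => a * K z z').
Proof.
move=> a0 psdK l; have := mulr_ge0 a0 (psdK l).
rewrite /quad_form mulr_sumr; congr (_ <= _); apply: eq_bigr => p _.
by rewrite mulr_sumr; apply: eq_bigr => q _; ring.
Qed.

Lemma psdD (Z : Type) (K L : Z -> Z -> R) :
  psd K -> psd L -> psd (fun z z' => K z z' + L z z').
Proof.
move=> psdK psdL l; have := addr_ge0 (psdK l) (psdL l).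
rewrite /quad_form -big_split/=; congr (_ <= _); apply: eq_bigr => p _.
by rewrite -big_split/=; apply: eq_bigr => q _; ring.
Qed.

Lemma psd_cst1 (Z : Type) : psd (fun _ _ : Z => 1).
Proof.
move=> l; rewrite /quad_form.
under eq_bigr => p _.
  under eq_bigr do rewrite mulr1.
  rewrite -mulr_sumr; over.
by rewrite -mulr_suml -expr2 sqr_ge0.
Qed.

Lemma psd_cvg (Z : Type) (K_ : nat -> Z -> Z -> R) (K : Z -> Z -> R) :
  (forall n, psd (K_ n)) ->
  (forall z z', K_ n z z' @[n --> \oo] --> K z z') -> psd K.
Proof.
move=> psdK cvgK l.
have : quad_form (K_ n) l @[n --> \oo] --> quad_form K l.
  rewrite /quad_form; apply: cvg_big; first exact: add_continuous.
    move=> p _; apply: cvg_big; first exact: add_continuous.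
    by move=> q _; apply: cvgM; [exact: cvg_cst|exact: cvgK].
move=> cvgq; rewrite -(cvg_lim _ cvgq)//.
apply: limr_ge; first exact: cvgP cvgq.
by apply: nearW => n; exact: psdK.
Qed.

(* [(z1 w, z2 w, b w)] stands for the functional delta_(z1 w) - b w delta_(z2 w). *)
Lemma psd_diff (Z W : Type) (z1 z2 : W -> Z) (b : W -> R) (K : Z -> Z -> R) :
  psd K -> psd (fun w w' => K (z1 w) (z1 w') - b w' * K (z1 w) (z2 w')
    - b w * K (z2 w) (z1 w') + b w * b w' * K (z2 w) (z2 w')).
Proof.
move=> psdK l.
have := psdK ([seq (p.1, z1 p.2) | p <- l] ++
              [seq (- (p.1 * b p.2), z2 p.2) | p <- l]).
rewrite /quad_form big_cat/= !big_map.
under eq_bigr do rewrite big_cat/= !big_map/=.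
under [X in _ + X]eq_bigr do rewrite big_cat/= !big_map/=.
rewrite -big_split/=; congr (_ <= _); apply: eq_bigr => p _.
rewrite -!big_split/=; apply: eq_bigr => q _.
by rewrite /=; ring.
Qed.

Section schur.
Context (H : hilbertType R).

(* Schur's product theorem: the part of the vectors along the first one
   contributes a reweighted form of [K], and the first vector then drops out. *)
Lemma psd_inner (Z : Type) (K : Z -> Z -> R) (x : Z -> H) :
  psd K -> psd (fun z z' => K z z' * inner (x z) (x z')).
Proof.
move=> psdK l; elim: l x => [|[c z0] l IH] x; first by rewrite /quad_form big_nil.
(* If [u] is zero, the quotient is 0 by convention and [y] equals [x], so the decomposition below
   still holds. *)
pose u := x z0; pose p z := inner (x z) u / `|u| ^+ 2.
pose y z := x z - p z *: u.
have yu z : inner (y z) u = 0.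
  rewrite /y /p !innerE inner_norm.
  have [->|u0] := eqVneq u 0; first by rewrite -[0 : H](scale0r 0) innerZr; ring.
  by rewrite divfK ?subrr// expf_neq0// normr_eq0.
have y0 : y z0 = 0.
  rewrite /y /p -/u; have [->|u0] := eqVneq u 0; first by rewrite scaler0 subr0.
  by rewrite inner_norm divff ?expf_neq0 ?normr_eq0// scale1r subrr.
have xd z : x z = y z + p z *: u by rewrite /y subrK.
clearbody y.
have xE z z' : inner (x z) (x z') = p z * p z' * `|u| ^+ 2 + inner (y z) (y z').
  rewrite [in LHS](xd z) [in LHS](xd z') !innerE inner_norm (innerC u) !yu.
  by ring.
have -> : quad_form (fun z z' => K z z' * inner (x z) (x z')) ((c, z0) :: l) =
    `|u| ^+ 2 * quad_form (fun z z' => p z * p z' * K z z') ((c, z0) :: l)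
    + quad_form (fun z z' => K z z' * inner (y z) (y z')) ((c, z0) :: l).
  rewrite /quad_form mulr_sumr -big_split/=; apply: eq_bigr => q _.
  rewrite mulr_sumr -big_split/=; apply: eq_bigr => r _.
  by rewrite xE; ring.
apply: addr_ge0; first by rewrite mulr_ge0 ?sqr_ge0//; exact: psd_scale.
rewrite /quad_form big_cons/= big1 ?add0r; last first.
  by move=> q _; rewrite y0 linear0l !mulr0.
under eq_bigr do rewrite big_cons/= y0 linear0r !mulr0 add0r.
exact: IH.
Qed.

Lemma psd_inner_exp (Z : Type) (K : Z -> Z -> R) (x : Z -> H) n :
  psd K -> psd (fun z z' => K z z' * inner (x z) (x z') ^+ n).
Proof.
move=> psdK; elim: n => [|n IH].
  by under eq_fun2 do rewrite expr0 mulr1.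
under eq_fun2 do rewrite exprSr mulrA.
exact: psd_inner.
Qed.

(** The exponential series has nonnegative coefficients, each power is covered by Schur's theorem,
    and [psd] passes to pointwise limits. *)
Lemma psd_expR_inner (Z : Type) (K : Z -> Z -> R) (x : Z -> H) :
  psd K -> psd (fun z z' => K z z' * expR (inner (x z) (x z'))).
Proof.
move=> psdK.
apply: (@psd_cvg _ (fun n z z' => K z z' *
    series (exp_coeff (inner (x z) (x z'))) n)); last first.
  by move=> z z'; apply: cvgM; [exact: cvg_cst|exact: is_cvg_series_exp_coeff].
elim=> [|n IH].
  under eq_fun2 do rewrite /series/= big_geq// mulr0.
  by move=> l; rewrite /quad_form big1// => p _; rewrite big1// => q _; rewrite mulr0.
under eq_fun2 do rewrite seriesSr mulrDr.
apply: psdD => //.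
rewrite (_ : (fun _ _ => _) = fun z z' =>
    n`!%:R^-1 * (K z z' * inner (x z) (x z') ^+ n)); last first.
  by apply/funext => z; apply/funext => z'; rewrite /exp_coeff/=; ring.
by apply: psdZ; [rewrite invr_ge0|exact: psd_inner_exp].
Qed.

Definition gaussk (t : R) (x y : H) : R := expR (- (t * `|x - y| ^+ 2)).

(** Expanding the square writes the Gaussian kernel as f(x) f(y) e^<cx,cy> with c the square root of
    2t, a rescaled exponential kernel. *)
Lemma psd_gaussk (Z : Type) (K : Z -> Z -> R) (x : Z -> H) t : 0 <= t ->
  psd K -> psd (fun z z' => K z z' * gaussk t (x z) (x z')).
Proof.
move=> t0 psdK.
rewrite (_ : (fun _ _ => _) = fun z z' =>
    expR (- (t * `|x z| ^+ 2)) * expR (- (t * `|x z'| ^+ 2)) *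
    (K z z' * expR (inner (Num.sqrt (2 * t) *: x z) (Num.sqrt (2 * t) *: x z'))));
  last first.
  apply/funext => z; apply/funext => z'.
  have s2 : Num.sqrt (2 * t) * Num.sqrt (2 * t) = 2 * t.
    by rewrite -expr2 sqr_sqrtr ?mulr_ge0.
  rewrite /gaussk sqr_normB !innerE (mulrA (Num.sqrt _)) s2 mulrCA -!expRD.
  by congr (_ * expR _); ring.
exact/psd_scale/psd_expR_inner.
Qed.

End schur.
End positive_semidefinite_kernels.

(** * Four-point differences of the Gaussian kernel *)

Section hat4.
Context (R : realType).

(** For symmetric [h] this is the pairing through [h] of the differences of point masses at x0, x2
    and at x1, x3. Adding f(x) + f(y) to h(x,y) does not change it. *)
Definition hat4 (K : Type) (h : K -> K -> R) (x0 x1 x2 x3 : K) : R :=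
  h x0 x1 - h x1 x2 + h x2 x3 - h x3 x0.

Context (H : hilbertType R).

Lemma gausskC t (x y : H) : gaussk t x y = gaussk t y x.
Proof. by rewrite /gaussk distrC. Qed.

Lemma gausskxx t (x : H) : gaussk t x x = 1.
Proof. by rewrite /gaussk subrr normr0 expr0n/= mulr0 oppr0 expR0. Qed.

Lemma gaussk_gt0 t (x y : H) : 0 < gaussk t x y.
Proof. exact: expR_gt0. Qed.

Lemma gaussk_le1 (t : R) (x y : H) : 0 <= t -> gaussk t x y <= 1.
Proof. by move=> t0; rewrite -expR0 ler_expR oppr_le0 mulr_ge0// sqr_ge0. Qed.

(** For a positive semidefinite kernel with unit diagonal, the difference of the point masses at x
    and y has squared norm 2(1 - k(x,y)). The bound is Cauchy-Schwarz in its weighted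
    arithmetic-geometric form, obtained by evaluating the quadratic form at a combination with
    weights s and 1/s, where s^2 = a; the sign b = 1 or -1 gives the two sides. *)
Lemma normr_hat4_gaussk (t a : R) (x0 x1 x2 x3 : H) : 0 <= t -> 0 < a ->
  `|hat4 (gaussk t) x0 x1 x2 x3| <=
    a * (1 - gaussk t x0 x2) + a^-1 * (1 - gaussk t x1 x3).
Proof.
move=> t0 a0.
have pk := psd_gaussk id t0 (@psd_cst1 R H).
pose s := Num.sqrt a; have s0 : 0 < s by rewrite sqrtr_gt0.
have sE : a = s ^+ 2 by rewrite sqr_sqrtr// ltW.
have F b : quad_form (fun z z' => 1 * gaussk t (id z) (id z'))
    [:: (s, x0); (- s, x2); (b * s^-1, x1); (- (b * s^-1), x3)] =
    2 * (a * (1 - gaussk t x0 x2) + b ^+ 2 * a^-1 * (1 - gaussk t x1 x3)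
         + b * hat4 (gaussk t) x0 x1 x2 x3).
  rewrite /quad_form !big_cons !big_nil/= sE /hat4 !gausskxx.
  rewrite (gausskC t x2 x0) (gausskC t x1 x0) (gausskC t x3 x0).
  rewrite (gausskC t x2 x1) (gausskC t x3 x1) (gausskC t x3 x2).
  by field; rewrite gt_eqF.
rewrite ler_norml; apply/andP; split.
  have := pk [:: (s, x0); (- s, x2); (1 * s^-1, x1); (- (1 * s^-1), x3)].
  by rewrite F; nra.
have := pk [:: (s, x0); (- s, x2); (-1 * s^-1, x1); (- (-1 * s^-1), x3)].
by rewrite F; nra.
Qed.

End hat4.

(** * Powers of distances as mixtures of Gaussian kernels *)

Section mixture.
Context (R : realType).
Local Notation leb := (@lebesgue_measure R).

Lemma integrable_expR_normr (c : R) : 0 < c ->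
  leb.-integrable setT (EFin \o (fun u => expR (- (c * `|u|)))).
Proof.
move=> c0.
have ce : continuous (fun u : R => expR (- (c * `|u|))).
  move=> u; apply: continuous_comp; last exact: continuous_expR.
  by apply: cvgN; apply: cvgM; [exact: cvg_cst|exact: norm_continuous].
have me : measurable_fun setT (fun u : R => expR (- (c * `|u|))).
  exact: continuous_measurable_fun.
apply: ge0_integrable_EFin => //.
rewrite ge0_symfun_integralT//; last by move=> u /=; rewrite normrN.
have mpos : measurable [set x : R | 0 <= x] by rewrite -set_itvcy.
have ipos : leb.-integrable [set x : R | 0 <= x]
    (EFin \o (fun x => c^-1 * exponential_pdf c x)).
  apply: (@integrableS _ _ _ _ setT) => //.
  exact/integrableZ_EFin/integrable_exponential_pdf.
have -> : (\int[leb]_(x in [set x : R | (0 <= x)%R]) (expR (- (c * `|x|)))%:E =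
    \int[leb]_(x in [set x : R | (0 <= x)%R]) (EFin \o (fun x => c^-1 * exponential_pdf c x)%R) x)%E.
  apply: eq_integral => x /=; rewrite inE/= => x0; rewrite exponential_pdfE// mulrA mulVf ?gt_eqF//.
  by rewrite mul1r ger0_norm// mulNr.
have := @integrable_fin_num _ _ _ leb _ mpos _ ipos.
by rewrite fin_numElt => /andP[_] /lte_mul_pinfty; apply.
Qed.

(** The substitution t = e^u in (1 - e^(-l t)) t^(-b-1) dt, whose integral over t > 0 is a constant
    times l^b. *)
Definition mix (b l u : R) : R := (1 - expR (- (l * expR u))) * expR (- (b * u)).

Lemma mix_ge0 b l u : 0 <= l -> 0 <= mix b l u.
Proof.
move=> l0; rewrite mulr_ge0 ?expR_ge0// subr_ge0 -expR0 ler_expR oppr_le0.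
by rewrite mulr_ge0// expR_ge0.
Qed.

Lemma continuous_mix b l : continuous (mix b l).
Proof.
move=> u; apply: cvgM.
  apply: cvgB; first exact: cvg_cst.
  apply: continuous_comp; last exact: continuous_expR.
  by apply: cvgN; apply: cvgM; [exact: cvg_cst|exact: continuous_expR].
apply: continuous_comp; last exact: continuous_expR.
by apply: cvgN; apply: cvgM; [exact: cvg_cst|exact: cvg_id].
Qed.

(** For u >= 0 the first factor is at most 1 and e^(-bu) decays; for u < 0 the first factor is at
    most l e^u, which leaves l e^((1-b)u). *)
Lemma mix_le b l u : 0 < b < 1 -> 0 <= l ->
  mix b l u <= (l + 1) * expR (- (Num.min b (1 - b) * `|u|)).
Proof.
move=> /andP[b0 b1] l0; set c := Num.min _ _.
have cb : c <= b by rewrite ge_min lexx.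
have c1b : c <= 1 - b by rewrite ge_min lexx orbT.
have [u0|u0] := leP 0 u.
  apply: (@le_trans _ _ (expR (- (b * u)))).
    rewrite ler_piMl ?expR_ge0// lerBlDr lerDl expR_ge0//.
  rewrite ger0_norm//; apply: (@le_trans _ _ (expR (- (c * u)))).
    by rewrite ler_expR lerN2 ler_wpM2r.
  by rewrite ler_peMl ?expR_ge0// lerDr.
apply: (@le_trans _ _ (l * expR u * expR (- (b * u)))).
  rewrite ler_wpM2r ?expR_ge0// lerBlDr addrC -lerBlDr.
  exact: expR_ge1Dx.
rewrite -mulrA -expRD ltr0_norm//.
apply: (@le_trans _ _ (l * expR (- (c * - u)))).
  by rewrite ler_wpM2l// ler_expR; nra.
by rewrite ler_wpM2r ?expR_ge0// lerDl.
Qed.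

Lemma integrable_mix b l : 0 < b < 1 -> 0 <= l ->
  leb.-integrable setT (EFin \o mix b l).
Proof.
move=> b01 l0.
apply: (@integrable_le _ _ _ leb _
  (fun u => (l + 1) * expR (- (Num.min b (1 - b) * `|u|)))).
- by apply: continuous_measurable_fun; exact: continuous_mix.
- apply: integrableZ_EFin; apply: integrable_expR_normr.
  by rewrite lt_min subr_gt0.
- by move=> u; rewrite ger0_norm ?mix_ge0//; exact: mix_le.
Qed.

Definition mix_const (b : R) : R := \int[leb]_u mix b 1 u.

Lemma mix_const_gt0 b : 0 < b < 1 -> 0 < mix_const b.
Proof.
move=> b01; rewrite lt_neqAle Rintegral_ge0 ?andbT; last first.
  by move=> u _; exact: mix_ge0.
rewrite eq_sym; apply/eqP => i0.
have [N [mN N0 sub]] := @Rintegral_eq0 _ _ _ leb _ (fun u => mix_ge0 b u ler01) (integrable_mix b01 ler01) i0.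
have NT : N = setT.
  apply/seteqP; split => // u _; apply: sub => /=; apply/eqP.
  rewrite gt_eqF// mulr_gt0 ?expR_gt0// subr_gt0 -[ltRHS]expR0 ltr_expR mul1r oppr_lt0.
  exact: expR_gt0.
have : (leb `[0%R, 1%R]%classic <= leb N)%E by apply: le_measure; rewrite ?inE// NT.
by rewrite N0 lebesgue_measure_itv/= lte01 oppr0 adde0 leNgt lte01.
Qed.

(** Scaling by l becomes the translation of u by ln l, which produces the factor l^b from e^(-bu);
    the case l = 0 is separate. *)
Lemma Rintegral_mix b l : 0 < b < 1 -> 0 <= l ->
  \int[leb]_u mix b l u = l `^ b * mix_const b.
Proof.
move=> b01; have /andP[b0 b1] := b01.
rewrite le_eqVlt => /predU1P[<-|l0].
  rewrite powR0 ?gt_eqF// mul0r.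
  under eq_Rintegral do rewrite /mix mul0r oppr0 expR0 subrr mul0r.
  by rewrite Rintegral_cst// mul0r.
pose c := ln l.
have shift : \int[leb]_u mix b 1 u = \int[leb]_u mix b 1 (u + c).
  have dF : (fun u : R => u + c)^`()%classic = cst 1.
    by apply/funext => u; rewrite derive1E deriveD// derive_id derive_cst addr0.
  rewrite /Rintegral; congr fine.
  rewrite (increasing_ge0_integration_by_substitutionT (F := fun u => u + c)).
  - by apply: eq_integral => u _; rewrite dF /= mulr1.
  - by move=> x y xy; rewrite ltrD2r.
  - by rewrite dF; exact: cst_continuous.
  - by rewrite dF; exact: is_cvg_cst.
  - by rewrite dF; exact: is_cvg_cst.
  - by move=> x; apply: derivableD.
  - exact: cvg_addrr_Ny.
  - exact: cvg_addrr.
  - exact: continuous_mix.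
  - by move=> x; exact: mix_ge0.
have lE : l = expR c by rewrite lnK.
have mixE u : mix b l u = l `^ b * mix b 1 (u + c).
  rewrite /mix mul1r {1}lE -expRD (addrC c) /powR gt_eqF// -/c.
  by rewrite mulrCA -expRD; congr (_ * expR _); ring.
have lb0 : l `^ b != 0 by rewrite gt_eqF// powR_gt0.
rewrite /mix_const shift -RintegralZl//; last first.
  have := @integrableZ_EFin _ _ _ leb (l `^ b)^-1 _ (integrable_mix b01 (ltW l0)).
  congr (_.-integrable _ _); apply/funext => u /=.
  by rewrite mixE mulrA mulVf// mul1r.
by apply: eq_Rintegral => u _; rewrite mixE.
Qed.

Section hilbert.
Context (H : hilbertType R).

Definition dpow (a : R) (x y : H) : R := `|x - y| `^ a.

Lemma dpowC a x y : dpow a x y = dpow a y x.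
Proof. by rewrite /dpow distrC. Qed.

Lemma dpow_sqr b (x y : H) : (`|x - y| ^+ 2) `^ b = dpow (2 * b) x y.
Proof. by rewrite /dpow powRrM powR_mulrn. Qed.

Lemma hat4_mix b (x0 x1 x2 x3 : H) u :
  hat4 (gaussk (expR u)) x0 x1 x2 x3 * expR (- (b * u)) =
  - hat4 (fun x y => mix b (`|x - y| ^+ 2) u) x0 x1 x2 x3.
Proof. by rewrite /hat4 /mix /gaussk !(mulrC (expR u)); ring. Qed.

Lemma integrable_hat4_mix b (x0 x1 x2 x3 : H) : 0 < b < 1 ->
  leb.-integrable setT (EFin \o
    (fun u => hat4 (gaussk (expR u)) x0 x1 x2 x3 * expR (- (b * u)))).
Proof.
move=> b01; under [X in _ \o X]eq_fun do rewrite hat4_mix.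
have im (x y : H) := @integrable_mix b (`|x - y| ^+ 2) b01 (sqr_ge0 _).
apply: integrableN_EFin; apply: integrableB_EFin => //.
by apply: integrableD_EFin => //; exact: integrableB_EFin.
Qed.

Lemma Rintegral_hat4_mix b (x0 x1 x2 x3 : H) : 0 < b < 1 ->
  \int[leb]_u (hat4 (gaussk (expR u)) x0 x1 x2 x3 * expR (- (b * u))) =
  - (mix_const b * hat4 (dpow (2 * b)) x0 x1 x2 x3).
Proof.
move=> b01; under eq_Rintegral do rewrite hat4_mix.
have im (x y : H) := @integrable_mix b (`|x - y| ^+ 2) b01 (sqr_ge0 _).
have imB := @integrableB_EFin _ _ _ leb.
have imD := @integrableD_EFin _ _ _ leb.
rewrite RintegralN; last by apply: (imB) => //; apply: (imD) => //; exact: (imB).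
rewrite /hat4 RintegralB//; last by apply: (imD) => //; exact: (imB).
rewrite RintegralD//; last exact: (imB).
rewrite RintegralB// !Rintegral_mix ?sqr_ge0// !dpow_sqr.
by ring.
Qed.

(* The weights of [normr_hat4_gaussk] are optimized after integration. *)
Lemma Rintegral_normr_hat4_mix_le b (x0 x1 x2 x3 : H) : 0 < b < 1 ->
  \int[leb]_u (`|hat4 (gaussk (expR u)) x0 x1 x2 x3| * expR (- (b * u))) <=
  2 * mix_const b * (dpow b x0 x2 * dpow b x1 x3).
Proof.
move=> b01; have /andP[b0 b1] := b01.
have C0 := mix_const_gt0 b01.
(* When one of the two differences of point masses vanishes, the optimal weight [a] below would be 0
   or undefined, but then the four-point difference is zero. *)
have hat0 : x0 = x2 \/ x1 = x3 -> forall u, hat4 (gaussk (expR u)) x0 x1 x2 x3 = 0.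
  by case=> -> u; rewrite /hat4;
    [rewrite (gausskC _ x1) (gausskC _ x3)|rewrite (gausskC _ x2) (gausskC _ x3 x0)]; ring.
have [/hat0 h0|n02] := pselect (x0 = x2 \/ x1 = x3).
  under eq_Rintegral do rewrite h0 normr0 mul0r.
  by rewrite Rintegral_cst// mul0r !mulr_ge0// ?powR_ge0// ltW.
have d02 : 0 < dpow b x0 x2.
  by rewrite powR_gt0// normr_gt0 subr_eq0; apply/eqP => e; apply: n02; left.
have d13 : 0 < dpow b x1 x3.
  by rewrite powR_gt0// normr_gt0 subr_eq0; apply/eqP => e; apply: n02; right.
pose a := dpow b x1 x3 / dpow b x0 x2.
have a0 : 0 < a by rewrite divr_gt0.
have dd x y : dpow (2 * b) x y = dpow b x y ^+ 2.
  by rewrite /dpow mulrC powRrM powR_mulrn// powR_ge0.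
have im (x y : H) := @integrable_mix b (`|x - y| ^+ 2) b01 (sqr_ge0 _).
have imZ := @integrableZ_EFin _ _ _ leb.
have -> : 2 * mix_const b * (dpow b x0 x2 * dpow b x1 x3) =
    \int[leb]_u (a * mix b (`|x0 - x2| ^+ 2) u + a^-1 * mix b (`|x1 - x3| ^+ 2) u).
  rewrite RintegralD//; [|exact: imZ|exact: imZ].
  rewrite !RintegralZl// !Rintegral_mix ?sqr_ge0// !dpow_sqr !dd /a.
  by field; rewrite !gt_eqF.
apply: le_Rintegral => //.
- have := @integrable_norm _ _ _ leb _ _ (integrable_hat4_mix x0 x1 x2 x3 b01).
  congr (_.-integrable _ _); apply/funext => u /=.
  by rewrite normrM (gtr0_norm (expR_gt0 _)).
- by apply: (@integrableD_EFin _ _ _ leb); exact: imZ.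
move=> u _; have := normr_hat4_gaussk x0 x1 x2 x3 (expR_ge0 u) a0.
move=> /(ler_wpM2r (expR_ge0 (- (b * u)))) /le_trans; apply.
by rewrite /mix /gaussk !(mulrC (expR u)) mulrDl !mulrA.
Qed.

(** Cauchy-Schwarz for the four-point pairing, carried from Gaussians to their mixture. The power 2b
    on the left is controlled by powers b of two separate distances; this is why moments of order
    alpha suffice for the products of hats. *)
Lemma normr_hat4_dpow b (x0 x1 x2 x3 : H) : 0 < b < 1 ->
  `|hat4 (dpow (2 * b)) x0 x1 x2 x3| <= 2 * (dpow b x0 x2 * dpow b x1 x3).
Proof.
move=> b01; have C0 := mix_const_gt0 b01.
rewrite -(ler_pM2l C0) [leRHS]mulrCA [leRHS]mulrA.
apply: le_trans (Rintegral_normr_hat4_mix_le x0 x1 x2 x3 b01).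
rewrite -[X in X * `|_|](gtr0_norm C0) -normrM -normrN -Rintegral_hat4_mix//.
apply: le_trans (@le_normr_Rintegral _ _ _ leb _ _ _ (integrable_hat4_mix x0 x1 x2 x3 b01)) _ => //.
by under eq_Rintegral do rewrite normrM (gtr0_norm (expR_gt0 _)).
Qed.

End hilbert.
End mixture.

(** * Polynomial approximation of a threshold *)

Lemma Rintegral_indicE d (T : measurableType d) (R : realType)
    (mu : {measure set T -> \bar R}) (A : set T) (f : T -> R) :
  \int[mu]_(x in A) f x = \int[mu]_x (f x * \1_A x).
Proof.
rewrite Rintegral_mkcond; apply: eq_Rintegral => x _.
by rewrite patchE indicE; case: (_ \in _); rewrite ?mulr1 ?mulr0.
Qed.

Section real_limits.
Context (R : realType).
Implicit Types v : R.

Lemma bernoulli_ge v n : 0 <= v -> 1 + n%:R * v <= (1 + v) ^+ n.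
Proof.
move=> v0; elim: n => [|n IH]; first by rewrite mul0r addr0 expr0.
rewrite exprS; have : (1 + v) * (1 + n%:R * v) <= (1 + v) * (1 + v) ^+ n.
  by rewrite ler_wpM2l// addr_ge0.
apply: le_trans; rewrite -natr1.
have : 0 <= v * (n%:R * v) by rewrite !mulr_ge0.
by nra.
Qed.

Lemma exprB1_le v n : 0 <= v <= 1 -> (1 - v) ^+ n <= (1 + n%:R * v)^-1.
Proof.
move=> /andP[v0 v1]; have nv : 0 < 1 + n%:R * v by rewrite ltr_pwDl// mulr_ge0.
rewrite -[leRHS]mul1r ler_pdivlMr//.
apply: (@le_trans _ _ ((1 - v) ^+ n * (1 + v) ^+ n)).
  by rewrite ler_wpM2l ?bernoulli_ge// exprn_ge0// subr_ge0.
rewrite -exprMn exprn_ile1//; nra.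
Qed.

Lemma exprB1_ge v n : 0 <= v <= 1 -> 1 - n%:R * v <= (1 - v) ^+ n.
Proof.
move=> /andP[v0 v1]; elim: n => [|n IH]; first by rewrite mul0r subr0 expr0.
rewrite exprS; have : (1 - v) * (1 - n%:R * v) <= (1 - v) * (1 - v) ^+ n.
  by rewrite ler_wpM2l// subr_ge0.
apply: le_trans; rewrite -natr1.
have : 0 <= v * (n%:R * v) by rewrite !mulr_ge0.
by nra.
Qed.

(** With v = s^2, the product n s^n stays bounded by Bernoulli's inequality while the other factor
    s^n tends to 0. *)
Lemma cvg_mulrn_exp v : 0 < v < 1 -> n%:R * v ^+ n @[n --> \oo] --> 0.
Proof.
move=> /andP[v0 v1].
pose s := Num.sqrt v.
have s0 : 0 < s by rewrite sqrtr_gt0.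
have sE : v = s * s by rewrite -expr2 sqr_sqrtr// ltW.
have s1 : s < 1 by rewrite -sqrtr1 ltr_sqrt.
have c0 : 0 < s^-1 - 1 by rewrite subr_gt0 invf_gt1.
have nsn n : n%:R * s ^+ n <= (s^-1 - 1)^-1.
  have sn0 : 0 < s ^+ n by rewrite exprn_gt0.
  have := bernoulli_ge n (ltW c0).
  rewrite (_ : 1 + (s^-1 - 1) = s^-1); last by rewrite addrC subrK.
  rewrite exprVn => H.
  have : n%:R * (s^-1 - 1) <= (s ^+ n)^-1 by apply: le_trans H; rewrite lerDr.
  rewrite -[(s ^+ n)^-1]mul1r ler_pdivlMr// mulrAC.
  by rewrite -ler_pdivlMr// mul1r.
apply: (@squeeze_cvgr _ _ _ _ (fun _ => 0) (fun n => (s^-1 - 1)^-1 * s ^+ n)).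
- near=> n; rewrite mulr_ge0 ?exprn_ge0 ?(ltW v0)//= sE exprMn mulrA.
  by rewrite ler_wpM2r// exprn_ge0// ltW.
- exact: cvg_cst.
- rewrite -[X in _ --> X](mulr0 (s^-1 - 1)^-1); apply: cvgM; first exact: cvg_cst.
  by apply: cvg_expr; rewrite ger0_norm// ltW.
Unshelve. all: by end_near. Qed.

Lemma cvg_invn : (n.+1%:R : R)^-1 @[n --> \oo] --> 0.
Proof. exact: cvg_harmonic. Qed.

(** With w = v^n and N = n 2^n one has N w = n (2v)^n, and Bernoulli's inequality gives 1 - N w <=
    (1 - w)^N <= 1/(1 + N w). The value v = 1/2 falls on the side of limit 0, thanks to the factor
    n. *)
Lemma cvg_threshold v : 0 <= v <= 1 ->
  (1 - v ^+ n) ^+ (n * 2 ^ n) @[n --> \oo] --> (((v < 1 / 2)%R)%:R : R).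
Proof.
move=> /andP[v0 v1].
have vn n : 0 <= v ^+ n <= 1 by rewrite exprn_ge0//= exprn_ile1.
have [v2|v2] := ltP v (1 / 2); last first.
  apply: (@squeeze_cvgr _ _ _ _ (fun _ => 0) (fun n => n.+1%:R^-1)).
  - near=> n; rewrite exprn_ge0 ?subr_ge0 ?(andP (vn n)).2//=.
    apply: (le_trans (exprB1_le _ (vn n))).
    rewrite lef_pV2 ?posrE//; last first.
      by rewrite ltr_pwDl// mulr_ge0// (andP (vn n)).1.
    rewrite -natr1 addrC lerD2l natrM -mulrA ler_peMr// natrX -exprMn.
    by rewrite exprn_ege1//; lra.
  - exact: cvg_cst.
  - exact: cvg_invn.
have [v3|v3] := eqVneq v 0.
  apply: cvg_near_cst; near=> n; rewrite v3 expr0n.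
  suff -> : (n == 0)%N = false by rewrite subr0 expr1n.
  by apply/negbTE; rewrite -lt0n; near: n; exact: nbhs_infty_gt.
apply: (@squeeze_cvgr _ _ _ _ (fun n => 1 - n%:R * (2 * v) ^+ n) (fun _ => 1)).
- near=> n; apply/andP; split.
    apply: le_trans (exprB1_ge _ (vn n)).
    by rewrite natrM natrX -mulrA -exprMn.
  by rewrite exprn_ile1// ?subr_ge0 ?lerBlDr ?lerDl; case/andP: (vn n).
- rewrite -[X in _ --> X]subr0; apply: cvgB; first exact: cvg_cst.
  by apply: cvg_mulrn_exp; apply/andP; split; [rewrite mulr_gt0// lt0r v3|lra].
- exact: cvg_cst.
Unshelve. all: by end_near. Qed.

End real_limits.

(** * The Borel sigma-algebra of a separable Hilbert space *)

Section borel_hilbert.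
Context (R : realType) (H : hilbertType R).

Lemma separable_seq : separable H ->
  exists e : nat -> H, forall x (eps : R), 0 < eps -> exists n, `|x - e n| < eps.
Proof.
move=> [D /countable_injP[f finj] dD].
exists (fun n => xget 0 [set x | D x /\ f x = n]) => x eps eps0.
have [y [xy Dy]] : (ball x eps `&` D) !=set0.
  apply: dD; last exact: ball_open.
  by exists x; exact: ballxx.
exists (f y); rewrite (_ : xget _ _ = y); first by rewrite -ball_normE in xy.
have : [set z | D z /\ f z = f y] y by [].
case: xgetP => [z -> [Dz fz] _|/(_ y) //].
by apply: finj => //; rewrite inE.
Qed.

Lemma continuous_borel_measurable (f : H -> R) :
  continuous f -> measurable_fun setT (f : borel H -> R).
Proof.
move=> /continuousP cf; apply: (measurability _ (RGenOpens.measurableE R)).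
move=> _ [_ [a [b ->] <-]]; rewrite setTI.
by apply: sub_sigma_algebra; apply: cf; exact: interval_open.
Qed.

Lemma measurable_norm_sub (a : H) :
  measurable_fun setT (fun x : borel H => `|(x : H) - a|).
Proof.
apply: continuous_borel_measurable => x.
by apply: cvg_norm; apply: cvgB; [exact: cvg_id|exact: cvg_cst].
Qed.

Lemma measurable_gaussk t (a : H) :
  measurable_fun setT (fun x : borel H => gaussk t (x : H) a).
Proof.
apply: measurableT_comp => //; apply: measurableT_comp => //.
apply: measurable_funM => //; apply: measurable_funX.
exact: measurable_norm_sub.
Qed.

Lemma measurable_inner (a : H) :
  measurable_fun setT (fun x : borel H => inner (x : H) a).
Proof.
rewrite (_ : (fun _ => _) =
    fun x : H => 2^-1 * (`|x| ^+ 2 + `|a| ^+ 2 - `|x - a| ^+ 2)).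
  apply: measurable_funM => //; apply: measurable_funB.
    apply: measurable_funD => //; apply: measurable_funX.
    rewrite [X in measurable_fun _ X](_ : _ = fun x : borel H => `|(x : H) - 0|).
      exact: measurable_norm_sub.
    by apply/funext => x; rewrite subr0.
  by apply: measurable_funX; exact: measurable_norm_sub.
by apply/funext => x; rewrite sqr_normB; field.
Qed.

Hypothesis sepH : separable H.

(** The domain carries the product of the Borel sigma-algebras, so continuity alone does not
    conclude. Separability does: |x-y| < r holds exactly when |x-c| + |y-c| < r for some c in a
    countable dense sequence. *)
Lemma measurable_dist :
  measurable_fun setT (fun z : borel H * borel H => `|(z.1 : H) - (z.2 : H)|).
Proof.
have [e eP] := separable_seq sepH.
apply: (measurability _ (RGenInftyO.measurableE R)) => _ [_ [r ->] <-].
rewrite setTI.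
have -> : (fun z : borel H * borel H => `|(z.1 : H) - z.2|) @^-1` `]-oo, r[ =
    \bigcup_n [set z : borel H * borel H |
      `|(z.1 : H) - e n| + `|(z.2 : H) - e n| < r].
  apply/seteqP; split => [[x y]|[x y] [n _]]; rewrite /= in_itv/=.
    move=> xyr; have d0 : 0 < (r - `|x - y|) / 2 by rewrite divr_gt0// subr_gt0.
    have [n xn] := eP x _ d0; exists n => //=.
    have : `|y - e n| <= `|x - y| + `|x - e n|.
      rewrite (_ : y - e n = (y - x) + (x - e n)); last by rewrite addrA subrK.
      by rewrite (le_trans (ler_normD _ _))// distrC.
    by lra.
  apply: le_lt_trans; rewrite (_ : x - y = (x - e n) - (y - e n)).
    exact: ler_normB.
  by rewrite opprB addrA subrK.
apply: bigcup_measurable => n _.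
have mf : measurable_fun setT (fun z : borel H * borel H =>
    `|(z.1 : H) - e n| + `|(z.2 : H) - e n|).
  apply: measurable_funD.
    exact: (measurableT_comp (measurable_norm_sub (e n)) measurable_fst).
  exact: (measurableT_comp (measurable_norm_sub (e n)) measurable_snd).
have := measurable_preimage mf (measurable_itv `]-oo, r[).
by congr measurable; apply/seteqP; split => z /=; rewrite in_itv.
Qed.

(** An intersection of complements of closed balls, each given by centre and radius; the empty list
    gives the whole space. Complements of balls are used because their indicators are limits of
    polynomials in Gaussians and multiply under intersection. *)
Definition far_set (l : seq (H * R)) : set H :=
  [set x | forall p, p \in l -> p.2 < `|x - p.1|].

Definition far_sets : set (set H) :=
  [set U | exists2 l, (forall p, p \in l -> 0 < p.2) & U = far_set l].

Lemma setI_closed_far_sets : setI_closed far_sets.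
Proof.
move=> _ _ [l lP ->] [l' lP' ->]; exists (l ++ l').
  by move=> p; rewrite mem_cat => /orP[/lP|/lP'].
apply/seteqP; split => [x [xl xl'] p|x xl].
  by rewrite mem_cat => /orP[/xl|/xl'].
by split => p pl; apply: xl; rewrite mem_cat pl ?orbT.
Qed.

Lemma far_sets_borel : far_sets `<=` @measurable _ (borel H).
Proof.
move=> _ [l _ ->]; elim: l => [|p l IH].
  by rewrite (_ : far_set [::] = setT)//; apply/seteqP; split.
rewrite (_ : far_set _ = (fun x : borel H => `|(x : H) - p.1|) @^-1` `]p.2, +oo[
    `&` far_set l).
  apply: measurableI => //; apply: measurable_preimage => //.
  exact: measurable_norm_sub.
apply/seteqP; split => [x xl|x [/=]].
  split; first by rewrite /= in_itv/= andbT; apply: xl; rewrite mem_head.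
  by move=> q ql; apply: xl; rewrite inE ql orbT.
by rewrite in_itv/= andbT => xp xl q; rewrite inE => /predU1P[->|/xl].
Qed.

(** An open set is the countable union of the closed balls it contains with centre in the dense
    sequence and radius 1/(m+1), and each such ball is the complement of a far set. *)
Lemma borel_far_sets : @measurable _ (borel H) `<=` <<s far_sets >>.
Proof.
apply: smallest_sub; first exact: smallest_sigma_algebra.
move=> O oO; have [e eP] := separable_seq sepH.
pose C (n m : nat) : set H := [set x | `|x - e n| <= m.+1%:R^-1].
pose F n m := if pselect (C n m `<=` O) then C n m else set0.
have -> : O = \bigcup_n \bigcup_m F n m.
  apply/seteqP; split => [x Ox|x [n _ [m _]]]; last first.
    by rewrite /F; case: pselect => [CO|//]; exact: CO.
  have /nbhs_ballP[eps /= eps0 xO] : nbhs x O by exact: open_nbhs_nbhs.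
  pose m := Num.truncn (2 / eps).
  have m0 : 0 < m.+1%:R^-1 :> R by rewrite invr_gt0.
  have meps : m.+1%:R^-1 < eps / 2.
    by rewrite -[ltRHS]invrK ltf_pV2 ?posrE ?invr_gt0 ?divr_gt0// invf_div truncnS_gt.
  have [n xn] := eP x _ m0.
  exists n => //; exists m => //; rewrite /F; case: pselect => [CO|]; first exact: ltW.
  case=> y; rewrite /C/= => yn; apply: xO; rewrite -ball_normE /ball_/=.
  rewrite (_ : x - y = (x - e n) - (y - e n)); last by rewrite opprB addrA subrK.
  by rewrite (le_lt_trans (ler_normB _ _))// (lt_le_trans (ltr_leD xn yn))//;
     move: (ltW meps); move: (m.+1%:R^-1) => ? ?; lra.
apply: sigma_algebra_bigcup => n; apply: sigma_algebra_bigcup => m.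
rewrite /F; case: pselect => [CO|nCO] /=; last exact: sigma_algebra0.
rewrite (_ : C n m = ~` far_set [:: (e n, m.+1%:R^-1)]); last first.
  apply/seteqP; split => x; last first.
    move=> /= Cfar; rewrite /C/= leNgt; apply/negP => xn; apply: Cfar => p.
    by rewrite inE => /eqP ->.
  move=> Cx /= xf; have := xf (e n, m.+1%:R^-1); rewrite mem_head => /(_ isT)/=.
  by apply/negP; rewrite -leNgt.
apply: sigma_algebraC; apply: sub_sigma_algebra.
by exists [:: (e n, m.+1%:R^-1)] => // p; rewrite inE => /eqP ->/=.
Qed.

End borel_hilbert.

(** * The algebra spanned by Gaussian kernels *)

Section gaussian_span.
Context (R : realType) (H : hilbertType R).

(** The exponent u = 0 is included so that the span contains the constants. *)
Inductive gauss_span : (H -> R) -> Prop :=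
| gauss_span_gaussk u b : 0 <= u -> gauss_span (fun x => gaussk u x b)
| gauss_spanD f g : gauss_span f -> gauss_span g -> gauss_span (fun x => f x + g x)
| gauss_spanZ a f : gauss_span f -> gauss_span (fun x => a * f x).

Lemma gaussk0 (x b : H) : gaussk 0 x b = 1.
Proof. by rewrite /gaussk mul0r oppr0 expR0. Qed.

Lemma gausskM u v (x b b' : H) : 0 < u + v ->
  gaussk u x b * gaussk v x b' =
  expR (- (u * v / (u + v) * `|b - b'| ^+ 2)) *
    gaussk (u + v) x ((u + v)^-1 *: (u *: b + v *: b')).
Proof.
move=> uv; rewrite /gaussk -!expRD; congr expR.
rewrite -!inner_norm !innerE (innerC b x) (innerC b' x) (innerC b' b).
by field; rewrite gt_eqF.
Qed.

Lemma gauss_span_cst a : gauss_span (fun=> a).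
Proof.
rewrite (_ : (fun=> a) = fun x => a * gaussk 0 x 0).
  by apply: gauss_spanZ; exact: gauss_span_gaussk.
by apply/funext => x; rewrite gaussk0 mulr1.
Qed.

Lemma gauss_spanM f g : gauss_span f -> gauss_span g ->
  gauss_span (fun x => f x * g x).
Proof.
move=> sf; elim: sf g => [u b u0|f1 f2 _ IH1 _ IH2|a f1 _ IH] g sg.
- elim: sg => [v b' v0|g1 g2 _ IH1 _ IH2|a g1 _ IH].
  + have [uv|uv] := eqVneq (u + v) 0.
      have -> : u = 0 by apply/eqP; rewrite eq_le u0 andbT -uv lerDl.
      rewrite (_ : (fun _ => _) = fun x => gaussk v x b'); first exact: gauss_span_gaussk.
      by apply/funext => x; rewrite gaussk0 mul1r.
    have uv0 : 0 < u + v by rewrite lt0r uv addr_ge0.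
    under eq_fun do rewrite gausskM//.
    by apply: gauss_spanZ; apply: gauss_span_gaussk; exact: ltW.
  + by under eq_fun do rewrite mulrDr; exact: gauss_spanD.
  + by under eq_fun do rewrite mulrCA; exact: gauss_spanZ.
- by under eq_fun do rewrite mulrDl; apply: gauss_spanD; [exact: IH1|exact: IH2].
- by under eq_fun do rewrite -mulrA; apply: gauss_spanZ; exact: IH.
Qed.

Lemma gauss_spanX f n : gauss_span f -> gauss_span (fun x => f x ^+ n).
Proof.
move=> sf; elim: n => [|n IH].
  by under eq_fun do rewrite expr0; exact: gauss_span_cst.
by under eq_fun do rewrite exprS; exact: gauss_spanM.
Qed.

Lemma gauss_span_prod (I : Type) (s : seq I) (F : I -> H -> R) :
  (forall i, gauss_span (F i)) -> gauss_span (fun x => \prod_(i <- s) F i x).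
Proof.
move=> sF; elim: s => [|i s IH].
  by under eq_fun do rewrite big_nil; exact: gauss_span_cst.
by under eq_fun do rewrite big_cons; exact: gauss_spanM.
Qed.

Lemma measurable_gauss_span f : gauss_span f ->
  measurable_fun setT (f : borel H -> R).
Proof.
elim=> [u b _|f1 f2 _ m1 _ m2|a f1 _ m1]; first exact: measurable_gaussk.
  exact: measurable_funD.
exact: measurable_funM.
Qed.

Lemma bounded_gauss_span f : gauss_span f -> exists M, forall x, `|f x| <= M.
Proof.
elim=> [u b u0|f1 f2 _ [M1 m1] _ [M2 m2]|a f1 _ [M1 m1]].
- by exists 1 => x; rewrite gtr0_norm ?gaussk_gt0// gaussk_le1.
- by exists (M1 + M2) => x; rewrite (le_trans (ler_normD _ _))// lerD.
- by exists (`|a| * M1) => x; rewrite normrM ler_wpM2l.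
Qed.

End gaussian_span.

(** * Gaussian kernels determine measures and independence *)

Section determining.
Context (R : realType) (H : hilbertType R) (sepH : separable H).
Context d (T : measurableType d) (mu : {measure set T -> \bar R}).
Variables (w : T -> R) (Y : T -> borel H).
Hypotheses (intw : mu.-integrable setT (EFin \o w)) (mY : measurable_fun setT Y).
Hypothesis w_gauss : forall u b, 0 < u ->
  \int[mu]_x (w x * gaussk u (Y x : H) b) = 0.

Let mw : measurable_fun setT w.
Proof. exact: integrable_measurable intw. Qed.

Let integrable_w_bounded (f : H -> R) (M : R) :
  measurable_fun setT (f : borel H -> R) -> (forall x, `|f x| <= M) ->
  mu.-integrable setT (EFin \o (fun x => w x * f (Y x))).
Proof.
move=> mf fM; apply: (integrable_le (g := fun x => M * `|w x|)).
- by apply: measurable_funM => //; exact: (measurableT_comp mf mY).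
- exact/integrableZ_EFin/integrable_norm.
- by move=> x; rewrite normrM mulrC ler_wpM2r.
Qed.

Let w_cvg (f_ : nat -> H -> R) (f : H -> R) (M : R) :
  (forall n, measurable_fun setT (f_ n : borel H -> R)) ->
  (forall n x, `|f_ n x| <= M) -> (forall x, f_ n x @[n --> \oo] --> f x) ->
  (forall n, \int[mu]_x (w x * f_ n (Y x)) = 0) ->
  \int[mu]_x (w x * f (Y x)) = 0.
Proof.
move=> mf fM cf f0.
have : \int[mu]_x (w x * f_ n (Y x)) @[n --> \oo] --> \int[mu]_x (w x * f (Y x)).
  apply: (dominated_cvg (g := fun x => M * `|w x|)).
  - by move=> n; apply: measurable_funM => //; exact: (measurableT_comp (mf n) mY).
  - by move=> x; apply: cvgM; [exact: cvg_cst|exact: cf].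
  - exact/integrableZ_EFin/integrable_norm.
  - by move=> n x; rewrite normrM mulrC ler_wpM2r.
under eq_fun do rewrite f0.
by move=> /cvg_lim <-//; rewrite lim_cst.
Qed.

(** The hypothesis [w_gauss] concerns u > 0 only; the constant 1 is reached as the limit of
    Gaussians with u = 1/(n+1). *)
Let w1 : \int[mu]_x w x = 0.
Proof.
have -> : \int[mu]_x w x = \int[mu]_x (w x * (fun=> 1) (Y x)).
  by apply: eq_Rintegral => x _; rewrite mulr1.
apply: (@w_cvg (fun n (x : H) => gaussk n.+1%:R^-1 x 0) (fun=> 1) 1).
- by move=> n; exact: measurable_gaussk.
- by move=> n x; rewrite gtr0_norm ?gaussk_gt0// gaussk_le1.
- move=> x; rewrite /gaussk -[X in _ --> X]expR0.
  apply: continuous_cvg; first exact: continuous_expR.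
  rewrite -[X in _ --> X]oppr0; apply: cvgN.
  rewrite -[X in _ --> X](mul0r (`|x - 0| ^+ 2)).
  by apply: cvgM; [exact: cvg_invn|exact: cvg_cst].
- by move=> n; exact: w_gauss.
Qed.

Let w_span f : gauss_span f -> \int[mu]_x (w x * f (Y x)) = 0.
Proof.
elim=> [u b|f1 f2 s1 H1 s2 H2|a f1 s1 H1].
- rewrite le_eqVlt => /predU1P[<-|u0]; last exact: w_gauss.
  by under eq_Rintegral do rewrite gaussk0 mulr1.
- under eq_Rintegral do rewrite mulrDr.
  have [M1 M1P] := bounded_gauss_span s1; have [M2 M2P] := bounded_gauss_span s2.
  rewrite RintegralD ?H1 ?H2 ?addr0//.
    by apply: integrable_w_bounded M1P; exact: measurable_gauss_span.
  by apply: integrable_w_bounded M2P; exact: measurable_gauss_span.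
- under eq_Rintegral do rewrite mulrCA.
  have [M1 M1P] := bounded_gauss_span s1.
  rewrite RintegralZl ?H1 ?mulr0//.
  by apply: integrable_w_bounded M1P; exact: measurable_gauss_span.
Qed.

Let w_far l : (forall p, p \in l -> 0 < p.2) ->
  \int[mu]_(x in Y @^-1` far_set l) w x = 0.
Proof.
move=> l0; rewrite Rintegral_indicE.
(* For this exponent the kernel drops below 1/2 exactly when the distance to the centre exceeds the
   radius [p.2]. *)
pose u (p : H * R) := ln 2 / (p.2 ^+ 2).
have u0 p : 0 <= u p by rewrite divr_ge0 ?sqr_ge0// ln_ge0// ler1n.
pose f n x := \prod_(p <- l) (1 - gaussk (u p) x p.1 ^+ n) ^+ (n * 2 ^ n).
have sf n : gauss_span (f n).
  apply: gauss_span_prod => p; apply: gauss_spanX.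
  rewrite (_ : (fun _ => _) = fun x => 1 + (- 1) * gaussk (u p) x p.1 ^+ n); last first.
    by apply/funext => x; rewrite mulN1r.
  apply: gauss_spanD; first exact: gauss_span_cst.
  by apply/gauss_spanZ/gauss_spanX/gauss_span_gaussk.
have k01 p x : 0 <= gaussk (u p) x p.1 <= 1 by rewrite ltW ?gaussk_gt0// gaussk_le1.
rewrite -[RHS](_ : \int[mu]_x (w x * \1_(far_set l) (Y x)) = 0).
  by apply: eq_Rintegral => x _; rewrite !indicE.
apply: (@w_cvg f \1_(far_set l) 1).
- by move=> n; exact: measurable_gauss_span.
- move=> n x; rewrite /f normr_prod; apply: prodr_ile1 => p _.
  have /andP[k0 k1] := k01 p x.
  by rewrite normr_ge0/= ger0_norm ?exprn_ge0 ?exprn_ile1 ?subr_ge0 ?exprn_ile1//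
    lerBlDr lerDl exprn_ge0.
- move=> x; rewrite (_ : \1_(far_set l) x =
      \prod_(p <- l) ((gaussk (u p) x p.1 < 1 / 2)%R)%:R); last first.
    have kE p : p \in l -> (gaussk (u p) x p.1 < 1 / 2) = (p.2 < `|x - p.1|).
      move=> /l0 p0; have ln20 : 0 < ln (2 : R) by rewrite ln_gt0// ltr1n.
      rewrite /gaussk /u -(@lnK _ (1 / 2)) ?posrE ?divr_gt0// ltr_expR.
      rewrite lnM ?posrE// ln1 add0r lnV ?posrE// ltrN2 mulrAC -mulrA ltr_pMr//.
      rewrite ltr_pdivlMr ?exprn_gt0// mul1r.
      by rewrite ltr_sqr// nnegrE// ltW.
    rewrite indicE; have [|xl] := boolP (x \in far_set l).
      rewrite inE => xl; rewrite big1_seq// => p /= pl.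
      by rewrite kE// (xl _ pl).
    apply/esym/eqP; rewrite prodf_seq_eq0.
    apply: contraNT xl => /hasPn nh; rewrite inE => p pl.
    by have := nh _ pl; rewrite /= kE//; case: ltP => _; rewrite ?eqxx.
  apply: cvg_big; first exact: mul_continuous.
  by move=> p _; exact: cvg_threshold.
- by move=> n; exact: w_span.
Qed.

(** A signed measure, here the image under [Y] of the measure with density [w], that annihilates all
    Gaussians annihilates the algebra they span, hence by bounded limits the far sets, a pi-system
    generating the Borel sets. *)
Lemma gaussk_determining V : measurable V ->
  \int[mu]_(x in Y @^-1` V) w x = 0.
Proof.
move=> mV; apply: (@Rintegral_pi_lambda _ _ _ mu w
    (preimage_set_system setT Y (far_sets (H := H)))) => //.
- move=> _ _ [U fU <-] [U' fU' <-]; exists (U `&` U').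
    exact: setI_closed_far_sets.
  by rewrite !setTI preimage_setI.
- move=> _ [U fU <-]; rewrite setTI; apply: measurable_preimage => //.
  exact: far_sets_borel.
- by move=> _ [_ [l l0 ->] <-]; rewrite setTI; exact: w_far.
- have := g_sigma_preimageE setT Y (far_sets (H := H)).
  move=> ->; exists V; last by rewrite setTI.
  exact: borel_far_sets.
Qed.

End determining.

(** [gaussk_determining] is used twice: with the density k_t(X,a) minus its mean, which replaces the
    Gaussian of Y by an arbitrary event of Y, and then with the centred indicator of that event,
    which does the same for X. *)
Lemma indep_gaussk (R : realType) (H H' : hilbertType R)
    (sepH : separable H) (sepH' : separable H')
    d (T : measurableType d) (Q : probability T R)
    (X : T -> borel H) (Y : T -> borel H') :
  measurable_fun setT X -> measurable_fun setT Y ->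
  (forall t u a b, 0 < t -> 0 < u ->
    \int[Q]_x (gaussk t (X x : H) a * gaussk u (Y x : H') b) =
    \int[Q]_x gaussk t (X x : H) a * \int[Q]_x gaussk u (Y x : H') b) ->
  indep Q X Y.
Proof.
move=> mX mY XY.
have mkX t a : measurable_fun setT (fun x => gaussk t (X x : H) a).
  exact: (measurableT_comp (measurable_gaussk t a) mX).
have mkY t a : measurable_fun setT (fun x => gaussk t (Y x : H') a).
  exact: (measurableT_comp (measurable_gaussk t a) mY).
have ikX t a : 0 < t -> Q.-integrable setT (EFin \o (fun x => gaussk t (X x : H) a)).
  move=> t0; apply: (@integrable_bounded _ _ _ _ _ 1) => // x.
  by rewrite gtr0_norm ?gaussk_gt0// gaussk_le1// ltW.
have ikY t a : 0 < t -> Q.-integrable setT (EFin \o (fun x => gaussk t (Y x : H') a)).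
  move=> t0; apply: (@integrable_bounded _ _ _ _ _ 1) => // x.
  by rewrite gtr0_norm ?gaussk_gt0// gaussk_le1// ltW.
have icst c : Q.-integrable setT (EFin \o (fun=> c : R)).
  exact: (@integrable_bounded _ _ _ _ _ `|c|).
have iM (f g : T -> R) : measurable_fun setT f -> measurable_fun setT g ->
    (forall x, `|f x| <= 1) -> (forall x, `|g x| <= 1) ->
    Q.-integrable setT (EFin \o (fun x => f x * g x)).
  move=> mf mg f1 g1; apply: (@integrable_bounded _ _ _ _ _ 1).
    exact: measurable_funM.
  by move=> x; rewrite normrM mulr_ile1.
have k1 (K : hilbertType R) t (x a : K) : 0 < t -> `|gaussk t x a| <= 1.
  by move=> t0; rewrite gtr0_norm ?gaussk_gt0// gaussk_le1// ltW.
have ind1 V (x : T) : `|\1_V x| <= 1 :> R.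
  by rewrite indicE; case: (_ \in _); rewrite ?normr1 ?normr0.
have centered (f g : T -> R) c : Q.-integrable setT (EFin \o g) ->
    Q.-integrable setT (EFin \o (fun x => f x * g x)) ->
    \int[Q]_x ((f x - c) * g x) = \int[Q]_x (f x * g x) - c * \int[Q]_x g x.
  move=> ig ifg; under eq_Rintegral do rewrite mulrBl.
  by rewrite RintegralB//; [rewrite RintegralZl|exact: integrableZ_EFin].
have step1 t a V : 0 < t -> measurable V ->
    \int[Q]_(x in Y @^-1` V) gaussk t (X x : H) a =
    \int[Q]_x gaussk t (X x : H) a * fine (Q (Y @^-1` V)).
  move=> t0 mV.
  set c := \int[Q]_x _.
  have := @gaussk_determining R H' sepH' _ T Q
    (fun x => gaussk t (X x : H) a - c) Y _ mY _ V mV.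
  have mYV : measurable (Y @^-1` V) by exact: measurable_preimage.
  rewrite RintegralB//; last 2 first.
  - exact: integrableS (ikX t a t0).
  - exact: integrableS (icst c).
  rewrite Rintegral_cst//.
  move=> /(_ _ _)/eqP; rewrite subr_eq0 => H0; apply/eqP/H0.
    exact: (integrableB_EFin (ikX t a t0) (icst c)).
  move=> u b u0; rewrite centered//; last 2 first.
  - exact: ikY.
  - by apply: iM => // x; exact: k1.
  by rewrite XY// subrr.
move=> U V mU mV.
have mYV : measurable (Y @^-1` V) by exact: measurable_preimage.
have mXU : measurable (X @^-1` U) by exact: measurable_preimage.
set c := fine (Q (Y @^-1` V)).
have i1 : Q.-integrable setT (EFin \o (\1_(Y @^-1` V) : T -> R)).
  by apply: (@integrable_bounded _ _ _ _ _ 1) => //; exact: ind1.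
have := @gaussk_determining R H sepH _ T Q
  (fun x => \1_(Y @^-1` V) x - c) X _ mX _ U mU.
rewrite RintegralB//; last 2 first.
- exact: integrableS i1.
- exact: integrableS (icst c).
rewrite Rintegral_cst// Rintegral_indicI// => /(_ _ _)/eqP.
rewrite subr_eq0 => H0.
rewrite (EFin_probability Q (measurableI _ _ mXU mYV)).
rewrite (EFin_probability Q mXU) (EFin_probability Q mYV) -EFinM -/c mulrC.
congr EFin; apply/eqP/H0; first exact: (integrableB_EFin i1 (icst c)).
move=> t a t0; rewrite centered//; last 2 first.
- exact: ikX.
- by apply: iM => // x; exact: k1.
under eq_Rintegral do rewrite mulrC.
by rewrite -Rintegral_indicE step1// mulrC subrr.
Qed.

(** * Independent copies and products of four-point differences *)

Lemma same_law_pair (R : realType) dS (S : measurableType dS) (Q : probability S R)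
    dA (A : measurableType dA) dB (B : measurableType dB)
    (U U' : S -> A) (V V' : S -> B) :
  measurable_fun setT U -> measurable_fun setT V ->
  measurable_fun setT U' -> measurable_fun setT V' ->
  indep Q U V -> indep Q U' V' -> same_law Q Q U U' -> same_law Q Q V V' ->
  same_law Q Q (pair_fun U V) (pair_fun U' V').
Proof.
move=> mU mV mU' mV' UV UV' lU lV E mE.
have mI : measurable_fun setT (fun z : A * B => (\1_E z)%:E : \bar R).
  exact/measurable_EFinP/measurable_indic.
have I0 z : (0 <= (\1_E z)%:E :> \bar R)%E by rewrite lee_fin indicE.
have QE (W : S -> A * B) : measurable_fun setT W ->
    (Q (W @^-1` E) = \int[Q]_w (\1_E (W w))%:E)%E.
  move=> mW; have mWE : measurable (W @^-1` E) by exact: measurable_preimage.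
  transitivity (\int[Q]_w (\1_(W @^-1` E) w)%:E)%E.
    by rewrite integral_indic// setIT.
  by apply: eq_integral => w _; rewrite !indicE.
rewrite !QE; last 2 first.
- exact: measurable_fun_pair.
- exact: measurable_fun_pair.
rewrite /pair_fun (ge0_integral_indep mU mV UV mI I0).
rewrite (ge0_integral_indep mU' mV' UV' mI I0).
pose g a := (\int[Q]_w' (\1_E (a, V' w'))%:E : \bar R)%E.
transitivity (\int[Q]_w g (U w))%E.
  apply: eq_integral => w _; rewrite /g.
  apply: (same_law_integral mV mV' lV (f := fun b => (\1_E (U w, b))%:E)).
  have mp : measurable_fun setT (fun b : B => (U w, b)) by exact: measurable_fun_pair.
  exact: (measurableT_comp mI mp).
apply: (same_law_integral mU mU' lU).
have : measurable_fun setT (fubini_F (distribution Q (mfun_Sub (mem_set mV')))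
    (fun z : A * B => (\1_E z)%:E : \bar R)).
  exact: measurable_fun_fubini_tonelli_F.
congr (measurable_fun _ _); apply/funext => a.
rewrite /fubini_F measurable_integral_pushforward//.
have mp : measurable_fun setT (fun b : B => (a, b)) by exact: measurable_fun_pair.
exact: (measurableT_comp mI mp).
Qed.

Section copies.
Context (R : realType) (H H' : hilbertType R).
Context dT (T : measurableType dT) (P : probability T R).
Variables (X : {RV P >-> borel H}) (Y : {RV P >-> borel H'}).
Context dS (S : measurableType dS) (Q : probability S R).
Variables (Xs : nat -> {RV Q >-> borel H}) (Ys : nat -> {RV Q >-> borel H'}).
Hypothesis copies : independent_copies X Y Xs Ys.

Local Notation E := (borel H * borel H')%type.

Definition copy (i : nat) : S -> E := pair_fun (Xs i) (Ys i).

Lemma measurable_copy i : measurable_fun setT (copy i).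
Proof. by apply: measurable_fun_pair; exact: measurable_funP. Qed.

Lemma same_law_copy i j : same_law Q Q (copy i) (copy j).
Proof. by move=> U mU; rewrite -(copies.1 i) -?(copies.1 j). Qed.

Lemma copies_prod (A : nat -> set E) (J : seq nat) : uniq J ->
  (forall i, measurable (A i)) ->
  Q (\big[setI/setT]_(i <- J) (copy i @^-1` A i)) =
  (\prod_(i <- J) Q (copy i @^-1` A i))%E.
Proof.
move=> uJ mA; apply: copies.2 => // i _; split => //.
by exists (A i) => //; rewrite setTI.
Qed.

Lemma indep_copy i j : i != j -> indep Q (copy i) (copy j).
Proof.
move=> ij C D mC mD; pose A m := if m == i then C else D.
have mA m : measurable (A m) by rewrite /A; case: ifP.
have := @copies_prod A [:: i; j]; rewrite /= inE ij => /(_ isT mA).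
by rewrite !big_cons !big_nil setIT mule1 /A eqxx eq_sym (negbTE ij).
Qed.

Definition copy2 i j : S -> E * E := pair_fun (copy i) (copy j).

Lemma measurable_copy2 i j : measurable_fun setT (copy2 i j).
Proof. by apply: measurable_fun_pair; exact: measurable_copy. Qed.

Lemma indep_copy2 i j k l : uniq [:: i; j; k; l] -> indep Q (copy2 i j) (copy2 k l).
Proof.
move=> u; have /= := u; rewrite !inE !negb_or !andbT.
move=> /and3P[/and3P[ij ik il] /andP[jk jl] kl].
apply: indep_pair; try exact: measurable_copy.
move=> C D C' D' mC mD mC' mD'.
pose A m := if m == i then C else if m == j then D else if m == k then C' else D'.
have mA m : measurable (A m) by rewrite /A; do ?case: ifP.
have := @copies_prod A [:: i; j; k; l] u mA.
have := @copies_prod A [:: i; j]; rewrite /= inE ij => /(_ isT mA).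
have := @copies_prod A [:: k; l]; rewrite /= inE kl => /(_ isT mA).
have Ai : A i = C by rewrite /A eqxx.
have Aj : A j = D by rewrite /A eqxx eq_sym (negbTE ij).
have Ak : A k = C' by rewrite /A eqxx !(eq_sym k) (negbTE ik) (negbTE jk).
have Al : A l = D'.
  by rewrite /A !(eq_sym l) (negbTE il) (negbTE jl) (negbTE kl).
rewrite !big_cons !big_nil !setIT !mule1 Ai Aj Ak Al => -> -> H4.
by rewrite -setIA H4 muleA.
Qed.

Lemma same_law_copy2 i j k l : i != j -> k != l ->
  same_law Q Q (copy2 i j) (copy2 k l).
Proof.
move=> ij kl; apply: same_law_pair; try exact: measurable_copy.
- exact: indep_copy.
- exact: indep_copy.
- exact: same_law_copy.
- exact: same_law_copy.
Qed.

Definition copy4 i j k l : S -> (E * E) * (E * E) := pair_fun (copy2 i j) (copy2 k l).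

Lemma measurable_copy4 i j k l : measurable_fun setT (copy4 i j k l).
Proof. by apply: measurable_fun_pair; exact: measurable_copy2. Qed.

(** Exchangeability for four distinct indices, built up as a pair of independent pairs. *)
Lemma same_law_copy4 i j k l i' j' k' l' :
  uniq [:: i; j; k; l] -> uniq [:: i'; j'; k'; l'] ->
  same_law Q Q (copy4 i j k l) (copy4 i' j' k' l').
Proof.
move=> u u'; apply: same_law_pair; try exact: measurable_copy2.
- exact: indep_copy2.
- exact: indep_copy2.
- apply: same_law_copy2; [move: u|move: u'] => /=; rewrite !inE !negb_or.
    by move=> /andP[/and3P[]].
  by move=> /andP[/and3P[]].
- apply: same_law_copy2; [move: u|move: u'] => /=; rewrite !inE !negb_or !andbT.
    by move=> /and3P[].
  by move=> /and3P[].
Qed.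

Section hat_product.
Variables (h : H -> H -> R) (h' : H' -> H' -> R).
Hypothesis mh : measurable_fun setT (fun z : borel H * borel H => h z.1 z.2).
Hypothesis mh' : measurable_fun setT (fun z : borel H' * borel H' => h' z.1 z.2).
Hypotheses (hC : forall x y, h x y = h y x) (h'C : forall x y, h' x y = h' y x).

Definition kprod i j k l (w : S) : R :=
  h (Xs i w) (Xs j w) * h' (Ys k w) (Ys l w).

Lemma kprodC i j k l w : kprod i j k l w = kprod j i k l w.
Proof. by rewrite /kprod hC. Qed.

Lemma kprodC' i j k l w : kprod i j k l w = kprod i j l k w.
Proof. by rewrite /kprod h'C. Qed.

(* The same pair, a common index, and disjoint pairs. *)
Definition same_pair i j := kprod i j i j.
Definition one_common i j k := kprod i j i k.

Let proj (z : (E * E) * (E * E)) (i : nat) : E :=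
  nth z.1.1 [:: z.1.1; z.1.2; z.2.1; z.2.2] i.

Let mproj i : measurable_fun setT (proj^~ i).
Proof.
have m1 := measurableT_comp (@measurable_fst _ _ E E) (@measurable_fst _ _ (E * E)%type (E * E)%type).
have m2 := measurableT_comp (@measurable_snd _ _ E E) (@measurable_fst _ _ (E * E)%type (E * E)%type).
have m3 := measurableT_comp (@measurable_fst _ _ E E) (@measurable_snd _ _ (E * E)%type (E * E)%type).
have m4 := measurableT_comp (@measurable_snd _ _ E E) (@measurable_snd _ _ (E * E)%type (E * E)%type).
case: i => [//|[//|[//|[//|i]]]]; rewrite /proj/=.
by under eq_fun do rewrite nth_nil.
Qed.

Let F p q r s z := h (proj z p).1 (proj z q).1 * h' (proj z r).2 (proj z s).2.

Let mF p q r s : measurable_fun setT (F p q r s).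
Proof.
apply: measurable_funM.
  apply: (measurableT_comp (g := fun z => ((proj z p).1, (proj z q).1)) mh).
  by apply: measurable_fun_pair; exact: measurableT_comp.
apply: (measurableT_comp (g := fun z => ((proj z r).2, (proj z s).2)) mh').
by apply: measurable_fun_pair; exact: measurableT_comp.
Qed.

(** Here p, q, r, s are positions in a list of four distinct indices; a product of kernels at
    reference positions has the same integral and integrability after relabelling. *)
Lemma kprod_transfer (p q r s : nat) (i0 i1 i2 i3 : nat) :
  uniq [:: i0; i1; i2; i3] -> (p < 4)%N -> (q < 4)%N -> (r < 4)%N -> (s < 4)%N ->
  let n := nth 0%N [:: i0; i1; i2; i3] in
  \int[Q]_w kprod (n p) (n q) (n r) (n s) w = \int[Q]_w kprod p q r s w /\
  (Q.-integrable setT (EFin \o kprod p q r s) ->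
   Q.-integrable setT (EFin \o kprod (n p) (n q) (n r) (n s))).
Proof.
move=> u p4 q4 r4 s4 n.
have projE j0 j1 j2 j3 m w : (m < 4)%N ->
    proj (copy4 j0 j1 j2 j3 w) m = copy (nth 0%N [:: j0; j1; j2; j3] m) w.
  by case: m => [//|[//|[//|[//|]]]].
have kE j0 j1 j2 j3 w : F p q r s (copy4 j0 j1 j2 j3 w) =
    let m := nth 0%N [:: j0; j1; j2; j3] in kprod (m p) (m q) (m r) (m s) w.
  by rewrite /F !projE.
have id4 m : (m < 4)%N -> nth 0%N [:: 0; 1; 2; 3]%N m = m.
  by case: m => [//|[//|[//|[//|]]]].
have kE0 w : F p q r s (copy4 0 1 2 3 w) = kprod p q r s w by rewrite kE/= !id4.
have l1 := @same_law_copy4 i0 i1 i2 i3 0 1 2 3 u isT.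
have l2 := @same_law_copy4 0 1 2 3 i0 i1 i2 i3 isT u.
split.
  have := same_law_Rintegral (measurable_copy4 _ _ _ _) (measurable_copy4 _ _ _ _) l1 (mF p q r s).
  by under eq_Rintegral do rewrite kE; under [X in _ = X]eq_Rintegral do rewrite kE0.
have := same_law_integrable (measurable_copy4 _ _ _ _) (measurable_copy4 _ _ _ _) l2 (mF p q r s).
under [X in _.-integrable _ (_ \o X) -> _]eq_fun do rewrite kE0.
by under [X in _ -> _.-integrable _ (_ \o X)]eq_fun do rewrite kE.
Qed.

Hypothesis int_same : Q.-integrable setT (EFin \o kprod 0 1 0 1).
Hypothesis int_common : Q.-integrable setT (EFin \o kprod 0 1 0 2).
Hypothesis int_disjoint : Q.-integrable setT (EFin \o kprod 0 1 2 3).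

(** [hat4] is the alternating sum over the edges of the 4-cycle 0-1-2-3. In a product of two of
    them, 4 pairs of edges coincide and 4 are opposite, with sign plus, while 8 are adjacent, with
    sign minus; this is the origin of the factor 4 and the coefficient -2 in
    [Rintegral_hat4_prod]. *)
Let edges : seq (R * (nat * nat)) :=
  [:: (1, (0%N, 1%N)); (-1, (1%N, 2%N)); (1, (2%N, 3%N)); (-1, (3%N, 0%N))].

Let hat4_prodE w :
  hat4 h (Xs 0 w) (Xs 1 w) (Xs 2 w) (Xs 3 w) *
  hat4 h' (Ys 0 w) (Ys 1 w) (Ys 2 w) (Ys 3 w) =
  \sum_(e <- edges) \sum_(f <- edges) e.1 * f.1 * kprod e.2.1 e.2.2 f.2.1 f.2.2 w.
Proof. by rewrite /hat4 /edges !big_cons !big_nil /kprod/=; ring. Qed.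

Let edge_value (e f : nat * nat) :=
  if e == f then \int[Q]_w kprod 0 1 0 1 w
  else if (e.1 \in [:: f.1; f.2]) || (e.2 \in [:: f.1; f.2])
  then \int[Q]_w kprod 0 1 0 2 w else \int[Q]_w kprod 0 1 2 3 w.

Let edgeP e f : e \in edges -> f \in edges ->
  Q.-integrable setT (EFin \o kprod e.2.1 e.2.2 f.2.1 f.2.2) /\
  \int[Q]_w kprod e.2.1 e.2.2 f.2.1 f.2.2 w = edge_value e.2 f.2.
Proof.
have fC i j k l : kprod i j k l = kprod j i k l by apply/funext => w; exact: kprodC.
have fC' i j k l : kprod i j k l = kprod i j l k by apply/funext => w; exact: kprodC'.
(* The last four indices given to [tr] are the images of the positions 0, 1, 2, 3; symmetry of the
   kernels is used beforehand to bring a common index to the first place of both pairs. *)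
have tr p q r s i0 i1 i2 i3 u p4 q4 r4 s4 intk :=
  let: conj v i := @kprod_transfer p q r s i0 i1 i2 i3 u p4 q4 r4 s4 in conj (i intk) v.
rewrite !inE => /or4P[]/eqP-> /or4P[]/eqP->/=.
- exact: (tr 0 1 0 1 0 1 2 3 isT isT isT isT isT int_same).
- rewrite (fC 0 1); exact: (tr 0 1 0 2 1 0 2 3 isT isT isT isT isT int_common).
- exact: (tr 0 1 2 3 0 1 2 3 isT isT isT isT isT int_disjoint).
- rewrite (fC' 0 1 3 0); exact: (tr 0 1 0 2 0 1 3 2 isT isT isT isT isT int_common).
- rewrite (fC' 1 2 0 1); exact: (tr 0 1 0 2 1 2 0 3 isT isT isT isT isT int_common).
- exact: (tr 0 1 0 1 1 2 0 3 isT isT isT isT isT int_same).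
- rewrite (fC 1 2); exact: (tr 0 1 0 2 2 1 3 0 isT isT isT isT isT int_common).
- exact: (tr 0 1 2 3 1 2 3 0 isT isT isT isT isT int_disjoint).
- exact: (tr 0 1 2 3 2 3 0 1 isT isT isT isT isT int_disjoint).
- rewrite (fC' 2 3 1 2); exact: (tr 0 1 0 2 2 3 1 0 isT isT isT isT isT int_common).
- exact: (tr 0 1 0 1 2 3 0 1 isT isT isT isT isT int_same).
- rewrite (fC 2 3); exact: (tr 0 1 0 2 3 2 0 1 isT isT isT isT isT int_common).
- rewrite (fC 3 0); exact: (tr 0 1 0 2 0 3 1 2 isT isT isT isT isT int_common).
- exact: (tr 0 1 2 3 3 0 1 2 isT isT isT isT isT int_disjoint).
- rewrite (fC' 3 0 2 3); exact: (tr 0 1 0 2 3 0 2 1 isT isT isT isT isT int_common).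
- exact: (tr 0 1 0 1 3 0 1 2 isT isT isT isT isT int_same).
Qed.

Let int_term e f : e \in edges -> f \in edges -> Q.-integrable setT
  (EFin \o (fun w => e.1 * f.1 * kprod e.2.1 e.2.2 f.2.1 f.2.2 w)).
Proof. by move=> eE fE; apply: integrableZ_EFin; exact: (edgeP eE fE).1. Qed.

Lemma integrable_hat4_prod : Q.-integrable setT (EFin \o (fun w =>
  hat4 h (Xs 0 w) (Xs 1 w) (Xs 2 w) (Xs 3 w) *
  hat4 h' (Ys 0 w) (Ys 1 w) (Ys 2 w) (Ys 3 w))).
Proof.
under [X in _ \o X]eq_fun do rewrite hat4_prodE.
apply: integrable_sum_EFin => e eE; apply: integrable_sum_EFin => f fE.
exact: int_term.
Qed.

Lemma Rintegral_hat4_prod :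
  \int[Q]_w (hat4 h (Xs 0 w) (Xs 1 w) (Xs 2 w) (Xs 3 w) *
             hat4 h' (Ys 0 w) (Ys 1 w) (Ys 2 w) (Ys 3 w)) =
  4 * (\int[Q]_w kprod 0 1 0 1 w + \int[Q]_w kprod 0 1 2 3 w
       - 2 * \int[Q]_w kprod 0 1 0 2 w).
Proof.
under eq_Rintegral do rewrite hat4_prodE.
rewrite Rintegral_sum; last first.
  by move=> e eE; apply: integrable_sum_EFin => f fE; exact: int_term.
rewrite (eq_big_seq (fun e => \sum_(f <- edges) e.1 * f.1 * edge_value e.2 f.2)); last first.
  move=> e eE; rewrite Rintegral_sum; last by move=> f fE; exact: int_term.
  apply: eq_big_seq => f fE; have [i1 i2] := edgeP eE fE.
  by rewrite RintegralZl// i2.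
rewrite /edges !big_cons !big_nil /edge_value/=.
by ring.
Qed.

End hat_product.
End copies.

(** * Gaussian covariances are controlled by expected four-point products *)

Lemma measurable_gaussk2 (R : realType) (H : hilbertType R) (t : R) :
  separable H ->
  measurable_fun setT (fun z : borel H * borel H => gaussk t (z.1 : H) (z.2 : H)).
Proof.
move=> sepH; apply: measurableT_comp => //; apply: measurableT_comp => //.
apply: measurable_funM => //; apply: measurable_funX.
exact: measurable_dist.
Qed.

Lemma quad_form_cons (R : realType) (Z I : Type) (K : Z -> Z -> R) (c : R) (z : Z)
    (f : I -> Z) (s : seq I) :
  quad_form K ((c, z) :: [seq (1, f i) | i <- s]) =
  c ^+ 2 * K z z + \sum_(i <- s) c * (K z (f i) + K (f i) z) +
  \sum_(i <- s) \sum_(j <- s) K (f i) (f j).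
Proof.
rewrite /quad_form big_cons big_map/= big_cons big_map/=.
under [X in _ + X]eq_bigr do rewrite big_cons big_map/= mulr1.
under [X in _ + X]eq_bigr do under eq_bigr do rewrite !mul1r.
rewrite big_split/= addrA; congr (_ + _).
rewrite -expr2 -addrA; congr (_ + _); rewrite -big_split/=.
by apply: eq_bigr => i _; ring.
Qed.

Lemma cvg_le_slope (R : realType) (x c : R) :
  (forall n, x <= c / n.+1%:R) -> x <= 0.
Proof.
move=> xc; have : c / n.+1%:R @[n --> \oo] --> 0.
  rewrite -(mulr0 c); apply: cvgM; first exact: cvg_cst.
  exact: cvg_invn.
move=> cv; rewrite -(cvg_lim _ cv)//.
apply: limr_ge; first exact: cvgP cv.
exact: nearW.
Qed.

Section covariance_bound.
Context (R : realType) (H H' : hilbertType R).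
Hypotheses (sepH : separable H) (sepH' : separable H').
Context dT (T : measurableType dT) (P : probability T R).
Variables (X : {RV P >-> borel H}) (Y : {RV P >-> borel H'}).
Context dS (S : measurableType dS) (Q : probability S R).
Variables (Xs : nat -> {RV Q >-> borel H}) (Ys : nat -> {RV Q >-> borel H'}).
Hypothesis copies : independent_copies X Y Xs Ys.
Variables (t s : R) (a : H) (b : H').
Hypotheses (t0 : 0 <= t) (s0 : 0 <= s).

Let mX i : measurable_fun setT (Xs i). Proof. exact: measurable_funP. Qed.
Let mY i : measurable_fun setT (Ys i). Proof. exact: measurable_funP. Qed.

Let k (i : nat) (w : S) := gaussk t (Xs i w : H) a.
Let l (i : nat) (w : S) := gaussk s (Ys i w : H') b.

Let mk i : measurable_fun setT (k i).
Proof. exact: (measurableT_comp (measurable_gaussk t a) (mX i)). Qed.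

Let ml i : measurable_fun setT (l i).
Proof. exact: (measurableT_comp (measurable_gaussk s b) (mY i)). Qed.

Let normr_gaussk (K : hilbertType R) (u : R) (x y : K) : 0 <= u -> `|gaussk u x y| <= 1.
Proof. by move=> u0; rewrite gtr0_norm ?gaussk_gt0// gaussk_le1. Qed.

Let ik i : Q.-integrable setT (EFin \o k i).
Proof. by apply: (@integrable_bounded _ _ _ _ _ 1) => // w; exact: normr_gaussk. Qed.

Let il i : Q.-integrable setT (EFin \o l i).
Proof. by apply: (@integrable_bounded _ _ _ _ _ 1) => // w; exact: normr_gaussk. Qed.

Let ikl i j : Q.-integrable setT (EFin \o (fun w => k i w * l j w)).
Proof.
apply: (@integrable_bounded _ _ _ _ _ 1); first exact: measurable_funM.
by move=> w; rewrite normrM mulr_ile1// normr_gaussk.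
Qed.

Let hatG (w : S) (i0 i1 i2 i3 : nat) : R :=
  hat4 (gaussk t) (Xs i0 w : H) (Xs i1 w : H) (Xs i2 w : H) (Xs i3 w : H) *
  hat4 (gaussk s) (Ys i0 w : H') (Ys i1 w : H') (Ys i2 w : H') (Ys i3 w : H').

Definition hat_gauss : R := \int[Q]_w hatG w 0 1 2 3.

Definition gauss_cov : R :=
  \int[Q]_w (k 0%N w * l 0%N w) - \int[Q]_w k 0%N w * \int[Q]_w l 0%N w.

Let W := ((H * H * R) * (H' * H' * R))%type.

Let Dx (z z' : H * H * R) : R := gaussk t z.1.1 z'.1.1 - z'.2 * gaussk t z.1.1 z'.1.2
  - z.2 * gaussk t z.1.2 z'.1.1 + z.2 * z'.2 * gaussk t z.1.2 z'.1.2.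

Let Dy (z z' : H' * H' * R) : R := gaussk s z.1.1 z'.1.1 - z'.2 * gaussk s z.1.1 z'.1.2
  - z.2 * gaussk s z.1.2 z'.1.1 + z.2 * z'.2 * gaussk s z.1.2 z'.1.2.

Let psd_D : psd (fun z z' : W => Dx z.1 z'.1 * Dy z.2 z'.2).
Proof.
have p0 : psd (fun z z' : H * H' => gaussk t z.1 z'.1 * gaussk s z.2 z'.2).
  apply: (@psd_gaussk _ H' _ (fun z z' : H * H' => gaussk t z.1 z'.1) snd) => //.
  have := @psd_gaussk R H _ (fun _ _ : H * H' => 1) fst t t0 (@psd_cst1 R _).
  by under eq_fun2 do rewrite mul1r.
have p1 := @psd_diff R _ ((H * H * R) * H')%type (fun z => (z.1.1.1, z.2))
  (fun z => (z.1.1.2, z.2)) (fun z => z.1.2) _ p0.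
have p2 := @psd_diff R _ W (fun z => (z.1, z.2.1.1)) (fun z => (z.1, z.2.1.2))
  (fun z => z.2.2) _ p1.
move=> ls; have := p2 ls; rewrite /quad_form; congr (_ <= _).
apply: eq_bigr => p _; apply: eq_bigr => q _; rewrite /Dx /Dy/=; ring.
Qed.

(** [pt i] encodes the tensor product of the differences of point masses at X_2i, X_(2i+1) and at
    Y_2i, Y_(2i+1), built from disjoint pairs of copies for different i. [pt0] encodes the point
    mass at a tensored with the one at b: its coefficients are 0, so its second entries are
    placeholders. *)
Let pt (i : nat) (w : S) : W :=
  ((Xs i.*2 w : H, Xs i.*2.+1 w : H, 1), (Ys i.*2 w : H', Ys i.*2.+1 w : H', 1)).
Let pt0 : W := ((a, a, 0), (b, b, 0)).

Let M (z z' : W) : R := Dx z.1 z'.1 * Dy z.2 z'.2.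

Let M_pt i j w : M (pt i w) (pt j w) = hatG w i.*2 j.*2 i.*2.+1 j.*2.+1.
Proof.
rewrite /M /Dx /Dy /hatG /hat4/=.
rewrite (gausskC t (Xs j.*2 w)) (gausskC t (Xs j.*2.+1 w)).
rewrite (gausskC s (Ys j.*2 w)) (gausskC s (Ys j.*2.+1 w)).
by congr (_ * _); ring.
Qed.

Let M_pt0 i w : M (pt i w) pt0 = (k i.*2 w - k i.*2.+1 w) * (l i.*2 w - l i.*2.+1 w).
Proof. by rewrite /M /Dx /Dy /k /l/=; ring. Qed.

Let M_pt0' i w : M pt0 (pt i w) = M (pt i w) pt0.
Proof.
rewrite /M /Dx /Dy/= (gausskC t a (Xs i.*2 w)) (gausskC t a (Xs i.*2.+1 w)).
by rewrite (gausskC s b (Ys i.*2 w)) (gausskC s b (Ys i.*2.+1 w)); ring.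
Qed.

Let M00 : M pt0 pt0 = 1.
Proof. by rewrite /M /Dx /Dy/= !gausskxx; ring. Qed.

Let mgX i j : measurable_fun setT (fun w => gaussk t (Xs i w : H) (Xs j w : H)).
Proof.
apply: (measurableT_comp (g := fun w => (Xs i w, Xs j w)) (measurable_gaussk2 t sepH)).
exact: measurable_fun_pair.
Qed.

Let mgY i j : measurable_fun setT (fun w => gaussk s (Ys i w : H') (Ys j w : H')).
Proof.
apply: (measurableT_comp (g := fun w => (Ys i w, Ys j w)) (measurable_gaussk2 s sepH')).
exact: measurable_fun_pair.
Qed.

Let normr_hat4 (K : hilbertType R) (u : R) (x0 x1 x2 x3 : K) : 0 <= u ->
  `|hat4 (gaussk u) x0 x1 x2 x3| <= 4.
Proof.
move=> u0; have n x y := normr_gaussk x y u0.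
rewrite /hat4 (le_trans (ler_normB _ _))//.
rewrite (_ : 4 = 1 + 1 + 1 + 1 :> R); last by ring.
rewrite lerD// (le_trans (ler_normD _ _))// lerD// (le_trans (ler_normB _ _))//.
exact: lerD.
Qed.

Let ihatG i0 i1 i2 i3 : Q.-integrable setT (EFin \o (fun w => hatG w i0 i1 i2 i3)).
Proof.
apply: (@integrable_bounded _ _ _ _ _ (4 * 4)).
  apply: measurable_funM; apply: measurable_funB => //;
  by apply: measurable_funD => //; exact: measurable_funB.
by move=> w; rewrite normrM ler_pM// normr_hat4.
Qed.

Let EhatG i j : i != j ->
  \int[Q]_w hatG w i.*2 j.*2 i.*2.+1 j.*2.+1 = hat_gauss.
Proof.
move=> ij.
have u : uniq [:: i.*2; j.*2; i.*2.+1; j.*2.+1].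
  rewrite /= !inE !negb_or !andbT; move/eqP: ij => ij.
  by repeat (apply/andP; split); apply/eqP; lia.
pose F (z : (borel H * borel H') * (borel H * borel H') *
          ((borel H * borel H') * (borel H * borel H'))) : R :=
  hat4 (gaussk t) (z.1.1.1 : H) (z.1.2.1 : H) (z.2.1.1 : H) (z.2.2.1 : H) *
  hat4 (gaussk s) (z.1.1.2 : H') (z.1.2.2 : H') (z.2.1.2 : H') (z.2.2.2 : H').
have mF : measurable_fun setT F.
  pose E := (borel H * borel H')%type.
  have m1 := measurableT_comp (@measurable_fst _ _ E E) (@measurable_fst _ _ (E * E)%type (E * E)%type).
  have m2 := measurableT_comp (@measurable_snd _ _ E E) (@measurable_fst _ _ (E * E)%type (E * E)%type).
  have m3 := measurableT_comp (@measurable_fst _ _ E E) (@measurable_snd _ _ (E * E)%type (E * E)%type).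
  have m4 := measurableT_comp (@measurable_snd _ _ E E) (@measurable_snd _ _ (E * E)%type (E * E)%type).
  have mg1 (f g : (E * E) * (E * E) -> E) : measurable_fun setT f ->
      measurable_fun setT g -> measurable_fun setT (fun z => gaussk t ((f z).1 : H) ((g z).1 : H)).
    move=> mf mg; apply: (measurableT_comp (g := fun z => ((f z).1, (g z).1)) (measurable_gaussk2 t sepH)).
    by apply: measurable_fun_pair; exact: measurableT_comp.
  have mg2 (f g : (E * E) * (E * E) -> E) : measurable_fun setT f ->
      measurable_fun setT g -> measurable_fun setT (fun z => gaussk s ((f z).2 : H') ((g z).2 : H')).
    move=> mf mg; apply: (measurableT_comp (g := fun z => ((f z).2, (g z).2)) (measurable_gaussk2 s sepH')).
    by apply: measurable_fun_pair; exact: measurableT_comp.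
  apply: measurable_funM.
    apply: measurable_funB; last exact: (mg1 _ _ m4 m1).
    apply: measurable_funD; last exact: (mg1 _ _ m3 m4).
    by apply: measurable_funB; [exact: (mg1 _ _ m1 m2)|exact: (mg1 _ _ m2 m3)].
  apply: measurable_funB; last exact: (mg2 _ _ m4 m1).
  apply: measurable_funD; last exact: (mg2 _ _ m3 m4).
  by apply: measurable_funB; [exact: (mg2 _ _ m1 m2)|exact: (mg2 _ _ m2 m3)].
exact: (same_law_Rintegral (measurable_copy4 Xs Ys _ _ _ _)
  (measurable_copy4 Xs Ys _ _ _ _) (same_law_copy4 copies u (isT : uniq [:: 0; 1; 2; 3]%N)) mF).
Qed.

(** Let p be the mean of [pt i] in the reproducing kernel space of the product kernel. Its squared
    norm is [hat_gauss], its pairing with the unit vector [pt0] is 2 [gauss_cov], and the claim is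
    Cauchy-Schwarz. Vector-valued means are avoided by testing positivity on n+1 independent [pt i]
    together with [pt0] and letting n tend to infinity. *)
Lemma gauss_cov_sqr_le : (2 * gauss_cov) ^+ 2 <= hat_gauss.
Proof.
set L := 2 * gauss_cov.
have EL i : \int[Q]_w ((k i.*2 w - k i.*2.+1 w) * (l i.*2 w - l i.*2.+1 w)) = L.
  have mE (f : H -> R) (g : H' -> R) : measurable_fun setT (f : borel H -> R) ->
      measurable_fun setT (g : borel H' -> R) ->
      measurable_fun setT (fun z : borel H * borel H' => f z.1 * g z.2).
    by move=> mf mg; apply: measurable_funM; exact: measurableT_comp.
  have mk' := measurable_gaussk t a; have ml' := measurable_gaussk s b.
  have mcst (K : hilbertType R) : measurable_fun setT ((fun=> 1) : borel K -> R) by [].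
  have Ekl m : \int[Q]_w (k m w * l m w) = \int[Q]_w (k 0%N w * l 0%N w).
    exact: (same_law_Rintegral (measurable_copy Xs Ys m) (measurable_copy Xs Ys 0)
      (same_law_copy copies m 0) (mE _ _ mk' ml')).
  have Ek m : \int[Q]_w k m w = \int[Q]_w k 0%N w.
    have := same_law_Rintegral (measurable_copy Xs Ys m) (measurable_copy Xs Ys 0)
      (same_law_copy copies m 0) (mE _ _ mk' (mcst H')).
    by under eq_Rintegral do rewrite mulr1; under [X in _ = X -> _]eq_Rintegral do rewrite mulr1.
  have El m : \int[Q]_w l m w = \int[Q]_w l 0%N w.
    have := same_law_Rintegral (measurable_copy Xs Ys m) (measurable_copy Xs Ys 0)
      (same_law_copy copies m 0) (mE _ _ (mcst H) ml').
    by under eq_Rintegral do rewrite mul1r; under [X in _ = X -> _]eq_Rintegral do rewrite mul1r.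
  have Eind m m' : m != m' -> \int[Q]_w (k m w * l m' w) =
      \int[Q]_w k 0%N w * \int[Q]_w l 0%N w.
    move=> mm'; rewrite -(Ek m) -(El m').
    have ind : indep Q (Xs m) (Ys m').
      exact: (indep_comp (measurable_fst) (measurable_snd) (indep_copy copies mm')).
    exact: (RintegralM_indep (mX m) (mY m') ind mk' ml' (ik m) (il m')).
  have i1 : (i.*2 != i.*2.+1)%N by lia.
  have i2 : (i.*2.+1 != i.*2)%N by lia.
  rewrite (_ : \int[Q]_w _ = \int[Q]_w ((k i.*2 w * l i.*2 w - k i.*2 w * l i.*2.+1 w) +
    (k i.*2.+1 w * l i.*2.+1 w - k i.*2.+1 w * l i.*2 w))); last first.
    by apply: eq_Rintegral => w _; ring.
  rewrite RintegralD//; [|exact: integrableB_EFin|exact: integrableB_EFin].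
  rewrite !RintegralB// !Ekl (Eind _ _ i1) (Eind _ _ i2).
  by rewrite /L /gauss_cov; ring.
have iM i : Q.-integrable setT (EFin \o (fun w => M (pt i w) pt0)).
  under [X in _ \o X]eq_fun do rewrite M_pt0.
  apply: (@integrable_bounded _ _ _ _ _ (2 * 2)).
    by apply: measurable_funM; exact: measurable_funB.
  move=> w; rewrite normrM ler_pM//.
    by rewrite (le_trans (ler_normB _ _))// (_ : 2 = 1 + 1)// lerD// normr_gaussk.
  by rewrite (le_trans (ler_normB _ _))// (_ : 2 = 1 + 1)// lerD// normr_gaussk.
have iMM i j : Q.-integrable setT (EFin \o (fun w => M (pt i w) (pt j w))).
  by under [X in _ \o X]eq_fun do rewrite M_pt; exact: ihatG.
rewrite -subr_le0; apply: (@cvg_le_slope _ _ (16 - hat_gauss)) => n.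
(* This weight of [pt0] minimizes c^2 + 2c(n+1)L, the part of the expected form that depends on
   c. *)
pose c : R := - (L * n.+1%:R).
have q0 w : 0 <= c ^+ 2 + \sum_(i < n.+1) (2 * c) * M (pt i w) pt0
    + \sum_(i < n.+1) \sum_(j < n.+1) M (pt i w) (pt j w).
  have := psd_D ((c, pt0) :: [seq (1, pt (val i) w) | i <- index_enum 'I_n.+1]).
  rewrite quad_form_cons -/(M pt0 pt0) M00 mulr1; congr (_ <= _ + _ + _).
    by apply: eq_bigr => i _; rewrite -/(M pt0 _) -/(M (pt i w) _) M_pt0'; ring.
have : 0 <= \int[Q]_w (c ^+ 2 + \sum_(i < n.+1) (2 * c) * M (pt i w) pt0
    + \sum_(i < n.+1) \sum_(j < n.+1) M (pt i w) (pt j w)) by apply: Rintegral_ge0.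
have i1 : Q.-integrable setT (EFin \o (fun w => \sum_(i < n.+1) (2 * c) * M (pt i w) pt0)).
  by apply: integrable_sum_EFin => i _; exact: integrableZ_EFin.
have i2 : Q.-integrable setT (EFin \o (fun w => \sum_(i < n.+1) \sum_(j < n.+1) M (pt i w) (pt j w))).
  by apply: integrable_sum_EFin => i _; exact: integrable_sum_EFin.
have ic : Q.-integrable setT (EFin \o (fun=> c ^+ 2)).
  exact: (@integrable_bounded _ _ _ _ _ `|c ^+ 2|).
rewrite RintegralD//; last exact: integrableD_EFin.
rewrite RintegralD// Rintegral_probability_cst.
rewrite Rintegral_sum; last by move=> i _; exact: integrableZ_EFin.
rewrite (eq_bigr (fun=> 2 * c * L)); last first.
  by move=> i _; rewrite RintegralZl//; under eq_Rintegral do rewrite M_pt0; rewrite EL.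
rewrite Rintegral_sum; last by move=> i _; exact: integrable_sum_EFin.
(* In each row the diagonal entry is at most 16 and the n others have expectation [hat_gauss]. *)
have H2 : \sum_(i < n.+1) \int[Q]_w (\sum_(j < n.+1) M (pt i w) (pt j w)) <=
   \sum_(i < n.+1) (16 + n%:R * hat_gauss).
  apply: ler_sum => i _; rewrite Rintegral_sum// (bigD1 i)//= lerD//.
    rewrite -[leRHS](Rintegral_probability_cst Q); apply: le_Rintegral => //.
      exact: (@integrable_bounded _ _ _ _ _ `|16|).
    move=> w _; rewrite M_pt (le_trans (ler_norm _))// /hatG normrM.
    by rewrite (_ : 16 = 4 * 4) ?ler_pM ?normr_hat4//; ring.
  rewrite (eq_bigr (fun=> hat_gauss)); last first.
    move=> j ji; under eq_Rintegral do rewrite M_pt.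
    by rewrite EhatG// eq_sym.
  by rewrite big_const -Monoid.iteropE/= cardC1 card_ord mulr_natl.
move: H2; rewrite !sumr_const !card_ord => H2 H1.
have {H2}H3 := le_trans H1 (lerD (lexx _) H2).
have n0 : 0 < n.+1%:R :> R by [].
rewrite ler_pdivlMr// -subr_ge0 -(pmulr_rge0 _ n0); apply: le_trans H3 _.
rewrite -[(2 * c * L) *+ _]mulr_natl -[(16 + _) *+ _]mulr_natl /c -natr1.
clear; clearbody L.
move: (n%:R) hat_gauss L => N g x; rewrite le_eqVlt; apply/orP; left; apply/eqP.
ring.
Qed.

End covariance_bound.

(** * Square-integrable functions and powers of distances *)

Section square_integrals.
Context d (T : measurableType d) (R : realType) (Q : probability T R).

Lemma sqr_Rintegral_le (f : T -> R) : Q.-integrable setT (EFin \o f) ->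
  Q.-integrable setT (EFin \o (fun x => f x ^+ 2)) ->
  (\int[Q]_x f x) ^+ 2 <= \int[Q]_x (f x ^+ 2).
Proof.
move=> intf intf2; set m := \int[Q]_x f x.
have : 0 <= \int[Q]_x ((f x - m) ^+ 2) by apply: Rintegral_ge0 => x _; exact: sqr_ge0.
rewrite (_ : \int[Q]_x _ = \int[Q]_x (f x ^+ 2 - (2 * m * f x - m ^+ 2))); last first.
  by apply: eq_Rintegral => x _; ring.
have ic : Q.-integrable setT (EFin \o (fun=> m ^+ 2)).
  exact: integrable_probability_cst.
rewrite RintegralB//; last by apply: integrableB_EFin => //; exact: integrableZ_EFin.
rewrite RintegralB//; last exact: integrableZ_EFin.
rewrite RintegralZl// Rintegral_probability_cst -/m.
by rewrite (_ : 2 * m * m - m ^+ 2 = m ^+ 2) ?subr_ge0//; ring.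
Qed.

Lemma integrableM_sqr (f g : T -> R) : measurable_fun setT f -> measurable_fun setT g ->
  Q.-integrable setT (EFin \o (fun x => f x ^+ 2)) ->
  Q.-integrable setT (EFin \o (fun x => g x ^+ 2)) ->
  Q.-integrable setT (EFin \o (fun x => f x * g x)).
Proof.
move=> mf mg if2 ig2; apply: (integrable_le (g := fun x => f x ^+ 2 + g x ^+ 2)).
- exact: measurable_funM.
- exact: integrableD_EFin.
- move=> x; rewrite normrM -[f x ^+ 2]real_normK ?num_real//.
  rewrite -[g x ^+ 2]real_normK ?num_real//.
  have : 0 <= (`|f x| - `|g x|) ^+ 2 by exact: sqr_ge0.
  by have := normr_ge0 (f x); have := normr_ge0 (g x); nra.
Qed.

Lemma Rintegral_cst_sub_add_sub (c : R) (f g h : T -> R) :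
  Q.-integrable setT (EFin \o f) -> Q.-integrable setT (EFin \o g) ->
  Q.-integrable setT (EFin \o h) ->
  \int[Q]_x (c - f x + g x - h x) =
  c - \int[Q]_x f x + \int[Q]_x g x - \int[Q]_x h x.
Proof.
move=> intf intg inth; have ic := @integrable_probability_cst _ _ _ Q c.
rewrite RintegralB//; last by apply: integrableD_EFin => //; exact: integrableB_EFin.
rewrite RintegralD//; last exact: integrableB_EFin.
by rewrite RintegralB// Rintegral_probability_cst.
Qed.

End square_integrals.

Section powers_of_distances.
Context (R : realType) (H : hilbertType R).

Lemma dpow_ge0 (p : R) (x y : H) : 0 <= dpow p x y.
Proof. exact: powR_ge0. Qed.

Lemma dpow_le (p : R) (x y : H) : 0 <= p ->
  dpow p x y <= 2 `^ p * (`|x| `^ p + `|y| `^ p).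
Proof.
move=> p0; rewrite /dpow.
have m0 : 0 <= Num.max `|x| `|y| by rewrite le_max normr_ge0.
apply: (@le_trans _ _ ((2 * Num.max `|x| `|y|) `^ p)).
  apply: ge0_ler_powR; rewrite ?nnegrE ?mulr_ge0//.
  rewrite (le_trans (ler_normB _ _))// mulr_natl mulr2n.
  by apply: lerD; rewrite le_max lexx ?orbT.
rewrite powRM// ler_wpM2l ?powR_ge0//.
by case: (leP `|x| `|y|) => _; rewrite ?lerDl ?lerDr powR_ge0.
Qed.

Lemma powR_le1D (x p q : R) : 0 <= x -> 0 <= p <= q -> x `^ p <= 1 + x `^ q.
Proof.
move=> x0 /andP[p0 pq]; have [x1|/ltW x1] := leP x 1.
  apply: (@le_trans _ _ (1 `^ p)); last by rewrite powR1 lerDl powR_ge0.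
  by rewrite ge0_ler_powR// nnegrE.
by rewrite ler_wpDl// ler_powR.
Qed.

Lemma measurable_dpow (p : R) : separable H ->
  measurable_fun setT (fun z : borel H * borel H => dpow p (z.1 : H) (z.2 : H)).
Proof.
move=> sepH; exact: (measurableT_comp (measurable_powR p) (measurable_dist sepH)).
Qed.

Lemma measurable_norm_powR (p : R) :
  measurable_fun setT (fun x : borel H => `|x : H| `^ p).
Proof.
apply: (measurableT_comp (measurable_powR p)).
rewrite [X in measurable_fun _ X](_ : _ = fun x : borel H => `|(x : H) - 0|).
  exact: measurable_norm_sub.
by apply/funext => x; rewrite subr0.
Qed.

End powers_of_distances.

(** * Doubly centred distances *)

Section centered_distance.
Context (R : realType) (H : hilbertType R) (sepH : separable H).
Context dS (S : measurableType dS) (Q : probability S R).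
Variable Z : nat -> {RV Q >-> borel H}.
Variable b : R.
Hypothesis b01 : 0 < b < 1.
Hypothesis indepZ : forall i j, i != j -> indep Q (Z i) (Z j).
Hypothesis indepZ2 : indep Q (pair_fun (Z 0) (Z 1)) (pair_fun (Z 2) (Z 3)).
Hypothesis same_lawZ : forall i j, same_law Q Q (Z i) (Z j).
Hypothesis intZ : Q.-integrable setT (EFin \o (fun w => `|Z 0 w : H| `^ (2 * b))).

Let b0 : 0 < b. Proof. by case/andP: b01. Qed.

Let mZ i : measurable_fun setT (Z i). Proof. exact: measurable_funP. Qed.

Let mZ2 i j : measurable_fun setT (fun w => (Z i w, Z j w)).
Proof. exact: measurable_fun_pair. Qed.

Let intZi p i : 0 <= p <= 2 * b -> Q.-integrable setT (EFin \o (fun w => `|Z i w : H| `^ p)).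
Proof.
move=> pb; have intZi' : Q.-integrable setT (EFin \o (fun w => `|Z i w : H| `^ (2 * b))).
  exact: (same_law_integrable (mZ 0) (mZ i) (same_lawZ 0 i) (measurable_norm_powR _)).
apply: (integrable_le (g := fun w => 1 + `|Z i w : H| `^ (2 * b))).
- exact: (measurableT_comp (measurable_norm_powR p) (mZ i)).
- apply: integrableD_EFin => //; exact: integrable_probability_cst.
- by move=> w; rewrite ger0_norm ?powR_ge0// powR_le1D.
Qed.

Let mdp p x i : measurable_fun setT (fun w => dpow p x (Z i w : H)).
Proof.
by apply: (measurableT_comp (g := fun w => (x : borel H, Z i w)) (measurable_dpow p sepH));
  exact: measurable_fun_pair.
Qed.

Lemma integrable_dpow1 p x i : 0 <= p <= 2 * b ->
  Q.-integrable setT (EFin \o (fun w => dpow p x (Z i w : H))).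
Proof.
move=> pb; have /andP[p0 _] := pb.
apply: (integrable_le (g := fun w => 2 `^ p * (`|x| `^ p + `|Z i w : H| `^ p))) => //.
- apply: integrableZ_EFin; apply: integrableD_EFin; last exact: intZi.
  exact: integrable_probability_cst.
- by move=> w; rewrite ger0_norm ?dpow_ge0// dpow_le.
Qed.

Lemma integrable_dpow2 p i j : 0 <= p <= 2 * b ->
  Q.-integrable setT (EFin \o (fun w => dpow p (Z i w : H) (Z j w : H))).
Proof.
move=> pb; have /andP[p0 _] := pb.
apply: (integrable_le (g := fun w => 2 `^ p * (`|Z i w : H| `^ p + `|Z j w : H| `^ p))).
- exact: (measurableT_comp (measurable_dpow p sepH) (mZ2 i j)).
- by apply: integrableZ_EFin; apply: integrableD_EFin; exact: intZi.
- by move=> w; rewrite ger0_norm ?dpow_ge0// dpow_le.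
Qed.

Let bb : 0 <= 2 * b <= 2 * b. Proof. by rewrite lexx andbT mulr_ge0// ltW. Qed.
Let b2 : 0 <= b <= 2 * b. Proof. by have bp := b0; rewrite (ltW bp)/=; lra. Qed.

Definition mean_dist (p : R) (x : H) : R := \int[Q]_w dpow p x (Z 1 w : H).

Definition dist_mean : R := \int[Q]_w dpow (2 * b) (Z 0 w : H) (Z 1 w : H).

Lemma mean_distE p x i : \int[Q]_w dpow p x (Z i w : H) = mean_dist p x.
Proof.
apply: (same_law_Rintegral (mZ i) (mZ 1) (same_lawZ i 1) (f := fun y : borel H => dpow p x y)).
by apply: (measurableT_comp (g := fun y : borel H => (x : borel H, y)) (measurable_dpow p sepH));
  exact: measurable_fun_pair.
Qed.

Lemma measurable_mean_dist p : 0 <= p <= 2 * b ->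
  measurable_fun setT (mean_dist p : borel H -> R).
Proof.
move=> pb; apply: (measurable_Rintegral_indep (mZ 0) (mZ 1) (indepZ (isT : 0 != 1)%N)
  (measurable_dpow p sepH)).
exact: integrable_dpow2.
Qed.

Lemma integrable_mean_dist p i : 0 <= p <= 2 * b ->
  Q.-integrable setT (EFin \o (fun w => mean_dist p (Z i w))).
Proof.
move=> pb; apply: (same_law_integrable (mZ 0) (mZ i) (same_lawZ 0 i) (measurable_mean_dist pb)).
apply: (integrable_Rintegral_indep (mZ 0) (mZ 1) (indepZ (isT : 0 != 1)%N)
  (measurable_dpow p sepH)).
exact: integrable_dpow2.
Qed.

Lemma Rintegral_mean_dist i : \int[Q]_w mean_dist (2 * b) (Z i w) = dist_mean.
Proof.
rewrite /dist_mean.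
rewrite (Rintegral_indep (mZ 0) (mZ 1) (indepZ (isT : 0 != 1)%N)
  (measurable_dpow (2 * b) sepH)); last exact: integrable_dpow2.
exact: (same_law_Rintegral (mZ i) (mZ 0) (same_lawZ i 0) (measurable_mean_dist bb)).
Qed.

Lemma Rintegral_dpow2 i j : i != j ->
  \int[Q]_w dpow (2 * b) (Z i w : H) (Z j w : H) = dist_mean.
Proof.
move=> ij; rewrite (Rintegral_indep (mZ i) (mZ j) (indepZ ij)
  (measurable_dpow (2 * b) sepH)); last exact: integrable_dpow2.
rewrite -(Rintegral_mean_dist i); apply: eq_Rintegral => w _ /=.
exact: mean_distE.
Qed.

Lemma mean_dist_ge0 p x : 0 <= mean_dist p x.
Proof. by apply: Rintegral_ge0 => w _; exact: dpow_ge0. Qed.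

Let dpow_bE (x y : H) : dpow b x y ^+ 2 = dpow (2 * b) x y.
Proof. by rewrite /dpow mulrC powRrM powR_mulrn// powR_ge0. Qed.

(** Jensen's inequality. It makes the mean b-th power of the distance square integrable under
    moments of order 2b only. *)
Lemma mean_dist_sqr_le x : mean_dist b x ^+ 2 <= mean_dist (2 * b) x.
Proof.
rewrite /mean_dist; under [leRHS]eq_Rintegral do rewrite -dpow_bE.
apply: sqr_Rintegral_le; first exact: integrable_dpow1.
by under [X in _ \o X]eq_fun do rewrite dpow_bE; exact: integrable_dpow1.
Qed.

Lemma integrable_mean_dist_sqr i :
  Q.-integrable setT (EFin \o (fun w => mean_dist b (Z i w) ^+ 2)).
Proof.
apply: (integrable_le (g := fun w => mean_dist (2 * b) (Z i w))).
- by apply: measurable_funX; exact: (measurableT_comp (measurable_mean_dist b2) (mZ i)).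
- exact: integrable_mean_dist.
- by move=> w; rewrite ger0_norm ?sqr_ge0// mean_dist_sqr_le.
Qed.

(** Its mean in either variable is zero, and it is the expectation of the four-point difference
    whose last two points are random ([Rintegral_hat4_dpow]). *)
Definition centered_dist (x y : H) : R :=
  dpow (2 * b) x y - mean_dist (2 * b) x - mean_dist (2 * b) y + dist_mean.

Lemma centered_distC x y : centered_dist x y = centered_dist y x.
Proof.
rewrite /centered_dist (dpowC (2 * b) x y); move: (mean_dist (2 * b)) dist_mean => m D.
by congr (_ + _); rewrite addrAC.
Qed.

Lemma measurable_centered_dist :
  measurable_fun setT (fun z : borel H * borel H => centered_dist z.1 z.2).
Proof.
have mm := measurable_mean_dist bb.
have m1 := measurableT_comp mm (@measurable_fst _ _ (borel H) (borel H)).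
have m2 := measurableT_comp mm (@measurable_snd _ _ (borel H) (borel H)).
apply: measurable_funD; last exact: measurable_cst.
apply: measurable_funB; last exact: m2.
apply: measurable_funB; last exact: m1.
exact: measurable_dpow.
Qed.

Lemma hat4_centered_dist x0 x1 x2 x3 :
  hat4 centered_dist x0 x1 x2 x3 = hat4 (dpow (2 * b)) x0 x1 x2 x3.
Proof.
rewrite /hat4 /centered_dist; move: (mean_dist (2 * b)) dist_mean (dpow (2 * b)) => m D f.
by ring.
Qed.

Lemma Rintegral_centered_dist x i : \int[Q]_w centered_dist x (Z i w) = 0.
Proof.
have := Rintegral_cst_sub_add_sub (dist_mean - mean_dist (2 * b) x)
  (integrable_mean_dist i bb) (integrable_dpow1 x i bb)
  (integrable_probability_cst Q 0).
rewrite Rintegral_probability_cst Rintegral_mean_dist mean_distE => E0.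
transitivity (dist_mean - mean_dist (2 * b) x - dist_mean + mean_dist (2 * b) x - 0).
  rewrite -[RHS]E0; apply: eq_Rintegral => w _; rewrite /centered_dist.
  move: (mean_dist (2 * b)) dist_mean (dpow (2 * b) x (Z i w : H)) => m D f.
  by ring.
move: (mean_dist (2 * b) x) dist_mean => m D.
by ring.
Qed.

Let hat4Z x y w := hat4 (dpow (2 * b)) x y (Z 2 w : H) (Z 3 w : H).

Lemma Rintegral_hat4_dpow x y : \int[Q]_w hat4Z x y w = centered_dist x y.
Proof.
have := Rintegral_cst_sub_add_sub (dpow (2 * b) x y) (integrable_dpow1 y 2 bb)
  (integrable_dpow2 2 3 bb) (integrable_dpow1 x 3 bb).
rewrite !mean_distE Rintegral_dpow2// => E0.
transitivity (dpow (2 * b) x y - mean_dist (2 * b) y + dist_mean - mean_dist (2 * b) x).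
  by rewrite -[RHS]E0; apply: eq_Rintegral => w _; rewrite /hat4Z /hat4 (dpowC _ _ x).
rewrite /centered_dist; move: (mean_dist (2 * b)) dist_mean (dpow (2 * b) x y) => m D f.
by ring.
Qed.

Let md u : measurable_fun setT (fun z : borel H => dpow b u (z : H)).
Proof.
by apply: (measurableT_comp (g := fun z : borel H => (u : borel H, z)) (measurable_dpow b sepH));
  exact: measurable_fun_pair.
Qed.

Let hat4Z_le x y w :
  `|hat4Z x y w| <= 2 * (dpow b x (Z 2 w : H) * dpow b y (Z 3 w : H)).
Proof. exact: normr_hat4_dpow. Qed.

Let integrable_bound x y : Q.-integrable setT
  (EFin \o (fun w => 2 * (dpow b x (Z 2 w : H) * dpow b y (Z 3 w : H)))).
Proof.
apply: integrableZ_EFin.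
apply: (integrableM_indep (mZ 2) (mZ 3) (indepZ (isT : 2 != 3)%N) (md x) (md y)).
  exact: integrable_dpow1.
exact: integrable_dpow1.
Qed.

Lemma integrable_hat4_dpow x y : Q.-integrable setT
  (EFin \o (fun w => hat4 (dpow (2 * b)) x y (Z 2 w : H) (Z 3 w : H))).
Proof.
apply: (integrable_le _ (integrable_bound x y) (hat4Z_le x y)).
apply: measurable_funB; last by under eq_fun do rewrite dpowC; exact: mdp.
apply: measurable_funD.
  by apply: measurable_funB; [exact: measurable_cst|exact: mdp].
exact: (measurableT_comp (measurable_dpow _ sepH) (mZ2 2 3)).
Qed.

(** The bound [normr_hat4_dpow] is averaged over the independent points Z 2 and Z 3. The result is a
    product of a function of x and a function of y, which makes products of centred distances
    integrable. *)
Lemma normr_centered_dist_le x y :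
  `|centered_dist x y| <= 2 * (mean_dist b x * mean_dist b y).
Proof.
have i1 := integrable_dpow1 x 2 b2; have i2 := integrable_dpow1 y 3 b2.
have ih := integrable_hat4_dpow x y.
rewrite -Rintegral_hat4_dpow (le_trans (le_normr_Rintegral _ ih))//.
rewrite -(mean_distE b x 2) -(mean_distE b y 3).
rewrite -(RintegralM_indep (mZ 2) (mZ 3) (indepZ (isT : 2 != 3)%N) (md x) (md y) i1 i2).
rewrite -RintegralZl//; last first.
  exact: (integrableM_indep (mZ 2) (mZ 3) (indepZ (isT : 2 != 3)%N) (md x) (md y)).
apply: le_Rintegral => //.
  exact: integrable_norm ih.
by move=> w _; exact: hat4Z_le.
Qed.

End centered_distance.

(** * The conditional expectation of the hat variable *)

Section tilde.
Context (R : realType) (H : hilbertType R) (sepH : separable H).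
Context dS (S : measurableType dS) (Q : probability S R).
Variable Z : nat -> {RV Q >-> borel H}.
Variable b : R.
Hypothesis b01 : 0 < b < 1.
Hypothesis indepZ : forall i j, i != j -> indep Q (Z i) (Z j).
Hypothesis indepZ2 : indep Q (pair_fun (Z 0) (Z 1)) (pair_fun (Z 2) (Z 3)).
Hypothesis same_lawZ : forall i j, same_law Q Q (Z i) (Z j).
Hypothesis intZ : Q.-integrable setT (EFin \o (fun w => `|Z 0 w : H| `^ (2 * b))).

Let b0 : 0 < b. Proof. by case/andP: b01. Qed.
Let bb : 0 <= 2 * b <= 2 * b.
Proof. by have bp := b0; rewrite lexx andbT mulr_ge0// ltW. Qed.
Let mZ i : measurable_fun setT (Z i). Proof. exact: measurable_funP. Qed.
Let mZ2 i j : measurable_fun setT (pair_fun (Z i) (Z j)).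
Proof. exact: measurable_fun_pair. Qed.

Local Notation hc := (centered_dist Z b).

Lemma integrable_hat : Q.-integrable setT (EFin \o hat (2 * b) Z).
Proof.
have i2 i j := integrable_dpow2 sepH same_lawZ intZ i j bb.
apply: integrableB_EFin; last exact: i2.
by apply: integrableD_EFin; [apply: integrableB_EFin|]; exact: i2.
Qed.

Lemma integrable_centered_dist i j :
  Q.-integrable setT (EFin \o (fun w => hc (Z i w) (Z j w))).
Proof.
have im k := integrable_mean_dist sepH indepZ same_lawZ intZ k bb.
apply: integrableD_EFin; last exact: integrable_probability_cst.
apply: integrableB_EFin; last exact: im.
apply: integrableB_EFin; last exact: im.
exact: (integrable_dpow2 sepH same_lawZ intZ i j bb).
Qed.

Lemma integrable_centered_dist1 x i :
  Q.-integrable setT (EFin \o (fun w => hc x (Z i w))).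
Proof.
have im k := integrable_mean_dist sepH indepZ same_lawZ intZ k bb.
apply: integrableD_EFin; last exact: integrable_probability_cst.
apply: integrableB_EFin; last exact: im.
apply: integrableB_EFin; last exact: integrable_probability_cst.
exact: (integrable_dpow1 sepH same_lawZ intZ x i bb).
Qed.

Lemma Rintegral_centered_dist2 i j : i != j ->
  \int[Q]_w hc (Z i w) (Z j w) = 0.
Proof.
move=> ij; have mhc := measurable_centered_dist sepH b01 indepZ same_lawZ intZ.
rewrite (Rintegral_indep (mZ i) (mZ j) (indepZ ij) mhc (integrable_centered_dist i j)).
rewrite -[RHS](Rintegral_probability_cst Q); apply: eq_Rintegral => w _.
exact: (Rintegral_centered_dist sepH b01 indepZ same_lawZ intZ).
Qed.

Lemma sigma_algebra_sigma_pair i j : sigma_algebra setT (sigma_pair (Z i) (Z j)).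
Proof. exact/sigma_algebra_preimage/sigma_algebra_measurable. Qed.

Lemma sigma_pair_measurable i j : sigma_pair (Z i) (Z j) `<=` measurable.
Proof. by move=> _ [B mB <-]; rewrite setTI; exact: measurable_preimage. Qed.

(** The pair (Z 2, Z 3) is independent of (Z 0, Z 1), so conditioning on the latter integrates the
    former out of the four-point difference. This is verified by Fubini against the indicator of
    each event of [sigma_pair]. *)
Lemma tilde_centered_dist :
  {ae Q, forall w, tilde (2 * b) Z w = hc (Z 0 w) (Z 1 w)}.
Proof.
apply: cond_exp_ae.
- exact: sigma_algebra_sigma_pair.
- exact: sigma_pair_measurable.
have mhc := measurable_centered_dist sepH b01 indepZ same_lawZ intZ.
split; [|exact: integrable_centered_dist|].
- move=> B mB; exists ((fun z : borel H * borel H => hc z.1 z.2) @^-1` B).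
    exact: measurable_preimage.
  by rewrite setTI.
- move=> A [B mB <-]; rewrite setTI.
  have mA : measurable (pair_fun (Z 0) (Z 1) @^-1` B) by exact: measurable_preimage.
  pose F (z : (borel H * borel H) * (borel H * borel H)) : R :=
    \1_B z.1 * hat4 (dpow (2 * b)) (z.1.1 : H) (z.1.2 : H) (z.2.1 : H) (z.2.2 : H).
  have mF : measurable_fun setT F.
    apply: measurable_funM.
      by apply: measurableT_comp => //; exact: measurable_indic.
    have m1 := measurableT_comp (@measurable_fst _ _ (borel H) (borel H)) (@measurable_fst _ _ (borel H * borel H)%type (borel H * borel H)%type).
    have m2 := measurableT_comp (@measurable_snd _ _ (borel H) (borel H)) (@measurable_fst _ _ (borel H * borel H)%type (borel H * borel H)%type).
    have m3 := measurableT_comp (@measurable_fst _ _ (borel H) (borel H)) (@measurable_snd _ _ (borel H * borel H)%type (borel H * borel H)%type).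
    have m4 := measurableT_comp (@measurable_snd _ _ (borel H) (borel H)) (@measurable_snd _ _ (borel H * borel H)%type (borel H * borel H)%type).
    have md f g := measurableT_comp (g := fun z => (f z, g z)) (measurable_dpow (2 * b) sepH).
    apply: measurable_funB; last by apply: md; exact: measurable_fun_pair m4 m1.
    apply: measurable_funD; last by apply: md; exact: measurable_fun_pair m3 m4.
    apply: measurable_funB; first by apply: md; exact: measurable_fun_pair m1 m2.
    by apply: md; exact: measurable_fun_pair m2 m3.
  have ihat := integrable_hat.
  have FE w : F (pair_fun (Z 0) (Z 1) w, pair_fun (Z 2) (Z 3) w) =
      \1_(pair_fun (Z 0) (Z 1) @^-1` B) w * hat (2 * b) Z w.
    by rewrite /F !indicE.
  have iF : Q.-integrable setT (EFin \o (fun w => F (pair_fun (Z 0) (Z 1) w, pair_fun (Z 2) (Z 3) w))).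
    apply: (integrable_le (g := fun w => `|hat (2 * b) Z w|)).
    - by apply: (measurableT_comp mF); exact: measurable_fun_pair.
    - exact: integrable_norm.
    - move=> w; rewrite FE normrM ler_piMl// indicE.
      by case: (_ \in _); rewrite ?normr1 ?normr0.
  apply: eq_integral_EFin => //; first exact: integrable_centered_dist.
  rewrite [LHS]Rintegral_indicE [RHS]Rintegral_indicE.
  have E0 := Rintegral_indep (mZ2 0 1) (mZ2 2 3) indepZ2 mF iF.
  transitivity (\int[Q]_w F (pair_fun (Z 0) (Z 1) w, pair_fun (Z 2) (Z 3) w)); last first.
    by apply: eq_Rintegral => w _; rewrite FE mulrC.
  rewrite E0; apply: eq_Rintegral => w _; rewrite /F/= RintegralZl//; last first.
    exact: (integrable_hat4_dpow sepH b01 indepZ same_lawZ intZ).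
  by rewrite (Rintegral_hat4_dpow sepH b01 indepZ same_lawZ intZ) mulrC !indicE.
Qed.

Lemma measurable_tilde : measurable_fun setT (tilde (2 * b) Z).
Proof.
apply: measurable_cond_exp.
- exact: sigma_algebra_sigma_pair.
- exact: sigma_pair_measurable.
- exact: integrable_hat.
Qed.

End tilde.

(** * The hat and tilde covariances through centred distances *)

Section distance_covariances.
Context (R : realType) (H H' : hilbertType R).
Hypotheses (sepH : separable H) (sepH' : separable H').
Context dT (T : measurableType dT) (P : probability T R).
Variables (X : {RV P >-> borel H}) (Y : {RV P >-> borel H'}).
Context dS (S : measurableType dS) (Q : probability S R).
Variables (Xs : nat -> {RV Q >-> borel H}) (Ys : nat -> {RV Q >-> borel H'}).
Hypothesis copies : independent_copies X Y Xs Ys.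

Local Notation E := (borel H * borel H')%type.

Let mX i : measurable_fun setT (Xs i). Proof. exact: measurable_funP. Qed.
Let mY i : measurable_fun setT (Ys i). Proof. exact: measurable_funP. Qed.
Let mZ i : measurable_fun setT (copy Xs Ys i). Proof. exact: measurable_copy. Qed.

Lemma indep_copyX i j : i != j -> indep Q (Xs i) (Xs j).
Proof.
by move=> ij; exact: (indep_comp measurable_fst measurable_fst (indep_copy copies ij)).
Qed.

Lemma indep_copyY i j : i != j -> indep Q (Ys i) (Ys j).
Proof.
by move=> ij; exact: (indep_comp measurable_snd measurable_snd (indep_copy copies ij)).
Qed.

Let uniq4 : uniq [:: 0; 1; 2; 3]%N. Proof. by []. Qed.

Lemma indep_copyX2 :
  indep Q (pair_fun (Xs 0) (Xs 1)) (pair_fun (Xs 2) (Xs 3)).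
Proof.
have mf : measurable_fun setT (fun z : E * E => (z.1.1, z.2.1)).
  by apply: measurable_fun_pair; exact: measurableT_comp.
exact: (indep_comp mf mf (indep_copy2 copies uniq4)).
Qed.

Lemma indep_copyY2 :
  indep Q (pair_fun (Ys 0) (Ys 1)) (pair_fun (Ys 2) (Ys 3)).
Proof.
have mf : measurable_fun setT (fun z : E * E => (z.1.2, z.2.2)).
  by apply: measurable_fun_pair; exact: measurableT_comp.
exact: (indep_comp mf mf (indep_copy2 copies uniq4)).
Qed.

Lemma same_law_copyX i j : same_law Q Q (Xs i) (Xs j).
Proof. by move=> U mU; exact: (same_law_copy copies i j (measurable_preimage measurable_fst mU)). Qed.

Lemma same_law_copyY i j : same_law Q Q (Ys i) (Ys j).
Proof. by move=> U mU; exact: (same_law_copy copies i j (measurable_preimage measurable_snd mU)). Qed.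

Lemma integrable_momentX p : (moment X p < +oo)%E ->
  Q.-integrable setT (EFin \o (fun w => `|Xs 0 w : H| `^ p)).
Proof.
rewrite /moment expectation.unlock => foo.
have l : same_law P Q X (Xs 0).
  by move=> U mU; exact: (copies.1 0 _ (measurable_preimage measurable_fst mU)).
have mXP : measurable_fun setT X by exact: measurable_funP.
apply: (same_law_integrable mXP (mX 0) l (measurable_norm_powR p)).
apply: ge0_integrable_EFin => //.
exact: (measurableT_comp (measurable_norm_powR p) mXP).
Qed.

Lemma integrable_momentY p : (moment Y p < +oo)%E ->
  Q.-integrable setT (EFin \o (fun w => `|Ys 0 w : H'| `^ p)).
Proof.
rewrite /moment expectation.unlock => foo.
have l : same_law P Q Y (Ys 0).
  by move=> U mU; exact: (copies.1 0 _ (measurable_preimage measurable_snd mU)).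
have mYP : measurable_fun setT Y by exact: measurable_funP.
apply: (same_law_integrable mYP (mY 0) l (measurable_norm_powR p)).
apply: ge0_integrable_EFin => //.
exact: (measurableT_comp (measurable_norm_powR p) mYP).
Qed.

Variable b : R.
Hypothesis b01 : 0 < b < 1.
Hypothesis intX : Q.-integrable setT (EFin \o (fun w => `|Xs 0 w : H| `^ (2 * b))).
Hypothesis intY : Q.-integrable setT (EFin \o (fun w => `|Ys 0 w : H'| `^ (2 * b))).

Let b0 : 0 < b. Proof. by case/andP: b01. Qed.
Let bb : 0 <= 2 * b <= 2 * b.
Proof. by have bp := b0; rewrite lexx andbT mulr_ge0// ltW. Qed.
Let b2 : 0 <= b <= 2 * b. Proof. by have bp := b0; rewrite (ltW bp)/=; lra. Qed.

Let hX := centered_dist Xs b.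
Let hY := centered_dist Ys b.
Let cX := mean_dist Xs b.
Let cY := mean_dist Ys b.

Let mhX : measurable_fun setT (fun z : borel H * borel H => hX z.1 z.2).
Proof. exact: (measurable_centered_dist sepH b01 indep_copyX same_law_copyX intX). Qed.
Let mhY : measurable_fun setT (fun z : borel H' * borel H' => hY z.1 z.2).
Proof. exact: (measurable_centered_dist sepH' b01 indep_copyY same_law_copyY intY). Qed.
Let mcX : measurable_fun setT (cX : borel H -> R).
Proof. exact: (measurable_mean_dist sepH indep_copyX same_law_copyX intX b2). Qed.
Let mcY : measurable_fun setT (cY : borel H' -> R).
Proof. exact: (measurable_mean_dist sepH' indep_copyY same_law_copyY intY b2). Qed.

Let icX i : Q.-integrable setT (EFin \o (fun w => cX (Xs i w))).
Proof. exact: (integrable_mean_dist sepH indep_copyX same_law_copyX intX i b2). Qed.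
Let icY i : Q.-integrable setT (EFin \o (fun w => cY (Ys i w))).
Proof. exact: (integrable_mean_dist sepH' indep_copyY same_law_copyY intY i b2). Qed.

(** The dominating function attached to one copy. It is integrable by Cauchy-Schwarz although its
    two factors may be dependent. *)
Let om (z : E) : R := cX z.1 * cY z.2.

Let mom : measurable_fun setT om.
Proof.
apply: measurable_funM; first exact: (measurableT_comp mcX measurable_fst).
exact: (measurableT_comp mcY measurable_snd).
Qed.

Let iom i : Q.-integrable setT (EFin \o (fun w => om (copy Xs Ys i w))).
Proof.
apply: integrableM_sqr.
- exact: (measurableT_comp mcX (mX i)).
- exact: (measurableT_comp mcY (mY i)).
- exact: (integrable_mean_dist_sqr sepH b01 indep_copyX same_law_copyX intX).
- exact: (integrable_mean_dist_sqr sepH' b01 indep_copyY same_law_copyY intY).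
Qed.

Let hX_le x y : `|hX x y| <= 2 * (cX x * cX y).
Proof. exact: (normr_centered_dist_le sepH b01 indep_copyX same_law_copyX intX). Qed.
Let hY_le x y : `|hY x y| <= 2 * (cY x * cY y).
Proof. exact: (normr_centered_dist_le sepH' b01 indep_copyY same_law_copyY intY). Qed.

Let cX0 x : 0 <= cX x. Proof. exact: mean_dist_ge0. Qed.
Let cY0 x : 0 <= cY x. Proof. exact: mean_dist_ge0. Qed.

Let mkp i j k l : measurable_fun setT (kprod Xs Ys hX hY i j k l).
Proof.
apply: measurable_funM.
  by apply: (measurableT_comp (g := fun w => (Xs i w, Xs j w)) mhX); exact: measurable_fun_pair.
by apply: (measurableT_comp (g := fun w => (Ys k w, Ys l w)) mhY); exact: measurable_fun_pair.
Qed.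

Let kp_le i j k l w : `|kprod Xs Ys hX hY i j k l w| <=
  4 * (cX (Xs i w) * cX (Xs j w) * (cY (Ys k w) * cY (Ys l w))).
Proof.
rewrite normrM (_ : 4 * _ = 2 * (cX (Xs i w) * cX (Xs j w)) * (2 * (cY (Ys k w) * cY (Ys l w)))).
  by rewrite ler_pM.
move: (cX _) (cX _) (cY _) (cY _) => p q r s; ring.
Qed.

Let int_same : Q.-integrable setT (EFin \o kprod Xs Ys hX hY 0 1 0 1).
Proof.
have i1 := integrableM_indep (mZ 0) (mZ 1) (indep_copy copies (isT : 0 != 1)%N) mom mom (iom 0) (iom 1).
apply: (integrable_le (mkp _ _ _ _) (integrableZ_EFin 4 i1)) => w.
by apply: (le_trans (kp_le 0 1 0 1 w)); rewrite [in leLHS]mulrACA.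
Qed.

(** The bound regroups into one factor for copy 0, one for X 1 and one for Y 2, which are
    independent. *)
Let int_common : Q.-integrable setT (EFin \o kprod Xs Ys hX hY 0 1 0 2).
Proof.
have i01 : indep Q (copy Xs Ys 0) (Xs 1).
  move=> C D mC mD.
  exact: (indep_copy copies (isT : 0 != 1)%N mC (measurable_preimage measurable_fst mD)).
have i1 := integrableM_indep (mZ 0) (mX 1) i01 mom mcX (iom 0) (icX 1).
have mg : measurable_fun setT (fun z : E * E => om z.1 * cX z.2.1).
  apply: measurable_funM; first exact: (measurableT_comp mom measurable_fst).
  exact: (measurableT_comp mcX (measurableT_comp measurable_fst measurable_snd)).
have mg' : measurable_fun setT (fun z : E * E => cY z.1.2).
  exact: (measurableT_comp mcY (measurableT_comp measurable_snd measurable_fst)).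
have i2 := integrableM_indep (measurable_copy2 Xs Ys 0 1) (measurable_copy2 Xs Ys 2 3)
  (indep_copy2 copies uniq4) mg mg' i1 (icY 2).
apply: (integrable_le (mkp _ _ _ _) (integrableZ_EFin 4 i2)) => w.
have eq5 (p q r s : R) : p * q * (r * s) = p * r * q * s by ring.
by have := kp_le 0 1 0 2 w; rewrite eq5.
Qed.

Let ihX i j : Q.-integrable setT (EFin \o (fun w => hX (Xs i w) (Xs j w))).
Proof. exact: (integrable_centered_dist sepH b01 indep_copyX same_law_copyX intX). Qed.
Let ihY i j : Q.-integrable setT (EFin \o (fun w => hY (Ys i w) (Ys j w))).
Proof. exact: (integrable_centered_dist sepH' b01 indep_copyY same_law_copyY intY). Qed.

Let mhX2 : measurable_fun setT (fun z : E * E => hX z.1.1 z.2.1).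
Proof.
apply: (measurableT_comp (g := fun z : E * E => (z.1.1, z.2.1)) mhX).
by apply: measurable_fun_pair; exact: measurableT_comp.
Qed.
Let mhY2 : measurable_fun setT (fun z : E * E => hY z.1.2 z.2.2).
Proof.
apply: (measurableT_comp (g := fun z : E * E => (z.1.2, z.2.2)) mhY).
by apply: measurable_fun_pair; exact: measurableT_comp.
Qed.

Let int_disjoint : Q.-integrable setT (EFin \o kprod Xs Ys hX hY 0 1 2 3).
Proof.
exact: (integrableM_indep (measurable_copy2 Xs Ys 0 1) (measurable_copy2 Xs Ys 2 3)
  (indep_copy2 copies uniq4) mhX2 mhY2 (ihX 0 1) (ihY 2 3)).
Qed.

Let disjoint0 : \int[Q]_w kprod Xs Ys hX hY 0 1 2 3 w = 0.
Proof.
rewrite /kprod.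
rewrite (RintegralM_indep (measurable_copy2 Xs Ys 0 1) (measurable_copy2 Xs Ys 2 3)
  (indep_copy2 copies uniq4) mhX2 mhY2 (ihX 0 1) (ihY 2 3))/=.
by rewrite (Rintegral_centered_dist2 sepH b01 indep_copyX same_law_copyX intX)// mul0r.
Qed.

(** With copies 0 and 2 fixed, integrating over X 1 gives zero because the centred distance has zero
    mean in each variable. *)
Let common0 : \int[Q]_w kprod Xs Ys hX hY 0 1 0 2 w = 0.
Proof.
(* The copies are grouped as (0,2) and (1,3), so that Fubini integrates copy 1 last in the order of
   indices but first in the iteration. *)
have u : uniq [:: 0; 2; 1; 3]%N by [].
pose F (z : (E * E) * (E * E)) := hX z.1.1.1 z.2.1.1 * hY z.1.1.2 z.1.2.2.
have mF : measurable_fun setT F.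
  apply: measurable_funM.
    apply: (measurableT_comp (g := fun z : (E * E) * (E * E) => (z.1.1.1, z.2.1.1)) mhX).
    apply: measurable_fun_pair; apply: measurableT_comp => //; exact: measurableT_comp.
  exact: (measurableT_comp mhY2 measurable_fst).
have := Rintegral_indep (measurable_copy2 Xs Ys 0 2) (measurable_copy2 Xs Ys 1 3)
  (indep_copy2 copies u) mF int_common.
move=> ->; rewrite -[RHS](Rintegral_probability_cst Q); apply: eq_Rintegral => w _; rewrite /F/= RintegralZr//; last first.
  exact: (integrable_centered_dist1 sepH b01 indep_copyX same_law_copyX intX).
by rewrite (Rintegral_centered_dist sepH b01 indep_copyX same_law_copyX intX) mul0r.
Qed.

Definition centered_dcov : R := \int[Q]_w kprod Xs Ys hX hY 0 1 0 1 w.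

Let hatE w : hat (2 * b) Xs w * hat (2 * b) Ys w =
  hat4 hX (Xs 0 w) (Xs 1 w) (Xs 2 w) (Xs 3 w) *
  hat4 hY (Ys 0 w) (Ys 1 w) (Ys 2 w) (Ys 3 w).
Proof. by rewrite !hat4_centered_dist. Qed.

Let hXC x y : hX x y = hX y x. Proof. exact: centered_distC. Qed.
Let hYC x y : hY x y = hY y x. Proof. exact: centered_distC. Qed.

Lemma integrable_hat_prod :
  Q.-integrable setT (EFin \o (fun w => hat (2 * b) Xs w * hat (2 * b) Ys w)).
Proof.
under [X in _ \o X]eq_fun do rewrite hatE.
exact: (integrable_hat4_prod copies mhX mhY hXC hYC int_same int_common int_disjoint).
Qed.

(** Centring leaves the hats unchanged, and in the expansion the common-index and disjoint terms
    vanish, leaving four times the same-pair term. *)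
Lemma Rintegral_hat_prod :
  \int[Q]_w (hat (2 * b) Xs w * hat (2 * b) Ys w) = 4 * centered_dcov.
Proof.
under eq_Rintegral do rewrite hatE.
have collapse (x y z u : R) : y = 0 -> z = 0 -> u = 4 * (x + y - 2 * z) -> u = 4 * x.
  by move=> -> -> ->; rewrite mulr0 subr0 addr0.
exact: (collapse _ _ _ _ disjoint0 common0
  (Rintegral_hat4_prod copies mhX mhY hXC hYC int_same int_common int_disjoint)).
Qed.

Lemma dcov_hatE : dcov_hat (2 * b) Xs Ys = centered_dcov%:E.
Proof.
rewrite /dcov_hat expectation.unlock EFin_Rintegral; last exact: integrable_hat_prod.
by rewrite -EFinM Rintegral_hat_prod mulrA mulVf ?mul1r.
Qed.

Lemma dcov_tildeE : dcov_tilde (2 * b) Xs Ys = centered_dcov%:E.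
Proof.
rewrite /dcov_tilde expectation.unlock -EFin_Rintegral; last exact: int_same.
have aX := tilde_centered_dist sepH b01 indep_copyX indep_copyX2 same_law_copyX intX.
have aY := tilde_centered_dist sepH' b01 indep_copyY indep_copyY2 same_law_copyY intY.
apply: ae_eq_integral => //.
- apply/measurable_EFinP; apply: measurable_funM.
    exact: (measurable_tilde sepH b01 same_law_copyX intX).
  exact: (measurable_tilde sepH' b01 same_law_copyY intY).
- exact/measurable_EFinP/mkp.
- apply: filterS2 aX aY => w -> -> _; exact: erefl.
Qed.

(** Independence of X and Y separates the two centred distances, and each has mean zero. *)
Lemma centered_dcov_indep : independent_RV X Y -> centered_dcov = 0.
Proof.
move=> XY.
have ind : indep Q (pair_fun (Xs 0) (Xs 1)) (pair_fun (Ys 0) (Ys 1)).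
  have PQ i C C' : measurable C -> measurable C' ->
      Q (Xs i @^-1` C `&` Ys i @^-1` C') = (Q (Xs i @^-1` C) * Q (Ys i @^-1` C'))%E.
    move=> mC mC'.
    have PE (D : set E) : measurable D -> Q (copy Xs Ys i @^-1` D) = P (pair_fun X Y @^-1` D).
      by move=> mD; rewrite -(copies.1 i).
    have := XY C C' mC mC'.
    have := PE _ (measurableX mC mC').
    have := PE _ (measurable_preimage measurable_fst mC).
    have := PE _ (measurable_preimage measurable_snd mC').
    move=> E1 E2 E3 E4.
    transitivity (P (X @^-1` C `&` Y @^-1` C')); first exact: E3.
    by rewrite E4; congr (_ * _)%E; [exact: (esym E2)|exact: (esym E1)].
  apply: indep_pair => // C D C' D' mC mD mC' mD'.
  have i01 := indep_copy copies (isT : 0 != 1)%N.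
  have E1 := i01 _ _ (measurableX mC mC') (measurableX mD mD').
  have E2 := indep_copyX (isT : 0 != 1)%N mC mD.
  have E3 := indep_copyY (isT : 0 != 1)%N mC' mD'.
  rewrite E2 E3 setIACA muleACA -!PQ//.
rewrite /centered_dcov /kprod.
have mX2 : measurable_fun setT (pair_fun (Xs 0) (Xs 1)) by exact: measurable_fun_pair.
have mY2 : measurable_fun setT (pair_fun (Ys 0) (Ys 1)) by exact: measurable_fun_pair.
rewrite (RintegralM_indep mX2 mY2 ind mhX mhY (ihX 0 1) (ihY 0 1))/=.
by rewrite (Rintegral_centered_dist2 sepH b01 indep_copyX same_law_copyX intX)// mul0r.
Qed.

End distance_covariances.

(** * Real Fubini and vanishing integrals of continuous functions *)

Section fubini_real.
Context d1 d2 (T1 : measurableType d1) (T2 : measurableType d2) (R : realType).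
Variables (m1 : {sigma_finite_measure set T1 -> \bar R}).
Variables (m2 : {sigma_finite_measure set T2 -> \bar R}).
Variable f : T1 * T2 -> R.
Hypothesis mf : measurable_fun setT f.
Hypothesis if1 : forall x, m2.-integrable setT (EFin \o (fun y => f (x, y))).
Hypothesis if2 : forall y, m1.-integrable setT (EFin \o (fun x => f (x, y))).
Variable g : T1 -> R.
Hypothesis ig : m1.-integrable setT (EFin \o g).
Hypothesis fg : forall x, \int[m2]_y `|f (x, y)| <= g x.

Let mEf : measurable_fun setT (EFin \o f). Proof. exact/measurable_EFinP. Qed.

Let intf : (m1 \x m2)%E.-integrable setT (EFin \o f).
Proof.
apply/(integrable12ltyP m1 m2 mEf); have /integrableP[_] := ig.
have mabs : measurable_fun setT (fun z => `|f z|%:E : \bar R).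
  exact/measurable_EFinP/measurableT_comp.
apply: le_lt_trans; apply: ge0_le_integral => //.
- by move=> x _; exact: integral_ge0.
- exact: (measurable_fun_fubini_tonelli_F (fun z => `|f z|%:E)).
- by apply: measurableT_comp => //; exact: measurable_int ig.
- move=> x _ /=; rewrite EFin_Rintegral; last exact: integrable_norm (if1 x).
  by rewrite lee_fin (le_trans (fg x))// ler_norm.
Qed.

Lemma integrable_Rintegral_fubini :
  m2.-integrable setT (EFin \o (fun y => \int[m1]_x f (x, y))).
Proof.
have mG : measurable_fun setT (fun y => (\int[m1]_x f (x, y))%:E).
  have := measurable_fubini_G intf.
  by congr (measurable_fun _ _); apply/funext => y; rewrite /= -EFin_Rintegral.
have mabs : measurable_fun setT (fun z => `|f z|%:E : \bar R).
  exact/measurable_EFinP/measurableT_comp.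
apply/integrableP; split => //.
apply: le_lt_trans ((integrable21ltyP m1 m2 mEf).1 intf).
apply: ge0_le_integral => //.
- exact: measurableT_comp.
- exact: (measurable_fun_fubini_tonelli_G (fun z => `|f z|%:E)).
- move=> y _ /=; rewrite EFin_normr_Rintegral//.
  by apply: le_abse_integral => //; exact: measurable_int (if2 y).
Qed.

Lemma Rintegral_fubini :
  \int[m1]_x \int[m2]_y f (x, y) = \int[m2]_y \int[m1]_x f (x, y).
Proof.
rewrite /Rintegral; congr fine.
transitivity (\int[m1]_x \int[m2]_y (EFin \o f) (x, y))%E.
  by apply: eq_integral => x _; rewrite -EFin_Rintegral.
rewrite Fubini//; apply: eq_integral => y _.
by rewrite fineK//; exact: integrable_fin_num (if2 y).
Qed.

End fubini_real.

Section lebesgue_zero.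
Context (R : realType).
Local Notation leb := (@lebesgue_measure R).

(** A point where [f] is positive has an open interval around it on which the integrand is nonzero,
    whereas the integrand vanishes almost everywhere. *)
Lemma continuous_Rintegral_eq0 (f g : R -> R) : continuous f ->
  (forall u, 0 <= f u) -> (forall u, 0 < g u) ->
  leb.-integrable setT (EFin \o (fun u => f u * g u)) ->
  \int[leb]_u (f u * g u) = 0 -> forall u, f u = 0.
Proof.
move=> cf f0 g0 ifg fg0 u0; apply/eqP; apply: contraT => fu0.
have fgt0 : 0 < f u0 by rewrite lt0r fu0 f0.
have fg_ge0 u : 0 <= f u * g u by rewrite mulr_ge0// ltW.
have [N [mN N0 sub]] := @Rintegral_eq0 _ _ _ leb _ fg_ge0 ifg fg0.
have /cvgrPdist_lt/(_ _ fgt0) [e /= e0 eP] := cf u0.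
have itvN : `]u0 - e, u0 + e[%classic `<=` N.
  move=> u; rewrite /= in_itv/= => ue; apply: sub => /= fu.
  have : `|f u0 - f u| < f u0.
    by apply: eP; rewrite /ball_/= distrC ltr_distl.
  move/eqP: fu; rewrite mulf_eq0 (gt_eqF (g0 u)) orbF => /eqP ->.
  by rewrite subr0 gtr0_norm// ltxx.
have : (leb `](u0 - e)%R, (u0 + e)%R[%classic <= leb N)%E.
  by apply: le_measure; rewrite ?inE.
rewrite N0 lebesgue_measure_itv/= lte_fin ifT; last by lra.
by rewrite -EFinD lee_fin; lra.
Qed.

End lebesgue_zero.

(** * The mixture formula under an expectation *)

Section hat_mixture.
Context (R : realType) (H : hilbertType R) (sepH : separable H).
Context dS (S : measurableType dS) (Q : probability S R).
Variables (X0 X1 X2 X3 : S -> borel H) (psi : S -> R) (b : R).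
Hypotheses (mX0 : measurable_fun setT X0) (mX1 : measurable_fun setT X1).
Hypotheses (mX2 : measurable_fun setT X2) (mX3 : measurable_fun setT X3).
Hypothesis b01 : 0 < b < 1.
Hypothesis ipsi : Q.-integrable setT (EFin \o psi).
Hypothesis ipsiX : Q.-integrable setT (EFin \o (fun w =>
  `|psi w| * (dpow b (X0 w : H) (X2 w : H) * dpow b (X1 w : H) (X3 w : H)))).
Local Notation leb := (@lebesgue_measure R).

Definition gauss_hat (u : R) (w : S) : R :=
  hat4 (gaussk (expR u)) (X0 w : H) (X1 w : H) (X2 w : H) (X3 w : H).

Let mpsi : measurable_fun setT psi. Proof. exact: integrable_measurable ipsi. Qed.

Let mgauss (U V : S -> borel H) : measurable_fun setT U -> measurable_fun setT V ->
  measurable_fun setT (fun z : S * measurableTypeR R => gaussk (expR z.2) (U z.1 : H) (V z.1 : H)).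
Proof.
move=> mU mV; apply: measurableT_comp => //; apply: measurableT_comp => //.
apply: measurable_funM; first exact: (measurableT_comp (@measurable_expR R)).
apply: measurable_funX.
apply: (measurableT_comp (g := fun z : S * measurableTypeR R => (U z.1, V z.1)) (measurable_dist sepH)).
by apply: measurable_fun_pair; exact: measurableT_comp.
Qed.

Let mhat : measurable_fun setT (fun z : S * measurableTypeR R => gauss_hat z.2 z.1).
Proof.
apply: measurable_funB; last exact: mgauss.
apply: measurable_funD; last exact: mgauss.
by apply: measurable_funB; exact: mgauss.
Qed.

Let mhat1 u : measurable_fun setT (gauss_hat u).
Proof.
apply: (measurableT_comp (g := fun w => (w, u : measurableTypeR R)) mhat).
exact: measurable_fun_pair.
Qed.

Let hat_le u w : `|gauss_hat u w| <= 4.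
Proof.
have n (x y : H) : `|gaussk (expR u) x y| <= 1.
  by rewrite gtr0_norm ?gaussk_gt0// gaussk_le1// expR_ge0.
rewrite /gauss_hat /hat4 (le_trans (ler_normB _ _))//.
rewrite (_ : 4 = 1 + 1 + 1 + 1 :> R); last by ring.
rewrite lerD// (le_trans (ler_normD _ _))// lerD// (le_trans (ler_normB _ _))//.
exact: lerD.
Qed.

Let ihatpsi u : Q.-integrable setT (EFin \o (fun w => gauss_hat u w * psi w)).
Proof.
apply: (integrable_le (g := fun w => 4 * `|psi w|)).
- exact: measurable_funM.
- exact/integrableZ_EFin/integrable_norm.
- by move=> w; rewrite normrM ler_wpM2r.
Qed.

Let e (u : R) := expR (- (b * u)).

Let f (z : S * measurableTypeR R) : R := gauss_hat z.2 z.1 * e z.2 * psi z.1.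

Let mf : measurable_fun setT f.
Proof.
apply: measurable_funM; last exact: (measurableT_comp mpsi).
apply: measurable_funM => //.
have me : measurable_fun setT (e : measurableTypeR R -> R).
  apply: continuous_measurable_fun => u; apply: continuous_comp; last exact: continuous_expR.
  by apply: cvgN; apply: cvgM; [exact: cvg_cst|exact: cvg_id].
exact: (measurableT_comp me measurable_snd).
Qed.

Let if1 w : leb.-integrable setT (EFin \o (fun u => f (w, u))).
Proof.
have := @integrableZ_EFin _ _ _ leb (psi w) _
  (integrable_hat4_mix (X0 w : H) (X1 w : H) (X2 w : H) (X3 w : H) b01).
by congr (_.-integrable _ _); apply/funext => u; rewrite /f /= mulrC.
Qed.

Let if2 u : Q.-integrable setT (EFin \o (fun w => f (w, u))).
Proof.
have := integrableZ_EFin (e u) (ihatpsi u).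
by congr (_.-integrable _ _); apply/funext => w; rewrite /f/= mulrA (mulrC (e u)).
Qed.

Let f_le w : \int[leb]_u `|f (w, u)| <= 2 * mix_const b * (`|psi w| *
  (dpow b (X0 w : H) (X2 w : H) * dpow b (X1 w : H) (X3 w : H))).
Proof.
have := Rintegral_normr_hat4_mix_le (X0 w : H) (X1 w : H) (X2 w : H) (X3 w : H) b01.
move=> /(ler_wpM2l (normr_ge0 (psi w))) le1.
rewrite [leRHS]mulrCA; apply: le_trans le1.
rewrite -(@RintegralZl _ _ _ leb)//; last first.
  have := @integrable_norm _ _ _ leb _ _ (integrable_hat4_mix (X0 w : H) (X1 w : H) (X2 w : H) (X3 w : H) b01).
  by congr (_.-integrable _ _); apply/funext => u; rewrite /= normrM (gtr0_norm (expR_gt0 _)).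
rewrite le_eqVlt; apply/orP; left; apply/eqP; apply: eq_Rintegral => u _.
by rewrite /f/= !normrM (gtr0_norm (expR_gt0 _)) mulrC.
Qed.

Let ig := integrableZ_EFin (2 * mix_const b) ipsiX.

Let FE u : \int[Q]_w f (w, u) = \int[Q]_w (gauss_hat u w * psi w) * e u.
Proof.
rewrite -RintegralZr//; apply: eq_Rintegral => w _.
by rewrite /f/= mulrAC.
Qed.

Lemma integrable_gauss_hat : leb.-integrable setT
  (EFin \o (fun u => \int[Q]_w (gauss_hat u w * psi w) * expR (- (b * u)))).
Proof.
have := @integrable_Rintegral_fubini _ _ _ _ _ Q leb f mf if1 if2 _ ig f_le.
by congr (_.-integrable _ _); apply/funext => u; rewrite /= FE.
Qed.

Let mdp p (U V : S -> borel H) : measurable_fun setT U -> measurable_fun setT V ->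
  measurable_fun setT (fun w => dpow p (U w : H) (V w : H)).
Proof.
move=> mU mV; apply: (measurableT_comp (g := fun w => (U w, V w)) (measurable_dpow p sepH)).
exact: measurable_fun_pair.
Qed.

Let ihat4 : Q.-integrable setT (EFin \o (fun w =>
  hat4 (dpow (2 * b)) (X0 w : H) (X1 w : H) (X2 w : H) (X3 w : H) * psi w)).
Proof.
apply: (integrable_le _ (integrableZ_EFin 2 ipsiX)).
  apply: measurable_funM => //; apply: measurable_funB; last exact: mdp.
  by apply: measurable_funD; [apply: measurable_funB|]; exact: mdp.
move=> w; rewrite normrM [leRHS]mulrCA [leLHS]mulrC ler_wpM2l//.
exact: normr_hat4_dpow.
Qed.

(** The mixture formula for distances, integrated against a random weight [psi]. It serves twice:
    with [psi] the hat of the Y-distances, and with [psi] a Gaussian four-point difference of X.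
    Fubini is justified by [Rintegral_normr_hat4_mix_le] and [ipsiX]. *)
Lemma Rintegral_gauss_hat :
  \int[leb]_u (\int[Q]_w (gauss_hat u w * psi w) * expR (- (b * u))) =
  - (mix_const b * \int[Q]_w (hat4 (dpow (2 * b)) (X0 w : H) (X1 w : H) (X2 w : H) (X3 w : H) * psi w)).
Proof.
transitivity (\int[leb]_u \int[Q]_w f (w, u)).
  by apply: eq_Rintegral => u _; rewrite FE.
rewrite -(Rintegral_fubini mf if1 if2 ig f_le) -mulNr -RintegralZl//.
apply: eq_Rintegral => w _.
rewrite mulrA mulNr -Rintegral_hat4_mix// -(@RintegralZr _ _ _ leb)//.
exact: integrable_hat4_mix.
Qed.

Lemma continuous_gauss_hat : continuous (fun u => \int[Q]_w (gauss_hat u w * psi w)).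
Proof.
move=> u; apply/(@cvg_nbhsP _ R^o) => u_ cu.
apply: (dominated_cvg (g := fun w => 4 * `|psi w|)).
- by move=> n; exact: measurable_funM.
- move=> w; apply: cvgM; last exact: cvg_cst.
  have ck (x y : H) : gaussk (expR (u_ n)) x y @[n --> \oo] --> gaussk (expR u) x y.
    apply: continuous_cvg; first exact: continuous_expR.
    apply: cvgN; apply: cvgM; last exact: cvg_cst.
    by apply: continuous_cvg cu; exact: continuous_expR.
  by apply: cvgB => //; apply: cvgD => //; exact: cvgB.
- exact/integrableZ_EFin/integrable_norm.
- by move=> n w; rewrite normrM ler_wpM2r.
Qed.

End hat_mixture.

(** * Zero distance covariance implies independence *)

Section zero_distance_covariance.
Context (R : realType) (H H' : hilbertType R).
Hypotheses (sepH : separable H) (sepH' : separable H').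
Context dT (T : measurableType dT) (P : probability T R).
Variables (X : {RV P >-> borel H}) (Y : {RV P >-> borel H'}).
Context dS (S : measurableType dS) (Q : probability S R).
Variables (Xs : nat -> {RV Q >-> borel H}) (Ys : nat -> {RV Q >-> borel H'}).
Hypothesis copies : independent_copies X Y Xs Ys.
Variable b : R.
Hypothesis b01 : 0 < b < 1.
Hypothesis intX : Q.-integrable setT (EFin \o (fun w => `|Xs 0 w : H| `^ (2 * b))).
Hypothesis intY : Q.-integrable setT (EFin \o (fun w => `|Ys 0 w : H'| `^ (2 * b))).

Local Notation E := (borel H * borel H')%type.
Local Notation leb := (@lebesgue_measure R).

Let mX i : measurable_fun setT (Xs i). Proof. exact: measurable_funP. Qed.
Let mY i : measurable_fun setT (Ys i). Proof. exact: measurable_funP. Qed.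
Let slX := same_law_copyX copies.
Let slY := same_law_copyY copies.

Let b0 : 0 < b. Proof. by case/andP: b01. Qed.
Let bb : 0 <= 2 * b <= 2 * b.
Proof. by have bp := b0; rewrite lexx andbT mulr_ge0// ltW. Qed.
Let b2 : 0 <= b <= 2 * b. Proof. by have bp := b0; rewrite (ltW bp)/=; lra. Qed.

Let dd (z : E * E) : R := dpow b (z.1.1 : H) (z.2.1 : H) * dpow b (z.1.2 : H') (z.2.2 : H').

Let mdd : measurable_fun setT dd.
Proof.
apply: measurable_funM.
  apply: (measurableT_comp (g := fun z : E * E => (z.1.1, z.2.1)) (measurable_dpow b sepH)).
  by apply: measurable_fun_pair; exact: measurableT_comp.
apply: (measurableT_comp (g := fun z : E * E => (z.1.2, z.2.2)) (measurable_dpow b sepH')).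
by apply: measurable_fun_pair; exact: measurableT_comp.
Qed.

Let dpow_bE (K : hilbertType R) (x y : K) : dpow b x y ^+ 2 = dpow (2 * b) x y.
Proof. by rewrite /dpow mulrC powRrM powR_mulrn// powR_ge0. Qed.

Let idd i j : Q.-integrable setT (EFin \o (fun w => dd (copy2 Xs Ys i j w))).
Proof.
apply: integrableM_sqr.
- apply: (measurableT_comp (g := fun w => (Xs i w, Xs j w)) (measurable_dpow b sepH)).
  exact: measurable_fun_pair.
- apply: (measurableT_comp (g := fun w => (Ys i w, Ys j w)) (measurable_dpow b sepH')).
  exact: measurable_fun_pair.
- under [X in _ \o X]eq_fun do rewrite dpow_bE.
  exact: (integrable_dpow2 sepH slX intX i j bb).
- under [X in _ \o X]eq_fun do rewrite dpow_bE.
  exact: (integrable_dpow2 sepH' slY intY i j bb).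
Qed.

Let psi := hat (2 * b) Ys.

Let ipsi : Q.-integrable setT (EFin \o psi).
Proof. exact: (integrable_hat sepH' b01 slY intY). Qed.

(** Bounding the hat of Y by [normr_hat4_dpow] leaves distances between copies 0, 2 and between
    copies 1, 3. These two groups are independent, and within each the X and Y factors are handled
    by Cauchy-Schwarz. *)
Let ipsiX : Q.-integrable setT (EFin \o (fun w => `|psi w| *
  (dpow b (Xs 0 w : H) (Xs 2 w : H) * dpow b (Xs 1 w : H) (Xs 3 w : H)))).
Proof.
have u : uniq [:: 0; 2; 1; 3]%N by [].
have i1 := integrableM_indep (measurable_copy2 Xs Ys 0 2) (measurable_copy2 Xs Ys 1 3)
  (indep_copy2 copies u) mdd mdd (idd 0 2) (idd 1 3).
have mdX i j : measurable_fun setT (fun w => dpow b (Xs i w : H) (Xs j w : H)).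
  apply: (measurableT_comp (g := fun w => (Xs i w, Xs j w)) (measurable_dpow b sepH)).
  exact: measurable_fun_pair.
apply: (integrable_le _ (integrableZ_EFin 2 i1)).
  apply: measurable_funM; last exact: measurable_funM.
  by apply: measurableT_comp => //; exact: integrable_measurable ipsi.
move=> w; rewrite ger0_norm ?mulr_ge0 ?dpow_ge0//.
have := normr_hat4_dpow (Ys 0 w : H') (Ys 1 w : H') (Ys 2 w : H') (Ys 3 w : H') b01.
move=> /(ler_wpM2r (mulr_ge0 (dpow_ge0 b (Xs 0 w : H) (Xs 2 w : H)) (dpow_ge0 b (Xs 1 w : H) (Xs 3 w : H)))).
move=> /le_trans; apply; rewrite /dd/=.
move: (dpow _ _ _) (dpow _ _ _) (dpow _ _ _) (dpow _ _ _) => p q r t.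
by rewrite le_eqVlt; apply/orP; left; apply/eqP; ring.
Qed.

Let gX := gauss_hat (Xs 0) (Xs 1) (Xs 2) (Xs 3).
Let gY := gauss_hat (Ys 0) (Ys 1) (Ys 2) (Ys 3).

Let gX_le u w : `|gX u w| <= 4.
Proof.
have n (x y : H) : `|gaussk (expR u) x y| <= 1.
  by rewrite gtr0_norm ?gaussk_gt0// gaussk_le1// expR_ge0.
rewrite /gX /gauss_hat /hat4 (le_trans (ler_normB _ _))//.
rewrite (_ : 4 = 1 + 1 + 1 + 1 :> R); last by ring.
rewrite lerD// (le_trans (ler_normD _ _))// lerD// (le_trans (ler_normB _ _))//.
exact: lerD.
Qed.

Let mgX u : measurable_fun setT (gX u).
Proof.
have mg i j : measurable_fun setT (fun w => gaussk (expR u) (Xs i w : H) (Xs j w : H)).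
  apply: (measurableT_comp (g := fun w => (Xs i w, Xs j w)) (measurable_gaussk2 _ sepH)).
  exact: measurable_fun_pair.
apply: measurable_funB; last exact: mg.
apply: measurable_funD; last exact: mg.
by apply: measurable_funB; exact: mg.
Qed.

Let igX u : Q.-integrable setT (EFin \o gX u).
Proof. exact: (@integrable_bounded _ _ _ _ _ 4). Qed.

Let igXY u : Q.-integrable setT (EFin \o (fun w => `|gX u w| *
  (dpow b (Ys 0 w : H') (Ys 2 w : H') * dpow b (Ys 1 w : H') (Ys 3 w : H')))).
Proof.
have u4 : uniq [:: 0; 2; 1; 3]%N by [].
have md : measurable_fun setT (fun z : E * E => dpow b (z.1.2 : H') (z.2.2 : H')).
  apply: (measurableT_comp (g := fun z : E * E => (z.1.2, z.2.2)) (measurable_dpow b sepH')).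
  by apply: measurable_fun_pair; exact: measurableT_comp.
have id2 i j := integrable_dpow2 sepH' slY intY i j b2.
have i1 := integrableM_indep (measurable_copy2 Xs Ys 0 2) (measurable_copy2 Xs Ys 1 3)
  (indep_copy2 copies u4) md md (id2 0%N 2%N) (id2 1%N 3%N).
apply: (integrable_le _ (integrableZ_EFin 4 i1)).
  apply: measurable_funM; first exact: measurableT_comp.
  by apply: measurable_funM; exact: integrable_measurable (id2 _ _).
move=> w; rewrite ger0_norm ?mulr_ge0 ?dpow_ge0//=.
by rewrite ler_wpM2r ?mulr_ge0 ?dpow_ge0.
Qed.

Hypothesis dcov0 : centered_dcov Xs Ys b = 0.

Let phi u := \int[Q]_w (gX u w * psi w).

Let G u v := \int[Q]_w (gY v w * gX u w).

Let G_ge a a' u v : (2 * gauss_cov Xs Ys (expR u) (expR v) a a') ^+ 2 <= G u v.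
Proof.
rewrite (_ : G u v = hat_gauss Xs Ys (expR u) (expR v)).
  by apply: (gauss_cov_sqr_le sepH sepH' copies); exact: expR_ge0.
by apply: eq_Rintegral => w _; rewrite mulrC.
Qed.

Let G_ge0 u v : 0 <= G u v.
Proof. by apply: le_trans (G_ge 0 0 u v); exact: sqr_ge0. Qed.

Let intG u : \int[leb]_v (G u v * expR (- (b * v))) = - (mix_const b * phi u).
Proof.
rewrite (Rintegral_gauss_hat sepH' (mY 0) (mY 1) (mY 2) (mY 3) b01 (igX u) (igXY u)).
by congr (- (_ * _)); apply: eq_Rintegral => w _; rewrite mulrC.
Qed.

(** By [intG], -C phi(u) is the mixture over v of G(u,v), hence nonnegative. Its own mixture over u
    is C^2 times the expected product of hats, which is zero by [dcov0]; continuity in u concludes.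
    Then [G0] repeats the argument in v. *)
Let phi0 u : phi u = 0.
Proof.
have C0 := mix_const_gt0 b01.
have f0 v : 0 <= - (mix_const b * phi v).
  rewrite -intG; apply: Rintegral_ge0 => w _.
  by rewrite mulr_ge0 ?expR_ge0.
have cf : continuous (fun v => - (mix_const b * phi v)).
  have cg := continuous_gauss_hat sepH (mX 0) (mX 1) (mX 2) (mX 3) ipsi.
  move=> v; apply: (@cvgN _ R^o); apply: cvgM; first exact: cvg_cst.
  exact: cg.
have e0 (v : R) : 0 < expR (- (b * v)) by exact: expR_gt0.
have iphi := integrable_gauss_hat sepH (mX 0) (mX 1) (mX 2) (mX 3) b01 ipsi ipsiX.
have iphiC : leb.-integrable setT (EFin \o (fun v => - (mix_const b * phi v) * expR (- (b * v)))).
  have := @integrableZ_EFin _ _ _ leb (- mix_const b) _ iphi.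
  by congr (_.-integrable _ _); apply/funext => v; rewrite /= mulrA mulNr.
have iphi0 : \int[leb]_v (- (mix_const b * phi v) * expR (- (b * v))) = 0.
  transitivity (\int[leb]_v (- mix_const b * (phi v * expR (- (b * v))))).
    by apply: eq_Rintegral => v _; rewrite [in RHS]mulrA [in RHS]mulNr.
  rewrite (@RintegralZl _ _ _ leb)//.
  rewrite (Rintegral_gauss_hat sepH (mX 0) (mX 1) (mX 2) (mX 3) b01 ipsi ipsiX).
  have := Rintegral_hat_prod sepH sepH' copies b01 intX intY.
  rewrite dcov0 mulr0 => h0.
  by rewrite (_ : \int[Q]_w _ = 0) ?mulr0 ?oppr0 ?mulr0.
have := continuous_Rintegral_eq0 cf f0 e0 iphiC iphi0 u.
by move/eqP; rewrite oppr_eq0 mulf_eq0 (gt_eqF C0) => /eqP.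
Qed.

Let G0 u v : G u v = 0.
Proof.
have cf : continuous (G u).
  exact: (continuous_gauss_hat sepH' (mY 0) (mY 1) (mY 2) (mY 3) (igX u)).
have e0 (s : R) : 0 < expR (- (b * s)) by exact: expR_gt0.
have iG := integrable_gauss_hat sepH' (mY 0) (mY 1) (mY 2) (mY 3) b01 (igX u) (igXY u).
apply: (continuous_Rintegral_eq0 cf (G_ge0 u) e0 iG).
by rewrite intG phi0 mulr0 oppr0.
Qed.

Lemma centered_dcov0_indep : indep Q (Xs 0) (Ys 0).
Proof.
apply: indep_gaussk => // t s a a' t0 s0.
have := G_ge a a' (ln t) (ln s).
rewrite G0 !lnK// le_eqVlt ltNge sqr_ge0 orbF sqrf_eq0 mulf_eq0 pnatr_eq0/=.
by rewrite /gauss_cov subr_eq0 => /eqP.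
Qed.

End zero_distance_covariance.

(** * The starred covariance under moments of order 2 alpha *)

Section distance_covariance_star.
Context (R : realType) (H H' : hilbertType R).
Hypotheses (sepH : separable H) (sepH' : separable H').
Context dT (T : measurableType dT) (P : probability T R).
Variables (X : {RV P >-> borel H}) (Y : {RV P >-> borel H'}).
Context dS (S : measurableType dS) (Q : probability S R).
Variables (Xs : nat -> {RV Q >-> borel H}) (Ys : nat -> {RV Q >-> borel H'}).
Hypothesis copies : independent_copies X Y Xs Ys.
Variable b : R.
Hypothesis b01 : 0 < b < 1.
Hypothesis intX4 : Q.-integrable setT (EFin \o (fun w => `|Xs 0 w : H| `^ (2 * (2 * b)))).
Hypothesis intY4 : Q.-integrable setT (EFin \o (fun w => `|Ys 0 w : H'| `^ (2 * (2 * b)))).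

Let mX i : measurable_fun setT (Xs i). Proof. exact: measurable_funP. Qed.
Let mY i : measurable_fun setT (Ys i). Proof. exact: measurable_funP. Qed.
Let slX := same_law_copyX copies.
Let slY := same_law_copyY copies.

Let b0 : 0 < b. Proof. by case/andP: b01. Qed.
Let b24 : 0 <= 2 * b <= 2 * (2 * b).
Proof. by have bp := b0; apply/andP; split; [rewrite mulr_ge0// ltW|lra]. Qed.
Let b44 : 0 <= 2 * (2 * b) <= 2 * (2 * b).
Proof. by have bp := b0; rewrite lexx andbT !mulr_ge0// ltW. Qed.

Let dX i j w := dpow (2 * b) (Xs i w : H) (Xs j w : H).
Let dY i j w := dpow (2 * b) (Ys i w : H') (Ys j w : H').

Let idX i j : Q.-integrable setT (EFin \o dX i j).
Proof. exact: (integrable_dpow2 sepH slX intX4 i j b24). Qed.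
Let idY i j : Q.-integrable setT (EFin \o dY i j).
Proof. exact: (integrable_dpow2 sepH' slY intY4 i j b24). Qed.

Let dpow_sqrE (K : hilbertType R) (x y : K) : dpow (2 * b) x y ^+ 2 = dpow (2 * (2 * b)) x y.
Proof. by rewrite /dpow [in RHS]mulrC [in RHS]powRrM powR_mulrn// powR_ge0. Qed.

Let ikp i j k l : Q.-integrable setT (EFin \o kprod Xs Ys (dpow (2 * b)) (dpow (2 * b)) i j k l).
Proof.
apply: (integrableM_sqr (f := dX i j) (g := dY k l)).
- exact: integrable_measurable (idX i j).
- exact: integrable_measurable (idY k l).
- under [X in _ \o X]eq_fun do rewrite /dX dpow_sqrE.
  exact: (integrable_dpow2 sepH slX intX4 i j b44).
- under [X in _ \o X]eq_fun do rewrite /dY dpow_sqrE.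
  exact: (integrable_dpow2 sepH' slY intY4 k l b44).
Qed.

(** The moments of order 2 alpha make each term of the expansion with raw distances integrable by
    Cauchy-Schwarz; the disjoint term then factors into the product of the two mean distances. *)
Lemma dcov_star_hat : dcov_star (2 * b) Xs Ys = dcov_hat (2 * b) Xs Ys.
Proof.
have dC (K : hilbertType R) (x y : K) : dpow (2 * b) x y = dpow (2 * b) y x by exact: dpowC.
have mdX := measurable_dpow (2 * b) sepH; have mdY := measurable_dpow (2 * b) sepH'.
have E4 := Rintegral_hat4_prod copies mdX mdY (dC H) (dC H') (ikp 0 1 0 1) (ikp 0 1 0 2) (ikp 0 1 2 3).
have i4 := integrable_hat4_prod copies mdX mdY (dC H) (dC H') (ikp 0 1 0 1) (ikp 0 1 0 2) (ikp 0 1 2 3).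
have EXY : \int[Q]_w kprod Xs Ys (dpow (2 * b)) (dpow (2 * b)) 0 1 2 3 w =
    \int[Q]_w dX 0 1 w * \int[Q]_w dY 0 1 w.
  pose E := (borel H * borel H')%type.
  have mf : measurable_fun setT (fun z : E * E => dpow (2 * b) (z.1.1 : H) (z.2.1 : H)).
    apply: (measurableT_comp (g := fun z : E * E => (z.1.1, z.2.1)) mdX).
    by apply: measurable_fun_pair; exact: measurableT_comp.
  have mg : measurable_fun setT (fun z : E * E => dpow (2 * b) (z.1.2 : H') (z.2.2 : H')).
    apply: (measurableT_comp (g := fun z : E * E => (z.1.2, z.2.2)) mdY).
    by apply: measurable_fun_pair; exact: measurableT_comp.
  have u : uniq [:: 0; 1; 2; 3]%N by [].
  rewrite (_ : \int[Q]_w dY 0 1 w = \int[Q]_w dY 2 3 w).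
    exact: (RintegralM_indep (measurable_copy2 Xs Ys 0 1) (measurable_copy2 Xs Ys 2 3)
      (indep_copy2 copies u) mf mg (idX 0 1) (idY 2 3)).
  exact: (same_law_Rintegral (measurable_copy2 Xs Ys 0 1) (measurable_copy2 Xs Ys 2 3)
    (same_law_copy2 copies (isT : 0 != 1)%N (isT : 2 != 3)%N) mg).
rewrite /dcov_star /dcov_hat expectation.unlock.
have real (A B C D F : \bar R) (p q r t f : R) : A = p%:E -> B = q%:E -> C = r%:E ->
    D = t%:E -> F = f%:E -> f = 4 * (p + q * r - 2 * t) ->
    (A + B * C - 2%:E * D = (4^-1)%:E * F)%E.
  move=> -> -> -> -> -> ->.
  have e : p + q * r - 2 * t = 4^-1 * (4 * (p + q * r - 2 * t)).
    by rewrite mulrA mulVf ?mul1r.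
  exact: (congr1 EFin e).
apply: (real _ _ _ _ _ _ _ _ _ _ (EFin_Rintegral (ikp 0 1 0 1)) (EFin_Rintegral (idX 0 1))
  (EFin_Rintegral (idY 0 1)) (EFin_Rintegral (ikp 0 1 0 2)) (EFin_Rintegral i4)).
by rewrite -EXY; exact: E4.
Qed.

End distance_covariance_star.

(** * The equivalences for the hat, tilde and starred covariances *)

Section first_three_parts.
Context (R : realType) (H H' : hilbertType R).
Hypotheses (sepH : separable H) (sepH' : separable H').
Variable alpha : R.
Hypotheses (alpha_gt0 : 0 < alpha) (alpha_lt2 : alpha < 2).
Context dT (T : measurableType dT) (P : probability T R).
Variables (X : {RV P >-> borel H}) (Y : {RV P >-> borel H'}).
Context dS (S : measurableType dS) (Q : probability S R).
Variables (Xs : nat -> {RV Q >-> borel H}) (Ys : nat -> {RV Q >-> borel H'}).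
Hypothesis copies : independent_copies X Y Xs Ys.

Let alphaE : alpha = 2 * (alpha / 2). Proof. by rewrite mulrC divfK. Qed.
Let b01 : 0 < alpha / 2 < 1.
Proof. by rewrite divr_gt0//= ltr_pdivrMr// mul1r. Qed.

Lemma indep_copies_independent_RV : indep Q (Xs 0) (Ys 0) -> independent_RV X Y.
Proof.
move=> ind U V mU mV.
have PE (D : set (borel H * borel H')) : measurable D ->
    Q (copy Xs Ys 0 @^-1` D) = P (pair_fun X Y @^-1` D).
  by move=> mD; rewrite -(copies.1 0).
have E1 := PE _ (measurableX mU mV).
have E2 := PE _ (measurable_preimage measurable_fst mU).
have E3 := PE _ (measurable_preimage measurable_snd mV).
have E4 := ind U V mU mV.
transitivity (Q (Xs 0 @^-1` U `&` Ys 0 @^-1` V)); first exact: esym E1.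
by rewrite E4; congr (_ * _)%E; [exact: E2|exact: E3].
Qed.

Hypotheses (mX : (moment X alpha < +oo)%E) (mY : (moment Y alpha < +oo)%E).

Lemma centered_dcov0 : centered_dcov Xs Ys (alpha / 2) = 0 <-> independent_RV X Y.
Proof.
have intX := integrable_momentX copies mX; have intY := integrable_momentY copies mY.
rewrite alphaE in intX intY; split=> [c0|].
  exact/indep_copies_independent_RV/(centered_dcov0_indep sepH sepH' copies b01 intX intY).
exact: (centered_dcov_indep sepH sepH' copies b01 intX intY).
Qed.

Lemma dcov_hat0 : dcov_hat alpha Xs Ys = 0%E <-> independent_RV X Y.
Proof.
have intX := integrable_momentX copies mX; have intY := integrable_momentY copies mY.
rewrite -centered_dcov0; rewrite alphaE in intX intY.
rewrite [in dcov_hat _ _ _]alphaE (dcov_hatE sepH sepH' copies b01 intX intY).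
by split=> [[]|->].
Qed.

Lemma dcov_tilde0 : dcov_tilde alpha Xs Ys = 0%E <-> independent_RV X Y.
Proof.
have intX := integrable_momentX copies mX; have intY := integrable_momentY copies mY.
rewrite -centered_dcov0; rewrite alphaE in intX intY.
rewrite [in dcov_tilde _ _ _]alphaE (dcov_tildeE sepH sepH' copies b01 intX intY).
by split=> [[]|->].
Qed.

End first_three_parts.

Section star_part.
Context (R : realType) (H H' : hilbertType R).
Hypotheses (sepH : separable H) (sepH' : separable H').
Variable alpha : R.
Hypotheses (alpha_gt0 : 0 < alpha) (alpha_lt2 : alpha < 2).
Context dT (T : measurableType dT) (P : probability T R).
Variables (X : {RV P >-> borel H}) (Y : {RV P >-> borel H'}).
Context dS (S : measurableType dS) (Q : probability S R).
Variables (Xs : nat -> {RV Q >-> borel H}) (Ys : nat -> {RV Q >-> borel H'}).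
Hypothesis copies : independent_copies X Y Xs Ys.

Lemma moment_le (K : normedModType R) (Z : {RV P >-> borel K}) (p q : R) :
  measurable_fun setT (fun w => `|Z w : K|) -> 0 <= p <= q ->
  (moment Z q < +oo)%E -> (moment Z p < +oo)%E.
Proof.
move=> mZ pq; rewrite /moment expectation.unlock => qoo.
have mp r : measurable_fun setT (fun w => `|Z w : K| `^ r).
  exact: (measurableT_comp (measurable_powR r) mZ).
have iq := ge0_integrable_EFin (mp q) (fun w => powR_ge0 _ _) qoo.
have : P.-integrable setT (EFin \o (fun w => `|Z w : K| `^ p)).
  apply: (integrable_le (g := fun w => 1 + `|Z w : K| `^ q)) => //.
    by apply: integrableD_EFin => //; exact: integrable_probability_cst.
  by move=> w; rewrite ger0_norm ?powR_ge0// powR_le1D.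
by move=> ip; have := EFin_Rintegral ip => ->; rewrite ltry.
Qed.

Lemma dcov_star0 : (moment X (2 * alpha) < +oo)%E -> (moment Y (2 * alpha) < +oo)%E ->
  dcov_star alpha Xs Ys = 0%E <-> independent_RV X Y.
Proof.
move=> mX mY.
have mn (K : hilbertType R) (Z : {RV P >-> borel K}) : measurable_fun setT (fun w => `|Z w : K|).
  have mZ : measurable_fun setT Z by exact: measurable_funP.
  apply: (measurableT_comp (g := Z) _ mZ).
  rewrite [X in measurable_fun _ X](_ : _ = fun x : borel K => `|(x : K) - 0|).
    exact: measurable_norm_sub.
  by apply/funext => x; rewrite subr0.
have a2 : 0 <= alpha <= 2 * alpha by have ap := alpha_gt0; apply/andP; split; [exact: ltW|lra].
have mX1 := moment_le (mn _ X) a2 mX; have mY1 := moment_le (mn _ Y) a2 mY.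
have intX := integrable_momentX copies mX; have intY := integrable_momentY copies mY.
have alphaE : alpha = 2 * (alpha / 2) by rewrite mulrC divfK.
have b01 : 0 < alpha / 2 < 1 by rewrite divr_gt0//= ltr_pdivrMr// mul1r.
rewrite -(dcov_hat0 sepH sepH' alpha_gt0 alpha_lt2 copies mX1 mY1).
rewrite alphaE in intX intY.
by rewrite alphaE (dcov_star_hat sepH sepH' copies b01 intX intY).
Qed.

End star_part.

(** * The standard normal law and its characteristic function *)

Section normal.
Context (R : realType).
Local Notation leb := (@lebesgue_measure R).

(** The fundamental theorem of calculus on [-n-1, n+1], followed by dominated convergence. *)
Lemma Rintegral_derive_eq0 (g g' : R -> R) :
  (forall x, is_derive x (1 : R) g (g' x)) -> continuous g' ->
  leb.-integrable setT (EFin \o g') ->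
  g n%:R @[n --> \oo] --> (0 : R) -> g (- n%:R) @[n --> \oo] --> (0 : R) ->
  \int[leb]_x g' x = 0.
Proof.
move=> gg' cg' ig' gy gNy.
have cg x : {for x, continuous g}.
  by apply/differentiable_continuous/derivable1_diffP; have [] := gg' x.
pose I n : set R := `[- n.+1%:R, n.+1%:R]%classic.
pose F n (x : R) : R := g' x * \1_(I n) x.
have mg' := integrable_measurable ig'.
have mF n : measurable_fun setT (F n).
  apply: measurable_funM; first exact: mg'.
  apply: measurable_indic; exact: measurable_itv.
have IF n : \int[leb]_x F n x = g n.+1%:R - g (- n.+1%:R).
  rewrite -Rintegral_indicE /Rintegral /I (@continuous_FTC2 _ g' g)//.
  - have : (0 : R) < n.+1%:R by [].
    by lra.
  - exact: continuous_subspaceT.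
  - split=> [x _||]; first by have [] := gg' x.
    + by apply: cvg_at_right_filter; exact: cg.
    + by apply: cvg_at_left_filter; exact: cg.
  - by move=> x _; rewrite derive1E; have [_ ->] := gg' x.
have : \int[leb]_x F n x @[n --> \oo] --> \int[leb]_x g' x.
  apply: (@dominated_cvg _ _ _ leb _ _ (fun x => `|g' x|)) => //.
  - move=> x; apply: cvg_near_cst; near=> n.
    have xn : `|x| <= n.+1%:R.
      by apply: (@le_trans _ _ n%:R); rewrite ?ler_nat//; near: n; exact: nbhs_infty_ger.
    by rewrite /F indicE mem_set ?mulr1// /I/= in_itv/= -ler_norml.
  - exact: (@integrable_norm _ _ _ leb).
  - move=> n x; rewrite /F normrM ler_piMr// indicE.
    by case: (_ \in _); rewrite ?normr1 ?normr0.
move=> /(cvg_lim (@Rhausdorff R)) => <-.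
apply: cvg_lim => //.
under eq_fun do rewrite IF.
rewrite -[0]subr0; apply: cvgB.
- by rewrite (@cvg_shiftS R (fun n => g n%:R)).
- by rewrite (@cvg_shiftS R (fun n => g (- n%:R))).
Unshelve. all: end_near. Qed.

Definition npdf : R -> R := normal_pdf 0 1.

Lemma npdfE x : npdf x = normal_peak 1 * expR (- (x ^+ 2 / 2)).
Proof. by rewrite /npdf normal_pdfE//= /normal_fun subr0 expr1n mulNr. Qed.

Lemma npdf_ge0 x : 0 <= npdf x. Proof. exact: normal_pdf_ge0. Qed.

Lemma continuous_npdf : continuous npdf. Proof. exact: continuous_normal_pdf. Qed.

Lemma measurable_npdf : measurable_fun setT npdf.
Proof. exact: measurable_normal_pdf. Qed.

Lemma Rintegral_npdf : \int[leb]_x npdf x = 1.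
Proof. by rewrite /Rintegral integral_normal_pdf. Qed.

Lemma is_derive_npdf x : is_derive x (1 : R) npdf (- (x * npdf x)).
Proof.
have -> : npdf = (fun x => normal_peak 1 * expR (- (x ^+ 2 / 2))).
  by apply/funext => y; exact: npdfE.
apply: is_derive_eq.
by rewrite /GRing.scale/=; field.
Qed.

Lemma npdf_le x : npdf x <= normal_peak 1 * expR 2 * expR (- (2 * `|x|)).
Proof.
rewrite npdfE -mulrA -expRD ler_pM2l; last by rewrite normal_peak_gt0 ?oner_eq0.
rewrite ler_expR -[x ^+ 2]real_normK ?num_real//.
(* This gives x^2/2 >= 2|x| - 2, hence the constant e^2. *)
have := sqr_ge0 (`|x| - 2); nra.
Qed.

Lemma integrable_npdf_mul (f : R -> R) (C : R) : measurable_fun setT f ->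
  (forall x, `|f x| <= C * expR `|x|) ->
  leb.-integrable setT (EFin \o (fun x => f x * npdf x)).
Proof.
move=> mf fC.
pose K := C * (normal_peak 1 * expR 2).
apply: (@integrable_le _ _ _ leb _ (fun x => K * expR (- (1 * `|x|)))).
- exact: measurable_funM mf measurable_npdf.
- by apply: (@integrableZ_EFin _ _ _ leb); exact: integrable_expR_normr.
- move=> x; rewrite normrM (ger0_norm (npdf_ge0 x)).
  apply: le_trans (ler_pM (normr_ge0 _) (npdf_ge0 x) (fC x) (npdf_le x)) _.
  rewrite /K mul1r; have -> : - (2 * `|x|) = - `|x| - `|x| by ring.
  rewrite [expR (- `|x| - _)]expRD; have e := expRxMexpNx_1 `|x|.
  rewrite le_eqVlt; apply/predU1P; left; move: e (normal_peak (1 : R)) (expR (2 : R)) => + p q.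
  move: (expR `|x|) (expR (- `|x|)) => a b ab.
  by transitivity (C * (p * q) * b * (a * b)); [ring|rewrite ab mulr1].
Qed.

Lemma cvg_expR_npdf (f : R -> R) (C : R) : (forall x, `|f x| <= C) ->
  f n%:R * npdf n%:R @[n --> \oo] --> (0 : R) /\
  f (- n%:R) * npdf (- n%:R) @[n --> \oo] --> (0 : R).
Proof.
move=> fC; have C0 : 0 <= C by exact: le_trans (fC 0).
pose K := C * (normal_peak 1 * expR 2).
have cK : K * expR (- n%:R) @[n --> \oo] --> (0 : R).
  rewrite -[X in _ --> X](mulr0 K); apply: cvgMr.
  exact: cvgn_expR.
have bnd x : `|f x * npdf x| <= K * expR (- `|x|).
  rewrite normrM (ger0_norm (npdf_ge0 x)) /K -mulrA.
  apply: ler_pM => //; first exact: npdf_ge0.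
  apply: le_trans (npdf_le x) _; rewrite ler_wpM2l//.
    by rewrite mulr_ge0 ?expR_ge0// normal_peak_ge0.
  by rewrite ler_expR lerN2; have := normr_ge0 x; lra.
have sq (g : nat -> R) : (forall n, `|g n| <= K * expR (- n%:R)) ->
    g n @[n --> \oo] --> (0 : R).
  move=> gK; apply/norm_cvg0P/(squeeze_cvgr _ (cvg_cst 0) cK).
  by apply: nearW => n; rewrite normr_ge0 gK.
by split; apply: sq => n; rewrite (le_trans (bnd _))// ?normrN ger0_norm.
Qed.

Lemma integrable_bounded_npdf (f : R -> R) (C : R) : measurable_fun setT f ->
  (forall x, `|f x| <= C) ->
  leb.-integrable setT (EFin \o (fun x => f x * npdf x)).
Proof.
move=> mf fC; apply: (@integrable_npdf_mul _ C) => // x.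
apply: le_trans (fC x) _; rewrite ler_peMr ?(le_trans (normr_ge0 _) (fC 0))//.
by rewrite -expR0 ler_expR.
Qed.

Let affine_continuous (v p : R) : continuous (fun z => v * z + p).
Proof.
by move=> z; apply: cvgD; [apply: cvgM; [exact: cvg_cst|exact: cvg_id]|exact: cvg_cst].
Qed.

Let cos_continuous (v p : R) : continuous (fun z => cos (v * z + p)).
Proof.
by move=> z; apply: continuous_comp; [exact: affine_continuous|exact: continuous_cos].
Qed.

Let sin_continuous (v p : R) : continuous (fun z => sin (v * z + p)).
Proof.
by move=> z; apply: continuous_comp; [exact: affine_continuous|exact: continuous_sin].
Qed.

Let normr_le_expR (x : R) : `|x| <= expR `|x|.
Proof. by apply: le_trans (expR_ge1Dx _); rewrite lerDr. Qed.

Let int_cos (v p : R) : leb.-integrable setT (EFin \o (fun x => cos (v * x + p) * npdf x)).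
Proof.
apply: (@integrable_bounded_npdf _ 1); first exact: continuous_measurable_fun.
by move=> x; rewrite ler_norml cos_geN1 cos_le1.
Qed.

Let int_sin (v p : R) :
  leb.-integrable setT (EFin \o (fun x => x * sin (v * x + p) * npdf x)).
Proof.
apply: (@integrable_npdf_mul _ 1).
  by apply: measurable_funM => //; exact: continuous_measurable_fun.
move=> x; rewrite mul1r normrM (le_trans _ (normr_le_expR x))// ler_piMr//.
by rewrite ler_norml sin_geN1 sin_le1.
Qed.

Let cos_sin_npdf (v p : R) :
  v * (\int[leb]_x (cos (v * x + p) * npdf x)) =
  \int[leb]_x (x * sin (v * x + p) * npdf x).
Proof.
apply/eqP; rewrite -subr_eq0; apply/eqP.
have iv := @integrableZ_EFin _ _ _ leb v _ (int_cos v p).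
rewrite -RintegralZl// -RintegralB//.
have bsin x : `|sin (v * x + p)| <= 1 by rewrite ler_norml sin_geN1 sin_le1.
have [c1 c2] := cvg_expR_npdf bsin.
apply: (@Rintegral_derive_eq0 (fun x => sin (v * x + p) * npdf x)
  (fun x => v * (cos (v * x + p) * npdf x) - x * sin (v * x + p) * npdf x)) => //.
- move=> x; have := is_derive_npdf x => dn; apply: is_derive_eq.
  by rewrite /GRing.scale/=; ring.
- move=> x; apply: cvgB; apply: cvgM; try exact: cvg_cst; last exact: continuous_npdf.
    by apply: cvgM; [exact: cos_continuous|exact: continuous_npdf].
  by apply: cvgM; [exact: cvg_id|exact: sin_continuous].
- exact: (@integrableB_EFin _ _ _ leb).
Qed.

(** As a function of v the integral F satisfies F' = -vF, by differentiation under the integral and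
    integration by parts ([cos_sin_npdf]); so F e^(v^2/2) is constant. The phase p covers cosine and
    sine at once. *)
Lemma Rintegral_cos_npdf (v p : R) :
  \int[leb]_x (cos (v * x + p) * npdf x) = cos p * expR (- (v ^+ 2 / 2)).
Proof.
pose f v x := cos (v * x + p) * npdf x.
pose F v := \int[leb]_x f v x.
have df u x : is_derive u (1 : R) (f ^~ x) (- (x * sin (u * x + p) * npdf x)).
  by apply: is_derive_eq; rewrite /GRing.scale/=; ring.
have d1 u x : partial1of2 f u x = - (x * sin (u * x + p) * npdf x).
  by rewrite partial1of2E; have [] := df u x.
have G0 x : 0 <= `|x| * npdf x by rewrite mulr_ge0 ?npdf_ge0.
have iG : leb.-integrable setT (EFin \o (fun x => `|x| * npdf x)).
  by apply: (@integrable_npdf_mul _ 1) => // x; rewrite mul1r normr_id.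
have Gub u x : `|partial1of2 f u x| <= `|x| * npdf x.
  rewrite d1 normrN !normrM (ger0_norm (npdf_ge0 x)) ler_wpM2r ?npdf_ge0//.
  by rewrite ler_piMr// ler_norml sin_geN1 sin_le1.
have dF u : is_derive u (1 : R) F (- (u * F u)).
  have Iu : `](u - 1), (u + 1)[%classic u by rewrite /= in_itv/=; lra.
  have df1 w x : derivable (f ^~ x) w 1 by have [] := df w x.
  have D := @derivable_under_integral R _ _ leb f setT measurableT u (u - 1) (u + 1) Iu
    (fun w _ => int_cos w p) (fun w x _ _ => df1 w x) _ G0 iG (fun w x _ _ => Gub w x).
  have E := @differentiation_under_integral R _ _ leb f setT measurableT u (u - 1) (u + 1) Iu
    (fun w _ => int_cos w p) (fun w x _ _ => df1 w x) _ G0 iG (fun w x _ _ => Gub w x).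
  apply: DeriveDef => //; rewrite -derive1E E /F /f cos_sin_npdf.
  rewrite -(@RintegralN _ _ _ leb)//; apply: eq_Rintegral => x _; exact: d1.
pose h u := F u * expR (u ^+ 2 / 2).
have dh u : is_derive u (1 : R) h 0.
  by have := dF u => dFu; apply: is_derive_eq; rewrite /GRing.scale/=; field.
have := is_derive_0_is_cst v 0 dh.
have F0 : F 0 = cos p.
  rewrite /F /f; under eq_Rintegral do rewrite mul0r add0r.
  by rewrite RintegralZl//; [rewrite Rintegral_npdf mulr1|exact: integrable_normal_pdf].
rewrite /h F0 expr0n/= mul0r expR0 mulr1 => <-.
by rewrite -mulrA -expRD subrr expR0 mulr1.
Qed.

Lemma Rintegral_id_npdf : \int[leb]_x (x * npdf x) = 0.
Proof.
have b1 (x : R) : `|(-1 : R)| <= 1 by rewrite normrN1.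
have [c1 c2] := cvg_expR_npdf b1.
apply: (@Rintegral_derive_eq0 (fun x => -1 * npdf x) (fun x => x * npdf x)) => //.
- by move=> x; have := is_derive_npdf x => dn; apply: is_derive_eq; rewrite /GRing.scale/=; ring.
- by move=> x; apply: cvgM; [exact: cvg_id|exact: continuous_npdf].
- by apply: (@integrable_npdf_mul _ 1) => // x; rewrite mul1r.
Qed.

Lemma ge0_integral_normal_prob (f : R -> \bar R) : measurable_fun setT f ->
  (forall x, 0 <= f x)%E ->
  (\int[normal_prob 0 (1 : R)]_x f x = \int[leb]_x (f x * (npdf x)%:E))%E.
Proof.
move=> mf f0; have dom := normal_prob_dominates (0 : R) (1 : R).
rewrite -(Radon_Nikodym_SigmaFinite.change_of_variables dom)//.
have ig := Radon_Nikodym_SigmaFinite.f_integrable dom.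
apply: ae_eq_integral => //.
- by apply: emeasurable_funM => //; exact: measurable_int ig.
- by apply: emeasurable_funM => //; apply/measurable_EFinP; exact: measurable_npdf.
- apply: ae_eqe_mul2l; apply: integral_ae_eq => //.
  + by apply/measurable_EFinP; exact: measurable_npdf.
  + by move=> E _ mE; rewrite -Radon_Nikodym_SigmaFinite.f_integral.
Qed.

End normal.

Section standard_normal.
Context (R : realType) d (S : measurableType d) (Q : probability S R).
Variable Z : {RV Q >-> R}.
Hypothesis nZ : standard_normal Z.
Local Notation leb := (@lebesgue_measure R).

Let ge0_law (f : R -> \bar R) : measurable_fun setT f -> (forall x, 0 <= f x)%E ->
  (\int[Q]_w f (Z w) = \int[leb]_x (f x * (npdf x)%:E))%E.
Proof.
move=> mf f0; rewrite -(ge0_integral_normal_prob mf f0).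
have mZ : @measurable_fun _ _ S (measurableTypeR R) setT Z.
  move=> _ B mB; have := @measurable_funPTI _ _ _ _ Z B mB; rewrite setTI; exact.
pose Zm : {mfun S >-> measurableTypeR R} :=
  @mfun_Sub _ _ S (measurableTypeR R) Z (mem_set mZ).
transitivity (\int[distribution Q Zm]_x f x)%E.
  by rewrite (ge0_integral_distribution Zm).
by apply: eq_measure_integral => A mA _; exact: nZ.
Qed.

Lemma integrable_standard_normal (f : R -> R) : measurable_fun setT f ->
  leb.-integrable setT (EFin \o (fun x => f x * npdf x)) ->
  Q.-integrable setT (EFin \o (f \o Z)).
Proof.
move=> mf /integrableP[_ foo]; apply/integrableP; split.
  by apply/measurable_EFinP; exact: measurableT_comp.
rewrite (ge0_law (f := fun x => `|(f x)%:E|%E))//; last first.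
  by apply: measurableT_comp => //; exact/measurable_EFinP.
move: foo; congr (_ < _)%E; apply: eq_integral => x _ /=.
by rewrite normrM (ger0_norm (npdf_ge0 x)) EFinM.
Qed.

Lemma Rintegral_standard_normal (f : R -> R) : measurable_fun setT f ->
  leb.-integrable setT (EFin \o (fun x => f x * npdf x)) ->
  \int[Q]_w f (Z w) = \int[leb]_x (f x * npdf x).
Proof.
move=> mf intf; rewrite /Rintegral; congr fine.
have mEf : measurable_fun setT (EFin \o f) by exact/measurable_EFinP.
rewrite integralE [RHS]integralE; congr (_ - _)%E.
- have := @ge0_law (EFin \o f)^\+%E (measurable_funepos mEf) (funepos_ge0 (EFin \o f)).
  move=> law; transitivity (\int[Q]_w ((EFin \o f)^\+ (Z w)))%E.
    by apply: eq_integral => w _; rewrite !funeposE.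
  rewrite law; apply: eq_integral => x _; rewrite !funeposE/= -!EFin_max -EFinM.
  by rewrite maxr_pMl ?npdf_ge0// mul0r.
- have := @ge0_law (EFin \o f)^\-%E (measurable_funeneg mEf) (funeneg_ge0 (EFin \o f)).
  move=> law; transitivity (\int[Q]_w ((EFin \o f)^\- (Z w)))%E.
    by apply: eq_integral => w _; rewrite !funenegE.
  rewrite law; apply: eq_integral => x _; rewrite !funenegE/= -!EFin_max -EFinM.
  by rewrite maxr_pMl ?npdf_ge0// mul0r mulNr.
Qed.

Lemma standard_normal_cos (v p : R) :
  \int[Q]_w cos (v * Z w + p) = cos p * expR (- (v ^+ 2 / 2)).
Proof.
have cc : continuous (fun x => cos (v * x + p)).
  move=> x; apply: continuous_comp; last exact: continuous_cos.
  by apply: cvgD; [apply: cvgM; [exact: cvg_cst|exact: cvg_id]|exact: cvg_cst].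
have mc := continuous_measurable_fun cc.
rewrite -Rintegral_cos_npdf (@Rintegral_standard_normal (fun x => cos (v * x + p)))//.
by apply: (@integrable_bounded_npdf _ _ 1) => // x; rewrite ler_norml cos_geN1 cos_le1.
Qed.

Lemma standard_normal_mean : \int[Q]_w Z w = 0.
Proof.
rewrite -[RHS](Rintegral_id_npdf R) (@Rintegral_standard_normal id)//.
apply: (@integrable_npdf_mul _ _ 1) => // x; rewrite mul1r.
by apply: le_trans (expR_ge1Dx _); rewrite lerDr.
Qed.

Let int_sqr : leb.-integrable setT (EFin \o (fun x => x ^+ 2 * npdf x)).
Proof.
apply: (@integrable_npdf_mul _ _ 4); first exact: measurable_funX.
move=> x; rewrite normrX; have := normr_ge0 x; set a := `|x| => a0.
rewrite (_ : expR a = expR (a / 2) ^+ 2); last by rewrite -expRM_natr divfK.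
by have := expR_ge1Dx (a / 2); nra.
Qed.

Lemma integrable_standard_normal_sqr : Q.-integrable setT (EFin \o (fun w => Z w ^+ 2)).
Proof.
by apply: (@integrable_standard_normal (fun x => x ^+ 2)); first exact: measurable_funX.
Qed.

Lemma standard_normal_sqr : \int[Q]_w (Z w ^+ 2) = \int[leb]_x (x ^+ 2 * npdf x).
Proof.
by rewrite (@Rintegral_standard_normal (fun x => x ^+ 2))//; exact: measurable_funX.
Qed.

End standard_normal.

(** * Conditional expectations by freezing independent variables *)

Section freezing.
Context d (S : measurableType d) (R : realType) (Q : probability S R).
Context dA (A : measurableType dA) (U : S -> A) (G : set (set S)).
Hypotheses (mU : measurable_fun setT U).
Hypotheses (sG : sigma_algebra setT G) (Gm : G `<=` measurable).

Local Notation SG := (g_sigma_algebraType G).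

Lemma measurable_id_sub_sigma : measurable_fun setT (id : S -> SG).
Proof.
by move=> _ B mB; rewrite setTI; apply: Gm; apply: mB; split.
Qed.

Hypothesis UG : indep Q U (id : S -> SG).
Variables (f : A * SG -> R) (M : R).
Hypotheses (mf : measurable_fun setT f) (fM : forall x, `|f x| <= M).

Let f' (x : SG * A) : R := f (x.2, x.1).

Let mf' : measurable_fun setT f'.
Proof.
apply: (measurableT_comp mf).
by apply: measurable_fun_pair; [exact: measurable_snd|exact: measurable_fst].
Qed.

Let msub : measurable_fun setT (fun w : SG => \int[Q]_w' f (U w', w)).
Proof.
apply: (measurable_Rintegral_indep measurable_id_sub_sigma mU (indepC UG) mf').
apply: (@integrable_bounded _ _ _ _ _ M) => [|x]; last exact: fM.
apply: (measurableT_comp mf'); apply: measurable_fun_pair => //.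
exact: measurable_id_sub_sigma.
Qed.

(* The explicit conditional expectation under independence: integrate out U with
   the G-measurable variables kept fixed. *)
Lemma is_cond_exp_freeze :
  is_cond_exp Q G (fun w => f (U w, w)) (fun w => \int[Q]_w' f (U w', w)).
Proof.
have mfU : measurable_fun setT (fun w : S => f (U w, w)).
  apply: (measurableT_comp mf); apply: measurable_fun_pair => //.
  exact: measurable_id_sub_sigma.
have mfw (w : SG) : measurable_fun setT (fun w' => f (U w', w)).
  by apply: (measurableT_comp mf); exact: measurable_fun_pair.
have Ib w : `|\int[Q]_w' f (U w', w)| <= M.
  apply: le_trans (le_normr_Rintegral _ _) _ => //.
    exact: (@integrable_bounded _ _ _ _ _ M).
  rewrite -[leRHS](@Rintegral_probability_cst _ _ _ Q).
  apply: le_Rintegral => //; last exact: integrable_probability_cst.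
  exact/integrable_norm/(@integrable_bounded _ _ _ _ _ M).
have mI : measurable_fun setT (fun w : S => \int[Q]_w' f (U w', w)).
  exact: (measurableT_comp msub measurable_id_sub_sigma).
have intI : Q.-integrable setT (EFin \o (fun w => \int[Q]_w' f (U w', w))).
  exact: (@integrable_bounded _ _ _ _ _ M).
have intf : Q.-integrable setT (EFin \o (fun w => f (U w, w))).
  exact: (@integrable_bounded _ _ _ _ _ M).
split => //; first exact/(sub_measurableP sG).
move=> B GB; have mB := Gm GB.
apply: eq_integral_EFin => //; rewrite Rintegral_indicE [RHS]Rintegral_indicE.
have mBG : measurable (B : set SG) by exact: sub_sigma_algebra.
have m1 : measurable_fun setT (\1_B : SG -> R) by exact: measurable_indic.
have n1 w : `|(\1_B w : R)| <= 1.
  by rewrite indicE; case: (_ \in _); rewrite ?normr1 ?normr0.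
have M0 : 0 <= M by exact: le_trans (normr_ge0 _) (fM (U point, point)).
have mg : measurable_fun setT (fun x : SG * A => f' x * \1_B x.1).
  by apply: measurable_funM => //; apply: (measurableT_comp m1); exact: measurable_fst.
rewrite [RHS](Rintegral_indep measurable_id_sub_sigma mU (indepC UG) mg); last first.
  apply: (@integrable_bounded _ _ _ _ _ M).
    exact: (measurableT_comp mg (measurable_fun_pair measurable_id_sub_sigma mU)).
  by move=> w /=; rewrite normrM -[leRHS]mulr1 ler_pM//; exact: fM.
apply: eq_Rintegral => w _ /=; rewrite RintegralZr//.
apply: (@integrable_bounded _ _ _ _ _ M); first exact: (mfw w).
by move=> w'; exact: fM.
Qed.

End freezing.

(** * Independence of disjoint blocks *)

Section mutual_independence.
Context d (S : measurableType d) (R : realType) (Q : probability S R).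
Context (I : eqType) (D : set I) (F : I -> set (set S)).
Hypothesis FD : mutually_independent Q D F.
Hypothesis FT : forall i, F i setT.
Hypothesis FI : forall i, setI_closed (F i).
Hypothesis Fm : forall i, D i -> F i `<=` measurable.

(** Finite intersections of events with indices in [J]: a pi-system whose sigma-algebra contains all
    the families indexed by [J], and on which mutual independence speaks directly. *)
Definition block (J : set I) : set (set S) :=
  [set A | exists (s : seq I) (E : I -> set S),
     [/\ uniq s, forall i, i \in s -> [/\ J i, D i & F i (E i)] &
       A = \big[setI/setT]_(i <- s) E i]].

Lemma bigsetIE (s : seq I) (E : I -> set S) :
  \big[setI/setT]_(i <- s) E i = [set x | forall i, i \in s -> E i x].
Proof.
elim: s => [|j s IH]; first by rewrite big_nil; apply/seteqP; split.
rewrite big_cons IH; apply/seteqP; split => x /=.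
  by move=> [Ej Es] i; rewrite inE => /predU1P[->|/Es].
by move=> H; split=> [|i js]; apply: H; rewrite inE ?eqxx ?js ?orbT.
Qed.

Lemma setI_closed_block J : setI_closed (block J).
Proof.
move=> _ _ [s [E [us sE ->]]] [s' [E' [us' sE' ->]]].
(* An index occurring in only one of the lists receives [setT] from the other. *)
exists (undup (s ++ s')), (fun i => (if i \in s then E i else setT) `&`
                                    (if i \in s' then E' i else setT)).
split; first exact: undup_uniq.
  move=> i; rewrite mem_undup mem_cat => iss.
  have [Ji Di] : J i /\ D i by case/orP: iss => [/sE[]|/sE'[]].
  by split=> //; apply: FI; case: ifPn => //; [move=> /sE[]|move=> /sE'[]].
rewrite !bigsetIE; apply/seteqP; split => x /=.
  by move=> [H H'] i _; split; case: ifPn => //; [exact: H|exact: H'].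
move=> H; split=> i im.
  by have := H i; rewrite mem_undup mem_cat im/= => /(_ isT) [].
by have := H i; rewrite mem_undup mem_cat im orbT => /(_ isT) [].
Qed.

Lemma block_measurable J : block J `<=` measurable.
Proof.
move=> _ [s [E [us sE ->]]]; rewrite big_seq.
by apply: bigsetI_measurable => i /sE[_ Di]; exact: Fm.
Qed.

Lemma indep_block J1 J2 A B : J1 `&` J2 = set0 -> block J1 A -> block J2 B ->
  Q (A `&` B) = (Q A * Q B)%E.
Proof.
move=> J12 [s [E [us sE ->]]] [s' [E' [us' sE' ->]]].
pose E'' i := if i \in s then E i else E' i.
have nss' i : i \in s' -> i \notin s.
  move=> /sE'[Ji _ _]; apply/negP => /sE[Ji' _ _].
  by have : (J1 `&` J2) i by []; rewrite J12.
have eqE : \big[setI/setT]_(i <- s) E i = \big[setI/setT]_(i <- s) E'' i.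
  by apply: eq_big_seq => i im; rewrite /E'' im.
have eqE' : \big[setI/setT]_(i <- s') E' i = \big[setI/setT]_(i <- s') E'' i.
  by apply: eq_big_seq => i im; rewrite /E'' (negbTE (nss' i im)).
have H i : i \in s ++ s' -> D i /\ F i (E'' i).
  rewrite mem_cat /E''; case: ifPn => [/sE[]|_ /sE'[]]//.
rewrite eqE eqE' -big_cat/= FD//; last first.
  rewrite cat_uniq us us' andbT; apply/hasPn => i; exact: nss'.
rewrite big_cat/=; congr (_ * _)%E; apply/esym/FD => // i im; apply: H;
  by rewrite mem_cat im ?orbT.
Qed.

Lemma indep_sigma_block J1 J2 A B : J1 `&` J2 = set0 ->
  <<s \bigcup_(i in J1 `&` D) F i >> A -> <<s \bigcup_(i in J2 `&` D) F i >> B ->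
  Q (A `&` B) = (Q A * Q B)%E.
Proof.
move=> J12.
have sub J : <<s \bigcup_(i in J `&` D) F i >> `<=` <<s block J >>.
  apply: smallest_sub; first exact: smallest_sigma_algebra.
  move=> E [i [Ji Di] FE]; apply: sub_sigma_algebra.
  exists [:: i], (fun=> E); split => //; last by rewrite big_seq1.
  by move=> j; rewrite inE => /eqP ->.
move=> /sub sA /sub sB.
apply: (@indep_g_sigma _ _ _ Q (block J1) (block J2)) => //.
- exact: setI_closed_block.
- exact: setI_closed_block.
- exact: block_measurable.
- exact: block_measurable.
- by move=> A' B'; exact: indep_block.
Qed.

End mutual_independence.

(** * The sigma-algebras of the Gaussian variables *)

Section gaussian_family.
Context (R : realType) (H H' : hilbertType R).
Context dS (S : measurableType dS) (Q : probability S R).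
Variables (X : {RV Q >-> borel H}) (Y : {RV Q >-> borel H'}).
Variables (dim : option nat) (xi : nat -> {RV Q >-> R}).
Variables (dim' : option nat) (eta : nat -> {RV Q >-> R}).
Hypothesis gs : gaussian_setup X Y dim xi dim' eta.

Let D : set (option (nat + nat)) := [set k | match k with
  | None => True | Some (inl i) => in_dim dim i | Some (inr j) => in_dim dim' j end].

Let F (k : option (nat + nat)) : set (set S) := match k with
  | None => sigma_pair X Y
  | Some (inl i) => g_sigma_algebra_preimage (xi i)
  | Some (inr j) => g_sigma_algebra_preimage (eta j) end.

Definition gauss_var (k : nat + nat) : {RV Q >-> R} :=
  match k with inl i => xi i | inr j => eta j end.

Definition gauss_index : set (nat + nat) := [set k | D (Some k)].

(* The sigma-algebra generated by the Gaussian variables with indices in J. *)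
Definition gauss_sigma (J : set (nat + nat)) : set (set S) :=
  <<s \bigcup_(k in (Some @` J) `&` D) F k >>.

Let mXY : measurable_fun setT (pair_fun X Y).
Proof. exact: measurable_fun_pair. Qed.

Let preimage_sigma_closed dA (A : measurableType dA) (f : S -> A) :
  g_sigma_algebra_preimage f setT /\ setI_closed (g_sigma_algebra_preimage f).
Proof.
split; first by exists setT => //; rewrite setTI.
move=> _ _ [B mB <-] [B' mB' <-]; exists (B `&` B'); first exact: measurableI.
by rewrite !setTI preimage_setI.
Qed.

Let FT k : F k setT.
Proof. by case: k => [[i|j]|]; exact: (preimage_sigma_closed _).1. Qed.

Let FI k : setI_closed (F k).
Proof. by case: k => [[i|j]|]; exact: (preimage_sigma_closed _).2. Qed.

Let Fm k : D k -> F k `<=` measurable.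
Proof.
by move=> _; case: k => [[i|j]|] _ [B mB <-]; rewrite setTI; exact: measurable_preimage.
Qed.

Lemma sigma_algebra_gauss_sigma J : sigma_algebra setT (gauss_sigma J).
Proof. exact: smallest_sigma_algebra. Qed.

Lemma gauss_sigma_measurable J : gauss_sigma J `<=` measurable.
Proof.
apply: smallest_sub; first exact: sigma_algebra_measurable.
by move=> E [k [_ Dk]]; exact: Fm.
Qed.

Lemma gauss_var_normal k : gauss_index k -> standard_normal (gauss_var k).
Proof. by case: gs => nx ny _; case: k => i; [exact: nx|exact: ny]. Qed.

Lemma measurable_gauss_var J k : J k -> gauss_index k ->
  measurable_fun setT (gauss_var k : g_sigma_algebraType (gauss_sigma J) -> R).
Proof.
move=> Jk Dk _ B mB; rewrite setTI; apply: sub_sigma_algebra; apply: sub_sigma_algebra.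
exists (Some k); first by split => //; exists k.
by rewrite /F/=; case: k {Jk Dk} => i; exists B => //; rewrite setTI.
Qed.

Let indep_sigma J1 J2 A B : J1 `&` J2 = set0 ->
  <<s \bigcup_(i in J1 `&` D) F i >> A -> <<s \bigcup_(i in J2 `&` D) F i >> B ->
  Q (A `&` B) = (Q A * Q B)%E.
Proof. by case: gs => _ _ ind; exact: (indep_sigma_block ind FT FI Fm). Qed.

Let gauss_sigma_elim J (B : set (g_sigma_algebraType (gauss_sigma J))) :
  measurable B -> gauss_sigma J B.
Proof. by move=> mB; apply: mB; split => //; exact: smallest_sigma_algebra. Qed.

Lemma indep_gauss_var J k : ~ J k -> gauss_index k ->
  indep Q (gauss_var k) (id : S -> g_sigma_algebraType (gauss_sigma J)).
Proof.
move=> nJk Dk A B mA mB.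
apply: (@indep_sigma [set Some k] (Some @` J)).
- by apply/seteqP; split => // _ [-> [j Jj [jk]]]; apply: nJk; rewrite -jk.
- apply: sub_sigma_algebra; exists (Some k) => //.
  by rewrite /F/=; case: k {nJk Dk} => i; exists A => //; rewrite setTI.
- exact: gauss_sigma_elim.
Qed.

Lemma indep_gauss_sigma J :
  indep Q (pair_fun X Y) (id : S -> g_sigma_algebraType (gauss_sigma J)).
Proof.
move=> A B mA mB; apply: (@indep_sigma [set None] (Some @` J)).
- by apply/seteqP; split => // _ [-> [j Jj]].
- by apply: sub_sigma_algebra; exists None => //; exists A => //; rewrite setTI.
- exact: gauss_sigma_elim.
Qed.

Lemma indep_gauss_sigma2 J1 J2 : J1 `&` J2 = set0 ->
  indep Q (id : S -> g_sigma_algebraType (gauss_sigma J1))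
          (id : S -> g_sigma_algebraType (gauss_sigma J2)).
Proof.
move=> J12 A B mA mB; apply: (@indep_sigma (Some @` J1) (Some @` J2)).
- apply/seteqP; split => // _ [[j Jj <-] [k Jk [kj]]].
  have : (J1 `&` J2) j by split => //; rewrite -kj.
  by rewrite J12.
- exact: gauss_sigma_elim.
- exact: gauss_sigma_elim.
Qed.

Lemma sigma_xiE : sigma_xi dim xi = gauss_sigma (range inl).
Proof.
congr (<<s _ >>); apply/seteqP; split => A.
  by move=> [i Di Ai]; exists (Some (inl i)) => //; split => //; exists (inl i) => //; exists i.
by move=> [_ [[_ [i _ <-] <-] Di] Ai]; exists i.
Qed.

Lemma sigma_etaE : sigma_eta dim' eta = gauss_sigma (range inr).
Proof.
congr (<<s _ >>); apply/seteqP; split => A.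
  by move=> [i Di Ai]; exists (Some (inr i)) => //; split => //; exists (inr i) => //; exists i.
by move=> [_ [[_ [i _ <-] <-] Di] Ai]; exists i.
Qed.

Lemma gauss_sigmaS J J' : J `<=` J' -> gauss_sigma J `<=` gauss_sigma J'.
Proof.
move=> JJ'; apply: smallest_sub; first exact: smallest_sigma_algebra.
move=> A [k [[j Jj <-] Dk] Ak]; apply: sub_sigma_algebra.
by exists (Some j) => //; split => //; exists j => //; exact: JJ'.
Qed.

Lemma sigma_xi_etaE : sigma_xi_eta dim xi dim' eta = gauss_sigma setT.
Proof.
rewrite /sigma_xi_eta sigma_xiE sigma_etaE; apply/seteqP; split.
  apply: smallest_sub; first exact: smallest_sigma_algebra.
  by move=> A [|]; apply: gauss_sigmaS.
apply: smallest_sub; first exact: smallest_sigma_algebra.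
move=> A [_ [[[i|i] _ <-] Di] Ai]; apply: sub_sigma_algebra; [left|right];
  by apply: sub_sigma_algebra; eexists; [split; [eexists; [exists i|]|exact: Di]|].
Qed.

End gaussian_family.

(** * Finite Gaussian sums *)

Section gaussian_sums.
Context (R : realType) (H H' : hilbertType R).
Context dS (S : measurableType dS) (Q : probability S R).
Variables (X : {RV Q >-> borel H}) (Y : {RV Q >-> borel H'}).
Variables (dim : option nat) (xi : nat -> {RV Q >-> R}).
Variables (dim' : option nat) (eta : nat -> {RV Q >-> R}).
Hypothesis gs : gaussian_setup X Y dim xi dim' eta.
Local Notation Z := (gauss_var xi eta).

Lemma measurable_cos_affine (c p : R) : measurable_fun setT (fun x : R => cos (c * x + p)).
Proof.
apply: continuous_measurable_fun => x; apply: continuous_comp; last exact: continuous_cos.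
by apply: cvgD; [apply: cvgM; [exact: cvg_cst|exact: cvg_id]|exact: cvg_cst].
Qed.

(** Induction on the list, splitting off one variable independent of the remaining sum. The phase p
    is general because the induction hypothesis is applied at shifted phases. *)
Lemma Rintegral_cos_gauss (s : seq (nat + nat)) (c : nat + nat -> R) (p : R) :
  uniq s -> (forall k, k \in s -> gauss_index dim dim' k) ->
  \int[Q]_w cos (\sum_(k <- s) c k * Z k w + p) =
  cos p * expR (- ((\sum_(k <- s) c k ^+ 2) / 2)).
Proof.
elim: s p => [|k s IH] p.
  move=> _ _; under eq_Rintegral do rewrite big_nil add0r.
  by rewrite Rintegral_probability_cst big_nil mul0r oppr0 expR0 mulr1.
move=> /= /andP[ks us] sD.
have Dk : gauss_index dim dim' k by apply: sD; exact: mem_head.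
have sD' j : j \in s -> gauss_index dim dim' j by move=> js; apply: sD; rewrite inE js orbT.
pose T (w : S) := \sum_(j <- s) c j * Z j w.
pose J : set (nat + nat) := [set j | j \in s].
have mT : measurable_fun setT (T : g_sigma_algebraType (gauss_sigma X Y dim xi dim' eta J) -> R).
  have msum (s' : seq (nat + nat)) : {subset s' <= s} ->
      measurable_fun setT ((fun w => \sum_(j <- s') c j * Z j w)
        : g_sigma_algebraType (gauss_sigma X Y dim xi dim' eta J) -> R).
    elim: s' => [|j s' IHs] ss'.
      by under eq_fun do rewrite big_nil; exact: measurable_cst.
    have js : j \in s by apply: ss'; exact: mem_head.
    under eq_fun do rewrite big_cons.
    apply: measurable_funD; last by apply: IHs => i is'; apply: ss'; rewrite inE is' orbT.
    apply: measurable_funM; first exact: measurable_cst.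
    by apply: measurable_gauss_var; [exact: js|exact: sD'].
  exact: msum.
have mTS : measurable_fun setT T.
  have mid := measurable_id_sub_sigma (sigma_algebra_gauss_sigma X Y dim xi dim' eta J)
    (@gauss_sigma_measurable _ _ _ _ _ _ X Y dim xi dim' eta J).
  exact: (measurableT_comp mT mid).
have mZ : measurable_fun setT (Z k) by [].
have ind : indep Q T (Z k).
  have nJk : ~ J k by rewrite /J/= (negbTE ks).
  have mI : measurable_fun setT (@id R) by exact: measurable_id.
  exact/indepC/(indep_comp mI mT (indep_gauss_var gs nJk Dk)).
have bcos (f : S -> R) : measurable_fun setT (fun w => cos (f w)) ->
    Q.-integrable setT (EFin \o (fun w => cos (f w))).
  move=> mf; apply: (@integrable_bounded _ _ _ _ _ 1) => // w.
  by rewrite ler_norml cos_geN1 cos_le1.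
have mcT q : measurable_fun setT (fun w => cos (1 * T w + q)).
  exact: (measurableT_comp (measurable_cos_affine 1 q) mTS).
have mcZ q : measurable_fun setT (fun w => cos (c k * Z k w + q)).
  exact: (measurableT_comp (measurable_cos_affine (c k) q) mZ).
(* Sine is written as cosine with phase -pi/2, so the addition formula involves cosines only; the
   second product vanishes because the single normal variable contributes the factor cos(-pi/2) =
   0. *)
pose h : R := pi / 2.
transitivity (\int[Q]_w (cos (1 * T w + p) * cos (c k * Z k w + 0) -
    cos (1 * T w + (p - h)) * cos (c k * Z k w + - h))).
  apply: eq_Rintegral => w _; rewrite big_cons -addrA cosD !mul1r addr0 [T w + (p - h)]addrA.
  have sE x : cos (x - h) = sin x by rewrite cosB cos_pihalf sin_pihalf mulr0 mulr1 add0r.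
  by rewrite !sE mulrC [X in _ - X]mulrC.
have iM q q' : Q.-integrable setT (EFin \o
    (fun w => cos (1 * T w + q) * cos (c k * Z k w + q'))).
  exact: (integrableM_indep mTS mZ ind (measurable_cos_affine 1 q)
    (measurable_cos_affine (c k) q') (bcos _ (mcT q)) (bcos _ (mcZ q'))).
have EM q q' : \int[Q]_w (cos (1 * T w + q) * cos (c k * Z k w + q')) =
    (\int[Q]_w cos (1 * T w + q)) * (\int[Q]_w cos (c k * Z k w + q')).
  exact: (RintegralM_indep mTS mZ ind (measurable_cos_affine 1 q)
    (measurable_cos_affine (c k) q') (bcos _ (mcT q)) (bcos _ (mcZ q'))).
rewrite RintegralB// !EM !(standard_normal_cos (gauss_var_normal gs Dk)).
rewrite cosN cos_pihalf cos0 mul0r mulr0 subr0 mul1r.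
under eq_Rintegral do rewrite mul1r.
rewrite IH// -mulrA -expRD big_cons; congr (_ * expR _); ring.
Qed.

End gaussian_sums.

(** * Kolmogorov's maximal inequality and convergence theorem *)

Section kolmogorov.
Context d (S : measurableType d) (R : realType) (Q : probability S R).
Variables (a : nat -> R) (Z : nat -> S -> R) (G : nat -> set (set S)) (v : R).
Hypothesis sG : forall n, sigma_algebra setT (G n).
Hypothesis Gm : forall n, G n `<=` measurable.
Local Notation SG n := (g_sigma_algebraType (G n)).
Hypothesis mZ : forall n, measurable_fun setT (Z n).
Hypothesis mZG : forall n i, (i < n)%N -> measurable_fun setT (Z i : SG n -> R).
Hypothesis ZG : forall n, indep Q (Z n) (id : S -> SG n).
Hypothesis iZ2 : forall n, Q.-integrable setT (EFin \o (fun w => Z n w ^+ 2)).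
Hypothesis EZ : forall n, \int[Q]_w Z n w = 0.
Hypothesis vZ : forall n, \int[Q]_w (Z n w ^+ 2) <= v.

Let iZ n : Q.-integrable setT (EFin \o Z n).
Proof.
apply: (@integrable_le _ _ _ Q _ (fun w => 1 + Z n w ^+ 2)) => //.
  by apply: integrableD_EFin => //; exact: integrable_probability_cst.
move=> w; rewrite -[Z n w ^+ 2]real_normK ?num_real//.
by have := normr_ge0 (Z n w); nra.
Qed.

Section maximal_inequality.
Variables (m : nat) (eps : R).
Hypothesis eps0 : 0 < eps.

Let T n (w : S) : R := \sum_(m <= k < m + n) a k * Z k w.

Let chi (t : R) : R := (`|t| <= eps)%R%:R.

(* [B n] is the indicator of the event that the partial sums have not left
   [-eps, eps] up to time n; the stopped sums [V n] keep orthogonal increments. *)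
Fixpoint not_stopped n (w : S) : R :=
  if n is n'.+1 then not_stopped n' w * chi (T n w) else 1.
Local Notation B := not_stopped.

Let V n (w : S) : R := \sum_(k < n) B k w * (a (m + k)%N * Z (m + k)%N w).

Let T0 w : T 0 w = 0. Proof. by rewrite /T addn0 big_geq. Qed.

Let TS n w : T n.+1 w = T n w + a (m + n)%N * Z (m + n)%N w.
Proof. by rewrite /T addnS big_nat_recr ?leq_addr. Qed.

Let VS n w : V n.+1 w = V n w + B n w * (a (m + n)%N * Z (m + n)%N w).
Proof. by rewrite /V big_ord_recr. Qed.

(** Before leaving [-eps, eps] the stopped sum is the true sum; after leaving it stays frozen at the
    first value outside. *)
Let stopped_inv n w : [/\ B n w = 1, V n w = T n w & `|T n w| <= eps] \/
  B n w = 0 /\ eps < `|V n w|.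
Proof.
elim: n => [|n [[Bn Vn Tn]|[Bn Vn]]].
- by left; rewrite /V big_ord0 T0 normr0; split => //; exact: ltW.
- have VT : V n.+1 w = T n.+1 w by rewrite VS TS Bn Vn mul1r.
  rewrite VT /= Bn mul1r /chi; case: leP => H; last by right.
  by left.
- by right; rewrite VS /= Bn !mul0r addr0.
Qed.

Let mchi : measurable_fun setT chi.
Proof.
rewrite (_ : chi = \1_(`[- eps, eps]%classic)).
  by apply: measurable_indic; exact: measurable_itv.
by apply/funext => t; rewrite indicE /chi ler_norml mem_setE in_itv.
Qed.

Let mTG n j : (j <= n)%N -> measurable_fun setT (T j : SG (m + n) -> R).
Proof.
elim: j => [|j IH] jn.
  by rewrite (_ : T 0 = cst 0); [exact: measurable_cst|apply/funext => w; exact: T0].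
rewrite (_ : T j.+1 = fun w => T j w + a (m + j)%N * Z (m + j)%N w); last first.
  by apply/funext => w; exact: TS.
apply: measurable_funD; first by apply: IH; exact: ltnW.
apply: measurable_funM; first exact: measurable_cst.
by apply: mZG; rewrite ltn_add2l.
Qed.

Let mBG n j : (j <= n)%N -> measurable_fun setT (B j : SG (m + n) -> R).
Proof.
elim: j => [|j IH] jn; first exact: measurable_cst.
apply: measurable_funM; first by apply: IH; exact: ltnW.
by apply: (measurableT_comp mchi); exact: mTG.
Qed.

Let mVG n j : (j <= n)%N -> measurable_fun setT (V j : SG (m + n) -> R).
Proof.
elim: j => [|j IH] jn.
  by rewrite (_ : V 0 = cst 0); [exact: measurable_cst|apply/funext => w; exact: big_ord0].
rewrite (_ : V j.+1 = fun w => V j w + B j w * (a (m + j)%N * Z (m + j)%N w)); last first.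
  by apply/funext => w; exact: VS.
apply: measurable_funD; first by apply: IH; exact: ltnW.
apply: measurable_funM; first by apply: mBG; exact: ltnW.
apply: measurable_funM; first exact: measurable_cst.
by apply: mZG; rewrite ltn_add2l.
Qed.

Let mid n := measurable_id_sub_sigma (sG n) (@Gm n).

(** The cross term is the expectation of V B times that of Z_n, which is zero, because V B depends
    on earlier variables only. V B is bounded by eps, since B vanishes once the sum has left the
    interval. *)
Let V_sqr n : Q.-integrable setT (EFin \o (fun w => V n w ^+ 2)) /\
  \int[Q]_w (V n w ^+ 2) <= v * \sum_(m <= k < m + n) a k ^+ 2.
Proof.
elim: n => [|n [iV IH]].
  rewrite (_ : (fun w => V 0 w ^+ 2) = fun=> 0); last first.
    by apply/funext => w; rewrite /V big_ord0 expr0n.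
  split; first exact: integrable_probability_cst.
  by rewrite Rintegral_probability_cst addn0 big_geq// mulr0.
set an := a (m + n)%N; pose Zn := Z (m + n)%N.
have B01 w : B n w = 0 \/ B n w = 1.
  by have [[]|[]] := stopped_inv n w; [right|left].
pose VB (w : S) := V n w * B n w.
have mB : measurable_fun setT (B n : SG (m + n) -> R) by exact: mBG.
have mVB : measurable_fun setT (VB : SG (m + n) -> R).
  by apply: measurable_funM; [exact: mVG|exact: mBG].
have VBe w : `|VB w| <= eps.
  rewrite /VB; have [[-> -> ?]|[-> _]] := stopped_inv n w; first by rewrite mulr1.
  by rewrite mulr0 normr0 ltW.
have iVB : Q.-integrable setT (EFin \o VB).
  by apply: (@integrable_bounded _ _ _ _ _ eps) => //; exact: (measurableT_comp mVB (@mid _)).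
have iB : Q.-integrable setT (EFin \o B n).
  apply: (@integrable_bounded _ _ _ _ _ 1); first exact: (measurableT_comp mB (@mid _)).
  by move=> w; case: (B01 w) => ->; rewrite ?normr0 ?normr1.
have indZ := indepC (@ZG (m + n)%N).
have mI : measurable_fun setT (@id R) by exact: measurable_id.
have msq : measurable_fun setT (fun x : R => x ^+ 2) by exact: measurable_funX.
have iVBZ := integrableM_indep (@mid _) (mZ _) indZ mVB mI iVB (@iZ _).
have EVBZ := RintegralM_indep (@mid _) (mZ _) indZ mVB mI iVB (@iZ _).
have iBZ := integrableM_indep (@mid _) (mZ _) indZ mB msq iB (@iZ2 _).
have EBZ := RintegralM_indep (@mid _) (mZ _) indZ mB msq iB (@iZ2 _).
have VE w : V n.+1 w ^+ 2 =
    V n w ^+ 2 + (2 * an) * (VB w * Zn w) + an ^+ 2 * (B n w * Zn w ^+ 2).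
  rewrite VS /VB -/an -/Zn; case: (B01 w) => ->; ring.
have i1 : Q.-integrable setT (EFin \o (fun w => V n w ^+ 2 + (2 * an) * (VB w * Zn w))).
  by apply: integrableD_EFin => //; exact: integrableZ_EFin.
have i2 : Q.-integrable setT (EFin \o (fun w => an ^+ 2 * (B n w * Zn w ^+ 2))).
  exact: integrableZ_EFin.
split.
  by rewrite (funext VE); exact: integrableD_EFin.
under eq_Rintegral do rewrite VE.
rewrite RintegralD// RintegralD//; last exact: integrableZ_EFin.
rewrite !RintegralZl// EVBZ EBZ EZ !mulr0 addr0 addnS big_nat_recr ?leq_addr//=.
rewrite mulrDr lerD// mulrC -/an; apply: ler_wpM2r; first exact: sqr_ge0.
have EB1 : \int[Q]_w B n w <= 1.
  rewrite -[leRHS](Rintegral_probability_cst Q); apply: le_Rintegral => //.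
    exact: integrable_probability_cst.
  by move=> w _; case: (B01 w) => ->.
have EZ0 : 0 <= \int[Q]_w (Z (m + n)%N w ^+ 2).
  by apply: Rintegral_ge0 => w _; exact: sqr_ge0.
by apply: le_trans (vZ (m + n)%N); rewrite -[leRHS]mul1r ler_wpM2r.
Qed.

Let mBS n : measurable_fun setT (B n).
Proof. by apply: (measurableT_comp (mBG (leqnn n)) (@mid _)). Qed.

Let leave n : set S := [set w | B n w = 0].

Let mleave n : measurable (leave n).
Proof. exact: (measurable_preimage (mBS n) (measurable_set1 0)). Qed.

Let leave_prob n :
  (Q (leave n) <= (v / eps ^+ 2 * \sum_(m <= k < m + n) a k ^+ 2)%:E)%E.
Proof.
have e2 : 0 < eps ^+ 2 by rewrite exprn_gt0.
have [iV EV] := V_sqr n.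
rewrite EFin_probability// lee_fin.
have -> : fine (Q (leave n)) = \int[Q]_w \1_(leave n) w.
  by rewrite /Rintegral integral_indic// setIT.
have iV' : Q.-integrable setT (EFin \o (fun w => (eps ^+ 2)^-1 * V n w ^+ 2)).
  exact: integrableZ_EFin.
apply: (@le_trans _ _ (\int[Q]_w ((eps ^+ 2)^-1 * V n w ^+ 2))).
  apply: le_Rintegral => //.
    apply: (@integrable_bounded _ _ _ _ _ 1); first exact: measurable_indic.
    by move=> w; rewrite indicE; case: (_ \in _); rewrite ?normr0 ?normr1.
  move=> w _; have V2 : 0 <= (eps ^+ 2)^-1 * V n w ^+ 2.
    by rewrite mulr_ge0 ?sqr_ge0// invr_ge0 ltW.
  rewrite indicE; case: (boolP (w \in _)) => //; rewrite inE => Bn.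
  have [[Bn1 _ _]|[_ Vn]] := stopped_inv n w.
    by move: Bn1; rewrite Bn => /eqP; rewrite eq_sym oner_eq0.
  rewrite mulrC ler_pdivlMr// mul1r -[V n w ^+ 2]real_normK ?num_real//.
  by rewrite lerXn2r ?nnegrE// ltW.
rewrite RintegralZl// [leRHS](_ : _ = (eps ^+ 2)^-1 * (v * \sum_(m <= k < m + n) a k ^+ 2)).
  by rewrite ler_pM2l// invr_gt0.
by rewrite mulrCA mulrA.
Qed.

(** Leaving by time n forces |V n| > eps, so Chebyshev's inequality and [V_sqr] bound its
    probability uniformly in n. The events increase with n, so their union inherits the bound. *)
Lemma kolmogorov_maximal (r : R) :
  (forall n, v / eps ^+ 2 * \sum_(m <= k < m + n) a k ^+ 2 <= r) ->
  measurable [set w | exists n, eps < `|\sum_(m <= k < m + n) a k * Z k w|] /\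
  (Q [set w | exists n, (eps < `|\sum_(m <= k < m + n) a k * Z k w|)%R] <= r%:E)%E.
Proof.
move=> ar.
have stop0 n w : B n w = 0 -> forall j, (n <= j)%N -> B j w = 0.
  move=> Bn j /subnK <-; elim: (j - n)%N => [//|i IH].
  by rewrite addSn /= IH mul0r.
have -> : [set w | exists n, eps < `|\sum_(m <= k < m + n) a k * Z k w|] =
    \bigcup_n leave n.
  apply/seteqP; split => w /=.
    move=> [n Tn]; exists n => //=.
    by have [[_ _ H]|[Bn _]] := stopped_inv n w; [move: H; rewrite leNgt Tn|exact: Bn].
  (* At the first time j with B j = 0, which is not 0 since B 0 = 1, the last factor [chi] vanishes,
     so the sum at time j is outside the interval. *)
  move=> [n _ /= Bn]; have [j] := ex_minnP (ex_intro (fun j => B j w == 0) n (introT eqP Bn)).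
  move=> /eqP Bj minj; exists j.
  case: j Bj minj => [/eqP|j]; first by rewrite oner_eq0.
  rewrite /= => /eqP; rewrite mulf_eq0 => /orP[Bj /(_ _ Bj)|]; first by rewrite ltnn.
  by rewrite /chi pnatr_eq0; case: leP.
split; first exact: bigcup_measurable.
have mono : nondecreasing_seq leave.
  by move=> i j ij; apply/subsetPset => w /= Bi; exact: stop0 Bi _ ij.
have cv := @nondecreasing_cvg_mu _ _ _ Q _ mleave (bigcup_measurable (fun k _ => mleave k)) mono.
rewrite -(cvg_lim _ cv)//; apply: lime_le; first by apply/cvg_ex; eexists; exact: cv.
by apply: nearW => n; apply: le_trans (leave_prob n) _; rewrite lee_fin.
Qed.

End maximal_inequality.

(** The tails of the sum of a_k^2 tend to 0, so by the maximal inequality the event that for every m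
    some partial sum started at m exceeds 1/(p+1) is null. Outside the countable union over p the
    series is Cauchy. *)
Lemma kolmogorov_cvg (C : R) : (forall n, \sum_(0 <= k < n) a k ^+ 2 <= C) ->
  {ae Q, forall w, cvgn (fun n => \sum_(0 <= k < n) a k * Z k w)}.
Proof.
move=> aC.
have v0 : 0 <= v.
  by apply: le_trans (vZ 0); apply: Rintegral_ge0 => w _; exact: sqr_ge0.
pose s n := \sum_(0 <= k < n) a k ^+ 2.
have cs : cvgn s.
  apply: nondecreasing_is_cvgn; last by exists C => _ [n _ <-]; exact: aC.
  move=> i j ij; rewrite /s (big_cat_nat (leq0n i) ij)/= lerDl.
  by apply: sumr_ge0 => k _; exact: sqr_ge0.
have tail (e : R) : 0 < e -> exists m, forall n, \sum_(m <= k < m + n) a k ^+ 2 <= e.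
  move=> e0; have /cvgrPdist_le/(_ _ e0)[m _ Hm] := cs.
  have lims n : s n <= limn s.
    apply: nondecreasing_cvgn_le => // i j ij.
    rewrite /s (big_cat_nat (leq0n i) ij)/= lerDl.
    by apply: sumr_ge0 => k _; exact: sqr_ge0.
  exists m => n; have := Hm m (leqnn m) => /=.
  have := lims (m + n)%N; rewrite /s (big_cat_nat (leq0n m) (leq_addr n m))/= -/(s m).
  by rewrite ler_norml; lra.
pose A m (eps : R) : set S :=
  [set w | exists n, eps < `|\sum_(m <= k < m + n) a k * Z k w|].
pose N p := \bigcap_m A m (p.+1%:R^-1).
have part m n : \sum_(m <= k < m + n) a k ^+ 2 <= C.
  apply: le_trans (aC (m + n)%N); rewrite (big_cat_nat (leq0n m) (leq_addr n m))/= lerDr.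
  by apply: sumr_ge0 => k _; exact: sqr_ge0.
have ve (eps : R) : 0 < eps -> 0 <= v / eps ^+ 2.
  by move=> eps0; rewrite divr_ge0// exprn_ge0// ltW.
have mA m (eps : R) : 0 < eps -> measurable (A m eps).
  move=> eps0; have [] := @kolmogorov_maximal m eps eps0 (v / eps ^+ 2 * C) => // n.
  by rewrite ler_wpM2l// ve.
have pp p : (0 : R) < p.+1%:R^-1 by [].
have mN p : measurable (N p) by apply: bigcap_measurable => // m _; exact: mA.
have N0 p : Q (N p) = 0%E.
  apply/eqP; rewrite -measure_le0; apply/lee_addgt0Pr => e e0; rewrite add0e.
  (* Adding 1 keeps the denominator positive when [v] is zero. *)
  have ed : 0 < e / (v / p.+1%:R^-1 ^+ 2 + 1) by rewrite divr_gt0// ltr_pwDr// ve.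
  have [m Hm] := tail _ ed.
  have He n : v / p.+1%:R^-1 ^+ 2 * \sum_(m <= k < m + n) a k ^+ 2 <= e.
    apply: le_trans (ler_wpM2l (ve _ (pp p)) (Hm n)) _.
    rewrite mulrCA ler_piMr ?(ltW e0)// ler_pdivrMr ?mul1r ?lerDl//.
    by rewrite ltr_pwDr// ve.
  have [_ +] := kolmogorov_maximal (pp p) He.
  apply: le_trans; apply: le_measure; rewrite ?inE//; first exact: mA.
  by move=> w /(_ m I).
apply: (@negligibleS _ _ _ Q (\bigcup_p N p)); last first.
  by apply: negligible_bigcup => p; exists (N p); split => //; exact: N0.
move=> w /= nC; apply: contrapT => nN; apply: nC.
apply/cauchy_cvgP/cauchy_seriesP => e e0.
(* A sum from i to j is the difference of two sums started at m, whence the factor 2. *)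
have [p pe] : exists p, 2 * p.+1%:R^-1 < e.
  have e2 : 0 < e / 2 by rewrite divr_gt0.
  have [p _ /(_ p (leqnn p))/= pe] := near_infty_natSinv_lt (PosNum e2).
  by exists p; rewrite mulrC -ltr_pdivlMr.
have [m Hm] : exists m, forall n, `|\sum_(m <= k < m + n) a k * Z k w| <= p.+1%:R^-1.
  apply: contrapT => nm; apply: nN; exists p => // m _.
  apply: contrapT => nA; apply: nm; exists m => n; rewrite leNgt; apply/negP => H.
  by apply: nA; exists n.
have big i j : (m <= i)%N -> `|\sum_(i <= k < j) a k * Z k w| < e.
  move=> mi; have [ij|ji] := leqP i j; last by rewrite big_geq ?normr0// ltnW.
  apply: le_lt_trans pe.
  have := Hm (i - m)%N; have := Hm (j - m)%N; rewrite !subnKC//; last exact: leq_trans ij.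
  rewrite (big_cat_nat mi ij)/= => H1 H2.
  rewrite -[X in `|X|](addKr (\sum_(m <= k < i) a k * Z k w)).
  by apply: le_trans (ler_normD _ _) _; rewrite normrN mulr2n mulrDl mul1r lerD.
exists ([set i | (m <= i)%N], setT).
  by split; [exists m|exact: filterT].
by move=> [i j] [/= mi _]; exact: big.
Qed.

End kolmogorov.

(** * Measurability of pointwise limits *)

Section measurable_limit.
Context d (T : measurableType d) (R : realType) (u : nat -> T -> R).
Hypothesis mu : forall n, measurable_fun setT (u n).

Lemma cvgn_cauchyE (v : nat -> R) :
  cvgn v <-> forall p, exists m, forall n, `|v (m + n)%N - v m| <= p.+1%:R^-1.
Proof.
split=> [cv p|H].
  have e0 : 0 < (p.+1%:R : R)^-1 / 2 by rewrite divr_gt0.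
  have /cvgrPdist_le/(_ _ e0)[m _ Hm] := cv.
  exists m => n; have := Hm _ (leq_addr n m); have := Hm _ (leqnn m) => /=.
  rewrite !ler_norml; move: (_^-1) => e; move: (v _) (v _) (limn v) => a b c.
  by move=> /andP[? ?] /andP[? ?]; apply/andP; split; lra.
apply/cauchy_cvgP/cauchy_exP => e e0.
have [p _ /(_ p (leqnn p))/= pe] := near_infty_natSinv_lt (PosNum e0).
have [m Hm] := H p; exists (v m); exists m => // n /= mn.
have := Hm (n - m)%N; rewrite subnKC// /ball/= distrC => /le_lt_trans; exact.
Qed.

Let C : set T := [set x | cvgn (u ^~ x)].

Let mC : measurable C.
Proof.
rewrite (_ : C = \bigcap_p \bigcup_m \bigcap_n
    [set x | `|u (m + n)%N x - u m x| <= p.+1%:R^-1]).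
  apply: bigcap_measurable => // p _; apply: bigcup_measurable => m _.
  apply: bigcap_measurable => // n _.
  rewrite (_ : [set x | _] = (fun x => `|u (m + n)%N x - u m x|) @^-1` `]-oo, p.+1%:R^-1]).
    apply: measurable_preimage; last exact: measurable_itv.
    by apply: measurableT_comp => //; exact: measurable_funB.
  by apply/seteqP; split => x /=; rewrite in_itv.
apply/seteqP; split => x /=.
  by move=> /cvgn_cauchyE H p _; have [m Hm] := H p; exists m => // n _; exact: Hm.
move=> H; apply/cvgn_cauchyE => p; have [m _ Hm] := H p I.
by exists m => n; exact: Hm.
Qed.

(** Where the sequence diverges, [limn] returns the default [point]. Replacing the sequence there by
    this constant gives measurable functions that converge everywhere to the same value; the
    convergence set is measurable by the Cauchy criterion. *)
Lemma measurable_limn : measurable_fun setT (fun x => limn (u ^~ x)).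
Proof.
pose h n (x : T) : R := u n x * \1_C x + (@point R : R) * (1 - \1_C x).
have mh n : measurable_fun setT (h n).
  have m1 : measurable_fun setT (\1_C : T -> R) by exact: measurable_indic.
  by apply: measurable_funD; apply: measurable_funM => //; exact: measurable_funB.
apply: (measurable_fun_cvg mh) => x _; rewrite /h indicE.
have [/set_mem Cx|nC] := boolP (x \in C).
  by under eq_fun do rewrite mulr1 subrr mulr0 addr0.
under eq_fun do rewrite mulr0 subr0 mulr1 add0r.
rewrite /lim /lim_in xgetPN; first exact: cvg_cst.
by move=> l ul; move/negP: nC; apply; apply/mem_set/cvg_ex; exists l.
Qed.

End measurable_limit.

(** * Bessel's inequality and Parseval's identity *)

Section bessel.
Context (R : realType) (K : hilbertType R) (dm : option nat) (b : nat -> K).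
Hypothesis bb : orthonormal_basis dm b.

Definition fourier_sqr (x : K) n : R := \sum_(0 <= i < n | in_dim dm i) inner x (b i) ^+ 2.

Let sum_recr (V : zmodType) (F : nat -> V) n :
  \sum_(0 <= i < n.+1 | in_dim dm i) F i =
  \sum_(0 <= i < n | in_dim dm i) F i + if in_dim dm n then F n else 0.
Proof. by rewrite [LHS]big_mkcond big_nat_recr//= -big_mkcond. Qed.

Let inner_span (c : nat -> R) n j : (n <= j)%N -> in_dim dm j ->
  inner (\sum_(0 <= i < n | in_dim dm i) c i *: b i) (b j) = 0.
Proof.
elim: n => [|n IH] nj dj; first by rewrite big_geq// -(scale0r 0) innerZl mul0r.
rewrite sum_recr innerDl IH ?(ltnW nj)// add0r.
case: ifP => dn; last by rewrite -(scale0r 0) innerZl mul0r.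
by rewrite innerZl bb.1// ltn_eqF// mulr0.
Qed.

Lemma dist_span_sqr (x : K) n (c : nat -> R) :
  `|x - \sum_(0 <= i < n | in_dim dm i) c i *: b i| ^+ 2 =
  `|x| ^+ 2 - fourier_sqr x n + \sum_(0 <= i < n | in_dim dm i) (c i - inner x (b i)) ^+ 2.
Proof.
elim: n => [|n IH]; first by rewrite /fourier_sqr !big_geq// !subr0 addr0.
rewrite /fourier_sqr !sum_recr -/(fourier_sqr x n); case: ifP => dn; last by rewrite !addr0.
rewrite opprD addrA sqr_normB IH innerZr innerDl innerNl inner_span// subr0.
rewrite normrZ exprMn real_normK ?num_real// -[`|b n| ^+ 2]inner_norm bb.1// eqxx mulr1.
by move: (fourier_sqr x n) (c n) (inner x (b n)) => p q r; ring.
Qed.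

Lemma fourier_sqr_le (x : K) n : fourier_sqr x n <= `|x| ^+ 2.
Proof.
rewrite -subr_ge0.
have := sqr_ge0 `|x - \sum_(0 <= i < n | in_dim dm i) inner x (b i) *: b i|.
rewrite dist_span_sqr big1 ?addr0// => i _.
by rewrite subrr expr0n.
Qed.

Lemma fourier_sqr_nondecreasing (x : K) : nondecreasing_seq (fourier_sqr x).
Proof.
move=> i j ij; rewrite /fourier_sqr (big_cat_nat (leq0n i) ij)/= lerDl.
by apply: sumr_ge0 => k _; exact: sqr_ge0.
Qed.

(** Some element of the span is close to x by density, and by [dist_span_sqr] the Fourier partial
    sum of the same length is at least as close. *)
Lemma fourier_sqr_cvg (x : K) : fourier_sqr x n @[n --> \oo] --> `|x| ^+ 2.
Proof.
apply/cvgrPdist_le => e e0.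
have : closure (lin_span dm b) x by rewrite bb.2.
pose d := Num.sqrt e; have d0 : 0 < d by rewrite sqrtr_gt0.
move=> /(_ _ (nbhsx_ballx x d d0)) [y [[m [c ->]]]].
rewrite -ball_normE /= => xd.
near=> n.
have mn : (m <= n)%N by near: n; exact: nbhs_infty_ge.
rewrite ger0_norm ?subr_ge0 ?fourier_sqr_le//.
apply: (@le_trans _ _ (`|x| ^+ 2 - fourier_sqr x m)).
  by rewrite lerB// fourier_sqr_nondecreasing.
apply: (@le_trans _ _ (d ^+ 2)); last by rewrite sqr_sqrtr// ltW.
apply: (@le_trans _ _ (`|x - \sum_(0 <= i < m | in_dim dm i) c i *: b i| ^+ 2)).
  by rewrite dist_span_sqr lerDl; apply: sumr_ge0 => k _; exact: sqr_ge0.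
by rewrite lerXn2r ?nnegrE// ltW.
Unshelve. all: end_near. Qed.

End bessel.

(** * Almost sure convergence of Gaussian series *)

Lemma indep_cst d (S : measurableType d) (R : realType) (Q : probability S R)
    dA (A : measurableType dA) dB (B : measurableType dB) (a : A) (V : S -> B) :
  indep Q (fun=> a) V.
Proof.
move=> C D _ _; have [aC|aC] := pselect (C a).
  rewrite (_ : _ @^-1` C = setT); last by apply/seteqP; split.
  by rewrite setTI [X in _ = (X * _)%E]probability_setT mul1e.
rewrite (_ : _ @^-1` C = set0); last by apply/seteqP; split.
by rewrite set0I measure0 mul0e.
Qed.

Section gaussian_series.
Context (R : realType) (H H' : hilbertType R).
Context dS (S : measurableType dS) (Q : probability S R).
Variables (X : {RV Q >-> borel H}) (Y : {RV Q >-> borel H'}).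
Variables (dim : option nat) (xi : nat -> {RV Q >-> R}).
Variables (dim' : option nat) (eta : nat -> {RV Q >-> R}).
Hypothesis gs : gaussian_setup X Y dim xi dim' eta.
Local Notation SG J := (g_sigma_algebraType (gauss_sigma X Y dim xi dim' eta J)).

Variables (K : hilbertType R) (dm : option nat) (b : nat -> K) (g : nat -> {RV Q >-> R}).
Variable emb : nat -> nat + nat.
Hypotheses (emb_inj : injective emb) (embE : forall i, gauss_var xi eta (emb i) = g i).
Hypothesis embD : forall i, gauss_index dim dim' (emb i) = in_dim dm i.

Definition gauss_partial (x : K) n (w : S) : R :=
  \sum_(0 <= i < n | in_dim dm i) inner x (b i) * g i w.

Lemma measurable_gauss_partial J n : (forall i, in_dim dm i -> J (emb i)) ->
  measurable_fun setT (fun z : borel K * SG J => gauss_partial z.1 n z.2).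
Proof.
move=> JD; pose F i (z : borel K * SG J) : R :=
  if in_dim dm i then inner (z.1 : K) (b i) * g i z.2 else 0.
rewrite (_ : (fun z => _) = fun z => \sum_(i <- index_iota 0 n) F i z); last first.
  by apply/funext => z; rewrite /gauss_partial big_mkcond.
apply: measurable_sum => i; rewrite /F; have [di|di] := boolP (in_dim dm i); last exact: measurable_cst.
apply: measurable_funM.
  exact: (measurableT_comp (measurable_inner (b i)) measurable_fst).
have Dk : gauss_index dim dim' (emb i) by rewrite embD.
have := @measurable_gauss_var _ _ _ _ _ _ X Y dim xi dim' eta J (emb i) (JD _ di) Dk.
rewrite embE => mg; exact: (measurableT_comp mg measurable_snd).
Qed.

Lemma measurable_gauss_dot J : (forall i, in_dim dm i -> J (emb i)) ->
  measurable_fun setT (fun z : borel K * SG J => gauss_dot dm b g (z.1 : K) z.2).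
Proof.
move=> JD; apply: (@measurable_limn _ _ _
  (fun n (z : borel K * SG J) => gauss_partial z.1 n z.2)) => n.
exact: measurable_gauss_partial.
Qed.

(** Kolmogorov's theorem with coefficients <x, b_i>, square summable by Bessel. Indices beyond the
    dimension get zero variables, and [emb] places the basis index inside the joint Gaussian family,
    so that one proof serves xi and eta. *)
Lemma gauss_dot_cvg (x : K) : orthonormal_basis dm b ->
  {ae Q, forall w, gauss_partial x n w @[n --> \oo] --> gauss_dot dm b g x w}.
Proof.
move=> bb.
pose Z i (w : S) : R := if in_dim dm i then g i w else 0.
pose a i : R := if in_dim dm i then inner x (b i) else 0.
pose J n : set (nat + nat) := [set emb i | i in [set i | (i < n)%N]].
have ZE n w : \sum_(0 <= k < n) a k * Z k w = gauss_partial x n w.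
  rewrite /gauss_partial [RHS]big_mkcond; apply: eq_bigr => i _.
  by rewrite /a /Z; case: ifP => //; rewrite mul0r.
have sn i : in_dim dm i -> standard_normal (g i).
  by move=> di; rewrite -embE; apply: gauss_var_normal gs _ _; rewrite embD.
pose v := \int[@lebesgue_measure R]_x (x ^+ 2 * npdf x).
have vZ n : \int[Q]_w (Z n w ^+ 2) <= v.
  rewrite /Z; have [di|di] := boolP (in_dim dm n); first by rewrite (standard_normal_sqr (sn _ di)).
  under eq_Rintegral do rewrite expr0n/=.
  rewrite Rintegral_probability_cst; apply: Rintegral_ge0 => t _.
  by rewrite mulr_ge0 ?sqr_ge0 ?npdf_ge0.
have ae : forall C, (forall n, \sum_(0 <= k < n) a k ^+ 2 <= C) ->
  {ae Q, forall w, cvgn (fun n => \sum_(0 <= k < n) a k * Z k w)}.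
  move=> C; apply: (@kolmogorov_cvg _ _ _ Q a Z
    (fun n => gauss_sigma X Y dim xi dim' eta (J n)) v) => // n.
  - exact: sigma_algebra_gauss_sigma.
  - exact: gauss_sigma_measurable.
  - by rewrite /Z; case: (in_dim dm n) => //; exact: measurable_cst.
  - move=> i ij; rewrite /Z; have [di|di] := boolP (in_dim dm i); last exact: measurable_cst.
    have Dk : gauss_index dim dim' (emb i) by rewrite embD.
    rewrite -embE; apply: measurable_gauss_var => //; by exists i.
  - have [di|di] := boolP (in_dim dm n); last first.
      rewrite (_ : Z n = fun=> 0); first exact: indep_cst.
      by apply/funext => w; rewrite /Z (negbTE di).
    rewrite (_ : Z n = g n); last by apply/funext => w; rewrite /Z di.
    have Dk : gauss_index dim dim' (emb n) by rewrite embD.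
    have nJ : ~ J n (emb n) by move=> [i /= ij] /emb_inj ijE; rewrite ijE ltnn in ij.
    by rewrite -embE; exact: (indep_gauss_var gs nJ Dk).
  - rewrite /Z; have [di|di] := boolP (in_dim dm n).
      exact: integrable_standard_normal_sqr (sn _ di).
    by rewrite expr0n; exact: integrable_probability_cst.
  - rewrite /Z; have [di|di] := boolP (in_dim dm n); last exact: Rintegral_probability_cst.
    exact: standard_normal_mean (sn _ di).
have /ae : forall n, \sum_(0 <= k < n) a k ^+ 2 <= `|x| ^+ 2.
  move=> n; apply: le_trans (fourier_sqr_le bb x n).
  rewrite /fourier_sqr [leRHS]big_mkcond; apply: ler_sum => i _.
  by rewrite /a; case: ifP; rewrite ?expr0n.
apply: filterS => w; under eq_fun do rewrite ZE.
by [].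
Qed.

End gaussian_series.

(** * Characteristic function of the Gaussian series *)

Section gaussian_characteristic.
Context (R : realType) (H H' : hilbertType R).
Context dS (S : measurableType dS) (Q : probability S R).
Variables (X : {RV Q >-> borel H}) (Y : {RV Q >-> borel H'}).
Variables (dim : option nat) (xi : nat -> {RV Q >-> R}).
Variables (dim' : option nat) (eta : nat -> {RV Q >-> R}).
Hypothesis gs : gaussian_setup X Y dim xi dim' eta.
Variables (e : nat -> H) (e' : nat -> H').
Hypotheses (be : orthonormal_basis dim e) (be' : orthonormal_basis dim' e').
Local Notation SG J := (g_sigma_algebraType (gauss_sigma X Y dim xi dim' eta J)).
Local Notation gx := (gauss_dot dim e xi).
Local Notation gy := (gauss_dot dim' e' eta).

Let inlI : injective (@inl nat nat). Proof. by move=> i j []. Qed.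
Let inrI : injective (@inr nat nat). Proof. by move=> i j []. Qed.
Let inlE i : gauss_var xi eta (inl i) = xi i. Proof. by []. Qed.
Let inrE i : gauss_var xi eta (inr i) = eta i. Proof. by []. Qed.
Let inlD i : gauss_index dim dim' (inl i) = in_dim dim i. Proof. by []. Qed.
Let inrD i : gauss_index dim dim' (inr i) = in_dim dim' i. Proof. by []. Qed.

Lemma measurable_gauss_dotX J : range inl `<=` J ->
  measurable_fun setT (fun z : borel H * SG J => gx (z.1 : H) z.2).
Proof.
move=> JX; apply: (@measurable_gauss_dot _ _ _ _ _ _ X Y dim xi dim' eta H dim e xi inl inlE inlD) => i _.
by apply: JX; exists i.
Qed.

Lemma measurable_gauss_dotY J : range inr `<=` J ->
  measurable_fun setT (fun z : borel H' * SG J => gy (z.1 : H') z.2).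
Proof.
move=> JY; apply: (@measurable_gauss_dot _ _ _ _ _ _ X Y dim xi dim' eta H' dim' e' eta inr inrE inrD) => i _.
by apply: JY; exists i.
Qed.

Lemma measurable_idG J : measurable_fun setT (id : S -> SG J).
Proof.
exact: (measurable_id_sub_sigma (sigma_algebra_gauss_sigma X Y dim xi dim' eta J)
    (@gauss_sigma_measurable _ _ _ _ _ _ X Y dim xi dim' eta J)).
Qed.

Let mpx n x : measurable_fun setT (gauss_partial dim e xi x n).
Proof.
have := @measurable_gauss_partial _ _ _ _ _ _ X Y dim xi dim' eta _ dim e xi inl inlE inlD setT n.
move=> /(_ (fun i _ => I)) mg.
have := measurableT_comp mg (measurable_fun_pair (@measurable_cst _ _ S (borel H) setT x) (@measurable_idG setT)).
by [].
Qed.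

Let mpy n y : measurable_fun setT (gauss_partial dim' e' eta y n).
Proof.
have := @measurable_gauss_partial _ _ _ _ _ _ X Y dim xi dim' eta _ dim' e' eta inr inrE inrD setT n.
move=> /(_ (fun i _ => I)) mg.
have := measurableT_comp mg (measurable_fun_pair (@measurable_cst _ _ S (borel H') setT y) (@measurable_idG setT)).
by [].
Qed.

Let mgx x : measurable_fun setT (gx x : S -> R).
Proof.
have := measurableT_comp (@measurable_gauss_dotX setT (fun _ _ => I))
  (measurable_fun_pair (@measurable_cst _ _ S (borel H) setT x) (@measurable_idG setT)).
by [].
Qed.

Let mgy y : measurable_fun setT (gy y : S -> R).
Proof.
have := measurableT_comp (@measurable_gauss_dotY setT (fun _ _ => I))
  (measurable_fun_pair (@measurable_cst _ _ S (borel H') setT y) (@measurable_idG setT)).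
by [].
Qed.

(** The partial sums are finite Gaussian sums with known characteristic function. Dominated
    convergence passes to the series, and Parseval turns the partial variances into squared
    norms. *)
Lemma Rintegral_cos_gauss_dot (x a : H) (y b : H') (r s p : R) :
  \int[Q]_w cos (r * gx x w + gx a w + (s * gy y w + gy b w) + p) =
  cos p * (expR (- (`|r *: x + a| ^+ 2 / 2)) * expR (- (`|s *: y + b| ^+ 2 / 2))).
Proof.
pose px := gauss_partial dim e xi; pose py := gauss_partial dim' e' eta.
pose f n w := cos (r * px x n w + px a n w + (s * py y n w + py b n w) + p).
have fE n : \int[Q]_w f n w = cos p *
    expR (- ((fourier_sqr dim e (r *: x + a) n + fourier_sqr dim' e' (s *: y + b) n) / 2)).
  pose sx := [seq inl nat i | i <- index_iota 0 n & in_dim dim i].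
  pose sy := [seq inr nat i | i <- index_iota 0 n & in_dim dim' i].
  pose c (k : nat + nat) : R :=
    match k with inl i => inner (r *: x + a) (e i) | inr j => inner (s *: y + b) (e' j) end.
  have us : uniq (sx ++ sy).
    rewrite cat_uniq !map_inj_uniq// !filter_uniq ?iota_uniq//= andbT.
    by apply/hasPn => _ /mapP[j _ ->]; apply/negP => /mapP[].
  have sD k : k \in sx ++ sy -> gauss_index dim dim' k.
    by rewrite mem_cat => /orP[] /mapP[i]; rewrite mem_filter => /andP[di _] ->.
  have sumc (F : nat + nat -> R) : \sum_(k <- sx ++ sy) F k =
      \sum_(0 <= i < n | in_dim dim i) F (inl i) + \sum_(0 <= i < n | in_dim dim' i) F (inr i).
    by rewrite big_cat/= !big_map !big_filter.
  have := Rintegral_cos_gauss gs c p us sD; rewrite sumc => <-.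
  apply: eq_Rintegral => w _; rewrite /f sumc; congr (cos (_ + p)).
  rewrite /px /py /gauss_partial !mulr_sumr -!big_split/=.
  by congr (_ + _); apply: eq_bigr => i _; rewrite innerDl innerZl mulrDl mulrA.
have cf : \int[Q]_w f n w @[n --> \oo] -->
    \int[Q]_w cos (r * gx x w + gx a w + (s * gy y w + gy b w) + p).
  have mcos (u : S -> R) : measurable_fun setT u -> measurable_fun setT (fun w => cos (u w)).
    have mc := continuous_measurable_fun (@continuous_cos R).
    exact: (measurableT_comp mc).
  have mlin (u1 u2 u3 u4 : S -> R) : measurable_fun setT u1 -> measurable_fun setT u2 ->
      measurable_fun setT u3 -> measurable_fun setT u4 ->
      measurable_fun setT (fun w => cos (r * u1 w + u2 w + (s * u3 w + u4 w) + p)).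
    move=> m1 m2 m3 m4; apply: mcos; apply: measurable_funD => //.
    by apply: measurable_funD; apply: measurable_funD => //; exact: measurable_funM.
  apply: (@ae_dominated_cvg _ _ _ Q _ _ (fun=> 1)).
  - by move=> n; apply: mlin.
  - exact: mlin.
  - have cx := gauss_dot_cvg gs inlI inlE inlD x be.
    have ca := gauss_dot_cvg gs inlI inlE inlD a be.
    have cy := gauss_dot_cvg gs inrI inrE inrD y be'.
    have cb := gauss_dot_cvg gs inrI inrE inrD b be'.
    apply: filterS2 (filterI cx ca) (filterI cy cb) => w [wx wa] [wy wb].
    rewrite /f; apply: continuous_cvg; first exact: continuous_cos.
    apply: cvgD; last exact: cvg_cst.
    by apply: cvgD; apply: cvgD => //; apply: cvgMr.
  - exact: integrable_probability_cst.
  - by move=> n w; rewrite ler_norml cos_geN1 cos_le1.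
rewrite -(cvg_lim (@Rhausdorff R) cf)//; apply: cvg_lim => //.
under eq_fun do rewrite fE.
apply: cvgMr; rewrite -expRD -opprD -mulrDl.
apply: continuous_cvg; first exact: continuous_expR.
by apply: cvgN; apply: cvgMl; apply: cvgD; exact: fourier_sqr_cvg.
Qed.

End gaussian_characteristic.

(** * Mixing over the Gaussian variables *)

Section gaussian_mixing.
Context (R : realType) (H H' : hilbertType R).
Context dS (S : measurableType dS) (Q : probability S R).
Variables (X : {RV Q >-> borel H}) (Y : {RV Q >-> borel H'}).
Variables (dim : option nat) (xi : nat -> {RV Q >-> R}).
Variables (dim' : option nat) (eta : nat -> {RV Q >-> R}).
Hypothesis gs : gaussian_setup X Y dim xi dim' eta.
Variables (e : nat -> H) (e' : nat -> H').
Hypotheses (be : orthonormal_basis dim e) (be' : orthonormal_basis dim' e').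
Local Notation SG J := (g_sigma_algebraType (gauss_sigma X Y dim xi dim' eta J)).
Local Notation gx := (gauss_dot dim e xi).
Local Notation gy := (gauss_dot dim' e' eta).
Local Notation h := (pi / 2 : R).

Lemma measurable_cos_comp dU (U : measurableType dU) (f : U -> R) (p : R) :
  measurable_fun setT f -> measurable_fun setT (fun u => cos (f u + p)).
Proof.
move=> mf; have mc := continuous_measurable_fun (@continuous_cos R).
by apply: (measurableT_comp mc); exact: measurable_funD.
Qed.

Lemma normr_cos_le1 (x : R) : `|cos x| <= 1.
Proof. by rewrite ler_norml cos_geN1 cos_le1. Qed.

Lemma cosBpihalf (x : R) : cos (x - h) = sin x.
Proof. by rewrite cosB cos_pihalf sin_pihalf mulr0 mulr1 add0r. Qed.

Lemma integrable_cos_comp (f : S -> R) (p : R) : measurable_fun setT f ->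
  Q.-integrable setT (EFin \o (fun w => cos (f w + p))).
Proof.
move=> mf; apply: (@integrable_bounded _ _ _ _ _ 1) => [|w]; last exact: normr_cos_le1.
exact: measurable_cos_comp.
Qed.

(* The phase p = 0 gives E cos T, the phase p = - pi / 2 gives E sin T. *)
Definition cosI (f : S -> R) (p : R) : R := \int[Q]_w cos (f w + p).

Lemma normr_cosI (f : S -> R) p : measurable_fun setT f -> `|cosI f p| <= 1.
Proof.
move=> mf; have ic := integrable_cos_comp p mf.
apply: le_trans (le_normr_Rintegral _ ic) _ => //.
rewrite -[leRHS](@Rintegral_probability_cst _ _ _ Q).
apply: le_Rintegral => //; first exact: integrable_norm.
  exact: integrable_probability_cst.
by move=> w _; exact: normr_cos_le1.
Qed.

Lemma cosID0 (f : S -> R) (c : R) : measurable_fun setT f ->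
  cosI (fun w => f w + c) 0 = cos c * cosI f 0 - sin c * cosI f (- h).
Proof.
move=> mf; have i0 := integrable_cos_comp 0 mf; have ih := integrable_cos_comp (- h) mf.
rewrite /cosI -!RintegralZl// -RintegralB//; try exact: integrableZ_EFin.
by apply: eq_Rintegral => w _; rewrite !addr0 cosBpihalf cosD mulrC (mulrC (sin c)).
Qed.

Lemma cosIDh (f : S -> R) (c : R) : measurable_fun setT f ->
  cosI (fun w => f w + c) (- h) = sin c * cosI f 0 + cos c * cosI f (- h).
Proof.
move=> mf; have i0 := integrable_cos_comp 0 mf; have ih := integrable_cos_comp (- h) mf.
rewrite /cosI -!RintegralZl// -RintegralD//; try exact: integrableZ_EFin.
by apply: eq_Rintegral => w _; rewrite !addr0 !cosBpihalf sinD addrC mulrC (mulrC (cos c)).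
Qed.

Lemma cosI_indep (f g : S -> R) : measurable_fun setT f -> measurable_fun setT g ->
  indep Q f g ->
  cosI (fun w => f w + g w) 0 = cosI f 0 * cosI g 0 - cosI f (- h) * cosI g (- h) /\
  cosI (fun w => f w + g w) (- h) = cosI f 0 * cosI g (- h) + cosI f (- h) * cosI g 0.
Proof.
move=> mf mg fg.
have mc (p : R) : measurable_fun setT (fun x : R => cos (x + p)).
  exact: measurable_cos_comp.
have iM p q : Q.-integrable setT (EFin \o (fun w => cos (f w + p) * cos (g w + q))).
  exact: (integrableM_indep mf mg fg (mc p) (mc q) (integrable_cos_comp p mf)
    (integrable_cos_comp q mg)).
have EM p q : \int[Q]_w (cos (f w + p) * cos (g w + q)) = cosI f p * cosI g q.
  exact: (RintegralM_indep mf mg fg (mc p) (mc q) (integrable_cos_comp p mf)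
    (integrable_cos_comp q mg)).
rewrite -!EM -RintegralB// -RintegralD//; split; apply: eq_Rintegral => w _.
  by rewrite !addr0 !cosBpihalf cosD.
by rewrite !addr0 !cosBpihalf sinD addrC (mulrC (sin _)) mulrC.
Qed.

(** The point [w] supplies the Gaussian variables and [w'] the value of X, so the two can be
    integrated separately as if independent. The vector [a] is a test vector that later becomes the
    centre of a Gaussian kernel. *)
Definition dotX (r : R) (a : H) (w w' : S) : R := r * gx (X w' : H) w + gx a w.
Definition dotY (s : R) (b : H') (w w' : S) : R := s * gy (Y w' : H') w + gy b w.

Lemma gauss_dot0 (K : hilbertType R) dm (b : nat -> K) (g : nat -> {RV Q >-> R}) w :
  gauss_dot dm b g 0 w = 0.
Proof.
rewrite /gauss_dot; apply: cvg_lim => //.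
under eq_fun do under eq_bigr do rewrite -(scale0r 0) innerZl !mul0r.
by under eq_fun do rewrite big1//; exact: cvg_cst.
Qed.

Let mfst J : measurable_fun setT (fun z : S * S => z.1 : SG J).
Proof.
have mi := @measurable_idG _ _ _ _ _ _ X Y dim xi dim' eta J.
exact: (measurableT_comp mi (@measurable_fst _ _ S S)).
Qed.

Let mX2 J : measurable_fun setT (fun z : S * S => (X z.2, z.1) : borel H * SG J).
Proof.
apply: measurable_fun_pair; first exact: measurableT_comp.
exact: mfst.
Qed.

Let mY2 J : measurable_fun setT (fun z : S * S => (Y z.2, z.1) : borel H' * SG J).
Proof.
apply: measurable_fun_pair; first exact: measurableT_comp.
exact: mfst.
Qed.

Let mgxG J a : range inl `<=` J -> measurable_fun setT (gx a : SG J -> R).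
Proof.
move=> JX; have mg := @measurable_gauss_dotX _ _ _ _ _ _ X Y dim xi dim' eta e _ JX.
exact: (measurableT_comp mg (measurable_fun_pair (@measurable_cst _ _ (SG J) (borel H) setT a) (@measurable_id _ (SG J) setT))).
Qed.

Let mgyG J b : range inr `<=` J -> measurable_fun setT (gy b : SG J -> R).
Proof.
move=> JY; have mg := @measurable_gauss_dotY _ _ _ _ _ _ X Y dim xi dim' eta e' _ JY.
exact: (measurableT_comp mg (measurable_fun_pair (@measurable_cst _ _ (SG J) (borel H') setT b) (@measurable_id _ (SG J) setT))).
Qed.

Lemma measurable_dotX2 r a : measurable_fun setT (fun z : S * S => dotX r a z.1 z.2).
Proof.
have mg := @measurable_gauss_dotX _ _ _ _ _ _ X Y dim xi dim' eta e setT (fun _ _ => I).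
have mXg := measurableT_comp mg (@mX2 setT).
apply: measurable_funD; first by apply: measurable_funM; [exact: measurable_cst|exact: mXg].
exact: (measurableT_comp (@mgxG setT a (fun _ _ => I)) (@mfst _)).
Qed.

Lemma measurable_dotY2 s b : measurable_fun setT (fun z : S * S => dotY s b z.1 z.2).
Proof.
have mg := @measurable_gauss_dotY _ _ _ _ _ _ X Y dim xi dim' eta e' setT (fun _ _ => I).
have mXg := measurableT_comp mg (@mY2 setT).
apply: measurable_funD; first by apply: measurable_funM; [exact: measurable_cst|exact: mXg].
exact: (measurableT_comp (@mgyG setT b (fun _ _ => I)) (@mfst _)).
Qed.

Lemma measurable_dotX r a w : measurable_fun setT (dotX r a w).
Proof. exact: (measurableT_comp (measurable_dotX2 r a) (measurable_pair1 w)). Qed.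

Lemma measurable_dotY s b w : measurable_fun setT (dotY s b w).
Proof. exact: (measurableT_comp (measurable_dotY2 s b) (measurable_pair1 w)). Qed.

Definition dotXY r a s b (w w' : S) : R := dotX r a w w' + dotY s b w w'.

Lemma measurable_dotXY2 r a s b : measurable_fun setT (fun z : S * S => dotXY r a s b z.1 z.2).
Proof. exact: measurable_funD (measurable_dotX2 r a) (measurable_dotY2 s b). Qed.

Lemma measurable_dotXY r a s b w : measurable_fun setT (dotXY r a s b w).
Proof. exact: measurable_funD (measurable_dotX r a w) (measurable_dotY s b w). Qed.

Definition gaussX r a (w : S) : R := expR (- (`|r *: (X w : H) + a| ^+ 2 / 2)).
Definition gaussY s b (w : S) : R := expR (- (`|s *: (Y w : H') + b| ^+ 2 / 2)).

Let measurable_half_sqr (K : hilbertType R) r (a : K) :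
  measurable_fun setT ((fun x : K => expR (- (`|r *: x + a| ^+ 2 / 2))) : borel K -> R).
Proof.
have cn : continuous (fun x : K => `|r *: x + a|).
  by move=> x; apply: cvg_norm; apply: cvgD; [apply: cvgZr; exact: cvg_id|exact: cvg_cst].
apply: continuous_borel_measurable => x; apply: continuous_comp; last exact: continuous_expR.
apply: cvgN; apply: cvgMl; rewrite expr2; under eq_fun do rewrite expr2.
by apply: cvgM; exact: cn.
Qed.

Lemma measurable_gaussX r a : measurable_fun setT (gaussX r a).
Proof. by have mc := measurable_half_sqr r a; exact: (measurableT_comp mc). Qed.

Lemma measurable_gaussY s b : measurable_fun setT (gaussY s b).
Proof. by have mc := measurable_half_sqr s b; exact: (measurableT_comp mc). Qed.

Let expR_half_le1 (t : R) : `|expR (- (t ^+ 2 / 2))| <= 1.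
Proof.
rewrite ger0_norm ?expR_ge0// -[leRHS]expR0 ler_expR oppr_le0.
by rewrite divr_ge0// sqr_ge0.
Qed.

(** After exchanging the integrals, the inner one is over the Gaussian variables with X and Y fixed,
    and is given by their characteristic function. *)
Lemma Rintegral_cosI r a s b p :
  \int[Q]_w cosI (dotXY r a s b w) p = cos p * \int[Q]_w (gaussX r a w * gaussY s b w).
Proof.
have mc : measurable_fun setT (fun z : S * S => cos (dotXY r a s b z.1 z.2 + p)).
  exact: measurable_cos_comp (measurable_dotXY2 r a s b).
have mc1 w : measurable_fun setT (fun w' => cos (dotXY r a s b w w' + p)).
  exact: (measurableT_comp mc (measurable_pair1 w)).
have mc2 w' : measurable_fun setT (fun w => cos (dotXY r a s b w w' + p)).
  exact: (measurableT_comp mc (measurable_pair2 w')).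
rewrite /cosI (@Rintegral_fubini _ _ _ _ _ Q Q
  (fun z => cos (dotXY r a s b z.1 z.2 + p)) mc _ _ (fun=> 1))//=.
- rewrite -RintegralZl//; last first.
    apply: (@integrable_bounded _ _ _ _ _ 1).
      exact: measurable_funM (measurable_gaussX r a) (measurable_gaussY s b).
    by move=> w; rewrite normrM -[leRHS]mulr1 ler_pM// expR_half_le1.
  apply: eq_Rintegral => w' _.
  exact: (Rintegral_cos_gauss_dot gs be be').
- by move=> w; apply: (@integrable_bounded _ _ _ _ _ 1) => // w'; exact: normr_cos_le1.
- by move=> w'; apply: (@integrable_bounded _ _ _ _ _ 1) => // w; exact: normr_cos_le1.
- exact: integrable_probability_cst.
- move=> w; rewrite -[leRHS](@Rintegral_probability_cst _ _ _ Q).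
  apply: le_Rintegral => //.
  + apply: integrable_norm.
    by apply: (@integrable_bounded _ _ _ _ _ 1) => // w'; exact: normr_cos_le1.
  + exact: integrable_probability_cst.
  + by move=> w' _; exact: normr_cos_le1.
Qed.

Lemma Rintegral_cosIX r a p :
  \int[Q]_w cosI (dotX r a w) p = cos p * \int[Q]_w gaussX r a w.
Proof.
have := Rintegral_cosI r a 0 0 p.
rewrite (_ : (fun w => gaussX r a w * gaussY 0 0 w) = gaussX r a); last first.
  by apply/funext => w; rewrite /gaussY scale0r addr0 normr0 expr0n/= mul0r oppr0 expR0 mulr1.
move=> <-; apply: eq_Rintegral => w _; congr (cosI _ p); apply/funext => w'.
by rewrite /dotXY [in RHS]/dotY mul0r gauss_dot0 !addr0.
Qed.

Lemma Rintegral_cosIY s b p :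
  \int[Q]_w cosI (dotY s b w) p = cos p * \int[Q]_w gaussY s b w.
Proof.
have := Rintegral_cosI 0 0 s b p.
rewrite (_ : (fun w => gaussX 0 0 w * gaussY s b w) = gaussY s b); last first.
  by apply/funext => w; rewrite /gaussX scale0r addr0 normr0 expr0n/= mul0r oppr0 expR0 mul1r.
move=> <-; apply: eq_Rintegral => w _; congr (cosI _ p); apply/funext => w'.
by rewrite /dotXY [in RHS]/dotX mul0r gauss_dot0 !add0r.
Qed.

Lemma is_cond_exp_cosIX r a p : is_cond_exp Q (gauss_sigma X Y dim xi dim' eta (range inl))
  (fun w => cos (dotX r a w w + p)) (fun w => cosI (dotX r a w) p).
Proof.
pose f (z : borel H * SG (range inl)) : R := cos (r * gx (z.1 : H) z.2 + gx a z.2 + p).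
have mf : measurable_fun setT f.
  apply: measurable_cos_comp; apply: measurable_funD.
    apply: measurable_funM; first exact: measurable_cst.
    exact: (@measurable_gauss_dotX _ _ _ _ _ _ X Y dim xi dim' eta e).
  exact: (measurableT_comp (@mgxG (range inl) a (fun _ => id)) measurable_snd).
have ind : indep Q X (id : S -> SG (range inl)).
  have mfst' := @measurable_fst _ _ (borel H) (borel H').
  by move=> C D mC mD; exact: (indep_gauss_sigma gs (measurable_preimage mfst' mC) mD).
apply: (@is_cond_exp_freeze _ _ _ Q _ _ X _ _ _ _ ind f 1 mf) => //.
- exact: sigma_algebra_gauss_sigma.
- exact: gauss_sigma_measurable.
- by move=> z; exact: normr_cos_le1.
Qed.

Lemma is_cond_exp_cosIY s b p : is_cond_exp Q (gauss_sigma X Y dim xi dim' eta (range inr))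
  (fun w => cos (dotY s b w w + p)) (fun w => cosI (dotY s b w) p).
Proof.
pose f (z : borel H' * SG (range inr)) : R := cos (s * gy (z.1 : H') z.2 + gy b z.2 + p).
have mf : measurable_fun setT f.
  apply: measurable_cos_comp; apply: measurable_funD.
    apply: measurable_funM; first exact: measurable_cst.
    exact: (@measurable_gauss_dotY _ _ _ _ _ _ X Y dim xi dim' eta e').
  exact: (measurableT_comp (@mgyG (range inr) b (fun _ => id)) measurable_snd).
have ind : indep Q Y (id : S -> SG (range inr)).
  have msnd' := @measurable_snd _ _ (borel H) (borel H').
  by move=> C D mC mD; exact: (indep_gauss_sigma gs (measurable_preimage msnd' mC) mD).
apply: (@is_cond_exp_freeze _ _ _ Q _ _ Y _ _ _ _ ind f 1 mf) => //.
- exact: sigma_algebra_gauss_sigma.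
- exact: gauss_sigma_measurable.
- by move=> z; exact: normr_cos_le1.
Qed.

Lemma is_cond_exp_cosIXY r a s b p : is_cond_exp Q (gauss_sigma X Y dim xi dim' eta setT)
  (fun w => cos (dotXY r a s b w w + p)) (fun w => cosI (dotXY r a s b w) p).
Proof.
pose f (z : (borel H * borel H') * SG setT) : R :=
  cos (r * gx (z.1.1 : H) z.2 + gx a z.2 + (s * gy (z.1.2 : H') z.2 + gy b z.2) + p).
have m1 : measurable_fun setT (fun z : (borel H * borel H') * SG setT => (z.1.1, z.2)).
  apply: measurable_fun_pair; last exact: measurable_snd.
  exact: (measurableT_comp measurable_fst measurable_fst).
have m2 : measurable_fun setT (fun z : (borel H * borel H') * SG setT => (z.1.2, z.2)).
  apply: measurable_fun_pair; last exact: measurable_snd.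
  exact: (measurableT_comp measurable_snd measurable_fst).
have mX := @measurable_gauss_dotX _ _ _ _ _ _ X Y dim xi dim' eta e setT (fun _ _ => I).
have mY := @measurable_gauss_dotY _ _ _ _ _ _ X Y dim xi dim' eta e' setT (fun _ _ => I).
have mf : measurable_fun setT f.
  apply: measurable_cos_comp; apply: measurable_funD; apply: measurable_funD.
  - by apply: measurable_funM; [exact: measurable_cst|exact: (measurableT_comp mX m1)].
  - exact: (measurableT_comp (@mgxG setT a (fun _ _ => I)) measurable_snd).
  - by apply: measurable_funM; [exact: measurable_cst|exact: (measurableT_comp mY m2)].
  - exact: (measurableT_comp (@mgyG setT b (fun _ _ => I)) measurable_snd).
have mXY : measurable_fun setT (pair_fun X Y) by exact: measurable_fun_pair.
have sG := @sigma_algebra_gauss_sigma _ _ _ _ _ _ X Y dim xi dim' eta setT.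
have Gm := @gauss_sigma_measurable _ _ _ _ _ _ X Y dim xi dim' eta setT.
have f1 z : `|f z| <= 1 by exact: normr_cos_le1.
have ind := @indep_gauss_sigma _ _ _ _ _ _ _ _ _ _ _ _ gs setT.
exact: (is_cond_exp_freeze mXY sG Gm ind mf f1).
Qed.

End gaussian_mixing.

(** * The conditional covariance of characters *)

Section gaussian_covariance.
Context (R : realType) (H H' : hilbertType R).
Context dS (S : measurableType dS) (Q : probability S R).
Variables (X : {RV Q >-> borel H}) (Y : {RV Q >-> borel H'}).
Variables (dim : option nat) (xi : nat -> {RV Q >-> R}).
Variables (dim' : option nat) (eta : nat -> {RV Q >-> R}).
Hypothesis gs : gaussian_setup X Y dim xi dim' eta.
Variables (e : nat -> H) (e' : nat -> H').
Hypotheses (be : orthonormal_basis dim e) (be' : orthonormal_basis dim' e').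
Local Notation SG J := (g_sigma_algebraType (gauss_sigma X Y dim xi dim' eta J)).
Local Notation h := (pi / 2 : R).
Local Notation dX := (dotX X dim xi e).
Local Notation dY := (dotY Y dim' eta e').
Local Notation dXY := (dotXY X Y dim xi dim' eta e e').
Local Notation cosI := (@cosI R dS S Q).

(* Real and imaginary parts of the covariance, over the second sample point, of
   e^(ir xi.X) and e^(is eta.Y), with the Gaussian variables fixed by w. *)
Definition cov_re r s w : R := cosI (dXY r 0 s 0 w) 0 -
  (cosI (dX r 0 w) 0 * cosI (dY s 0 w) 0 - cosI (dX r 0 w) (- h) * cosI (dY s 0 w) (- h)).

Definition cov_im r s w : R := cosI (dXY r 0 s 0 w) (- h) -
  (cosI (dX r 0 w) 0 * cosI (dY s 0 w) (- h) + cosI (dX r 0 w) (- h) * cosI (dY s 0 w) 0).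

Definition cov_sqr r s w : R := cov_re r s w ^+ 2 + cov_im r s w ^+ 2.

Let dXE r a w : dX r a w = (fun w' => dX r 0 w w' + gauss_dot dim e xi a w).
Proof. by apply/funext => w'; rewrite /dotX gauss_dot0 addr0. Qed.

Let dYE s b w : dY s b w = (fun w' => dY s 0 w w' + gauss_dot dim' e' eta b w).
Proof. by apply/funext => w'; rewrite /dotY gauss_dot0 addr0. Qed.

Let dXYE r a s b w : dXY r a s b w =
  (fun w' => dXY r 0 s 0 w w' + (gauss_dot dim e xi a w + gauss_dot dim' e' eta b w)).
Proof. by apply/funext => w'; rewrite /dotXY dXE dYE addrACA. Qed.

Let mdX r a w : measurable_fun setT (dX r a w).
Proof. exact: (@measurable_dotX _ _ _ _ _ _ X Y dim xi dim' eta). Qed.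

Let mdY s b w : measurable_fun setT (dY s b w).
Proof. exact: (@measurable_dotY _ _ _ _ _ _ X Y dim xi dim' eta). Qed.

Let mdXY r a s b w : measurable_fun setT (dXY r a s b w).
Proof. exact: measurable_dotXY. Qed.

(** For almost every choice of the Gaussian variables the joint character factors. Multiplying by
    the character of (a, b), which is constant in the second sample point, keeps the factorization;
    integrating over the Gaussian variables, with xi and eta independent, turns characters into
    Gaussian functions of X and Y. *)
Lemma cov0_gaussian r s a b :
  {ae Q, forall w, cov_sqr r s w = 0} ->
  \int[Q]_w (gaussX X r a w * gaussY Y s b w) =
  (\int[Q]_w gaussX X r a w) * (\int[Q]_w gaussY Y s b w).
Proof.
move=> cov0.
pose u p w := cosI (dX r a w) p; pose v p w := cosI (dY s b w) p.
pose M w := cosI (dXY r a s b w) 0.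
have Gm J := @gauss_sigma_measurable _ _ _ _ _ _ X Y dim xi dim' eta J.
have sG J := @sigma_algebra_gauss_sigma _ _ _ _ _ _ X Y dim xi dim' eta J.
have cu p := is_cond_exp_cosIX gs e r a p.
have cv p := is_cond_exp_cosIY gs e' s b p.
have mu p : measurable_fun setT (u p : SG (range inl) -> R).
  by have [mu _ _] := cu p; exact: (sub_measurableP (sG _) _).1 mu.
have mv p : measurable_fun setT (v p : SG (range inr) -> R).
  by have [mv _ _] := cv p; exact: (sub_measurableP (sG _) _).1 mv.
have iu p : Q.-integrable setT (EFin \o u p) by have [_ iu _] := cu p.
have iv p : Q.-integrable setT (EFin \o v p) by have [_ iv _] := cv p.
have ind : indep Q (id : S -> SG (range inl)) (id : S -> SG (range inr)).
  by apply: (indep_gauss_sigma2 gs); apply/seteqP; split => // _ [[i _ <-] [j _]].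
have mid J := @measurable_idG _ _ _ _ _ _ X Y dim xi dim' eta J.
have iM p q : Q.-integrable setT (EFin \o (fun w => u p w * v q w)).
  exact: (integrableM_indep (mid _) (mid _) ind (mu p) (mv q) (iu p) (iv q)).
have EM p q : \int[Q]_w (u p w * v q w) = (\int[Q]_w u p w) * (\int[Q]_w v q w).
  exact: (RintegralM_indep (mid _) (mid _) ind (mu p) (mv q) (iu p) (iv q)).
have cM := is_cond_exp_cosIXY gs e e' r a s b 0.
have iMM : Q.-integrable setT (EFin \o M) by have [_ iM' _] := cM.
have ME : {ae Q, forall w, M w = u 0 w * v 0 w - u (- h) w * v (- h) w}.
  (* Both parts of the covariance vanish; the phases coming from [a] and [b] are then restored by
     the addition formulas. *)
  apply: filterS cov0 => w /eqP; rewrite /cov_sqr paddr_eq0 ?sqr_ge0// !sqrf_eq0.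
  rewrite /cov_re /cov_im !subr_eq0 => /andP[/eqP re0 /eqP im0].
  rewrite /M /u /v dXYE (dXE r a) (dYE s b) (@cosID0 _ _ _ Q _ _ (mdXY r 0 s 0 w)).
  rewrite (@cosID0 _ _ _ Q _ _ (mdX r 0 w)) (@cosID0 _ _ _ Q _ _ (mdY s 0 w)).
  rewrite (@cosIDh _ _ _ Q _ _ (mdX r 0 w)) (@cosIDh _ _ _ Q _ _ (mdY s 0 w)) re0 im0 cosD sinD.
  by move: (cosI _ _) (cosI _ _) (cosI _ _) (cosI _ _) => c1 c2 c3 c4; ring.
have := Rintegral_cosI gs be be' r a s b 0; rewrite cos0 mul1r => <-.
transitivity (\int[Q]_w (u 0 w * v 0 w - u (- h) w * v (- h) w)).
  have iuv : Q.-integrable setT (EFin \o (fun w => u 0 w * v 0 w - u (- h) w * v (- h) w)).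
    exact: integrableB_EFin.
  rewrite /Rintegral; congr fine; apply: ae_eq_integral => //.
  - exact: measurable_int iMM.
  - exact: measurable_int iuv.
  - by apply: filterS ME => w /= + _; rewrite -/(M w) => ->.
have Eu p : \int[Q]_w u p w = cos p * \int[Q]_w gaussX X r a w.
  exact: (Rintegral_cosIX gs be be').
have Ev p : \int[Q]_w v p w = cos p * \int[Q]_w gaussY Y s b w.
  exact: (Rintegral_cosIY gs be be').
(* The sine contributions drop out because their means carry the factor cos(-pi/2) = 0. *)
rewrite (RintegralB measurableT (iM 0 0) (iM (- h) (- h))).
rewrite (EM 0 0) (EM (- h) (- h)) (Eu 0) (Eu (- h)) (Ev 0) (Ev (- h)).
by rewrite cosN cos_pihalf cos0 !mul0r !mul1r subr0.
Qed.

Lemma cov_indep r s w : indep Q X Y -> cov_sqr r s w = 0.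
Proof.
move=> XY.
have mX : measurable_fun setT (fun x : borel H => r * gauss_dot dim e xi (x : H) w + gauss_dot dim e xi 0 w).
  have mg := @measurable_gauss_dotX _ _ _ _ _ _ X Y dim xi dim' eta e setT (fun _ _ => I).
  have mp := measurable_fun_pair (@measurable_id _ (borel H) setT)
    (@measurable_cst _ _ (borel H) (SG setT) setT w).
  apply: measurable_funD; last exact: measurable_cst.
  by apply: measurable_funM; [exact: measurable_cst|exact: (measurableT_comp mg mp)].
have mY : measurable_fun setT (fun y : borel H' => s * gauss_dot dim' e' eta (y : H') w + gauss_dot dim' e' eta 0 w).
  have mg := @measurable_gauss_dotY _ _ _ _ _ _ X Y dim xi dim' eta e' setT (fun _ _ => I).
  have mp := measurable_fun_pair (@measurable_id _ (borel H') setT)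
    (@measurable_cst _ _ (borel H') (SG setT) setT w).
  apply: measurable_funD; last exact: measurable_cst.
  by apply: measurable_funM; [exact: measurable_cst|exact: (measurableT_comp mg mp)].
have ind : indep Q (dX r 0 w) (dY s 0 w) by exact: (indep_comp mX mY XY).
have [E0 E1] := cosI_indep (mdX r 0 w) (mdY s 0 w) ind.
by rewrite /cov_sqr /cov_re /cov_im /dotXY E0 E1 !subrr expr0n addr0.
Qed.

Local Notation GS := (gauss_sigma X Y dim xi dim' eta).
Let ceX r p := cond_exp Q (GS (range inl)) (fun w => cos (dX r 0 w w + p)).
Let ceY s p := cond_exp Q (GS (range inr)) (fun w => cos (dY s 0 w w + p)).
Let ceXY r s p := cond_exp Q (GS setT) (fun w => cos (dXY r 0 s 0 w w + p)).

Let cond_diff_sqrE r s w :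
  complex.ComplexField.Normc.normc (cond_diff X Y dim e xi dim' e' eta r s w) ^+ 2 =
  (ceXY r s 0 w - (ceX r 0 w * ceY s 0 w - ceX r (- h) w * ceY s (- h) w)) ^+ 2 +
  (ceXY r s (- h) w - (ceX r 0 w * ceY s (- h) w + ceX r (- h) w * ceY s 0 w)) ^+ 2.
Proof.
have fX p : (fun w => cos (dX r 0 w w + p)) = (fun w => cos (r * xiX X dim e xi w + p)).
  by apply/funext => w'; rewrite /dotX gauss_dot0 addr0.
have fY p : (fun w => cos (dY s 0 w w + p)) = (fun w => cos (s * etaY Y dim' e' eta w + p)).
  by apply/funext => w'; rewrite /dotY gauss_dot0 addr0.
have fXY p : (fun w => cos (dXY r 0 s 0 w w + p)) =
    (fun w => cos (r * xiX X dim e xi w + s * etaY Y dim' e' eta w + p)).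
  by apply/funext => w'; rewrite /dotXY /dotX /dotY !gauss_dot0 !addr0.
have ReE (f : S -> R) : (fun w => complex.Re (expi (f w))) = (fun w => cos (f w + 0)).
  by apply/funext => w'; rewrite addr0.
have ImE (f : S -> R) : (fun w => complex.Im (expi (f w))) = (fun w => cos (f w + - h)).
  by apply/funext => w'; rewrite cosBpihalf.
rewrite /cond_diff /ccond_exp.
rewrite (sigma_xi_etaE X Y) (sigma_xiE X Y dim xi dim' eta) (sigma_etaE X Y dim xi dim' eta).
rewrite (ReE (fun w' => r * xiX X dim e xi w' + s * etaY Y dim' e' eta w')).
rewrite (ImE (fun w' => r * xiX X dim e xi w' + s * etaY Y dim' e' eta w')).
rewrite (ReE (fun w' => r * xiX X dim e xi w')) (ImE (fun w' => r * xiX X dim e xi w')).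
rewrite (ReE (fun w' => s * etaY Y dim' e' eta w')) (ImE (fun w' => s * etaY Y dim' e' eta w')).
rewrite -(fXY 0) -(fXY (- h)) -(fX 0) -(fX (- h)) -(fY 0) -(fY (- h)).
by rewrite /complex.ComplexField.Normc.normc/= sqr_sqrtr ?addr_ge0 ?sqr_ge0.
Qed.

Let Gm J := @gauss_sigma_measurable _ _ _ _ _ _ X Y dim xi dim' eta J.
Let sG J := @sigma_algebra_gauss_sigma _ _ _ _ _ _ X Y dim xi dim' eta J.

Let measurable_sqr_cov (c1 c2 c3 c4 c5 c6 : S -> R) :
  measurable_fun setT c1 -> measurable_fun setT c2 -> measurable_fun setT c3 ->
  measurable_fun setT c4 -> measurable_fun setT c5 -> measurable_fun setT c6 ->
  measurable_fun setT (fun w => (c1 w - (c2 w * c4 w - c3 w * c5 w)) ^+ 2 +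
    (c6 w - (c2 w * c5 w + c3 w * c4 w)) ^+ 2).
Proof.
move=> m1 m2 m3 m4 m5 m6; apply: measurable_funD; apply: measurable_funX;
  apply: measurable_funB => //; [apply: measurable_funB|apply: measurable_funD];
  exact: measurable_funM.
Qed.

Let is_cond_exp_measurable G (Z W : S -> R) : G `<=` measurable ->
  is_cond_exp Q G Z W -> measurable_fun setT W /\ measurable_fun setT (cond_exp Q G Z).
Proof.
move=> GM cW; have [mW _ _] := cW; split; first exact: sub_measurable_measurable mW.
rewrite /cond_exp; case: xgetP => [V _ [mV _ _]|/(_ W)//].
exact: sub_measurable_measurable mV.
Qed.

Let mcX r p := is_cond_exp_measurable (@Gm _) (is_cond_exp_cosIX gs e r 0 p).
Let mcY s p := is_cond_exp_measurable (@Gm _) (is_cond_exp_cosIY gs e' s 0 p).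
Let mcXY r s p := is_cond_exp_measurable (@Gm _) (is_cond_exp_cosIXY gs e e' r 0 s 0 p).

Lemma measurable_cov_sqr r s : measurable_fun setT (cov_sqr r s).
Proof.
by apply: measurable_sqr_cov; [exact: (mcXY r s 0).1|exact: (mcX r 0).1|exact: (mcX r (- h)).1
  |exact: (mcY s 0).1|exact: (mcY s (- h)).1|exact: (mcXY r s (- h)).1].
Qed.

Lemma cov_sqr_ge0 r s w : 0 <= cov_sqr r s w.
Proof. by rewrite addr_ge0 ?sqr_ge0. Qed.

Let sqr_le9 (a b c : R) : `|a| <= 1 -> `|b| <= 1 -> `|c| <= 1 -> (a - (b + c)) ^+ 2 <= 9.
Proof. by rewrite !ler_norml => /andP[? ?] /andP[? ?] /andP[? ?]; nra. Qed.

Lemma cov_sqr_le r s w : cov_sqr r s w <= 18.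
Proof.
have bXY p : `|cosI (dXY r 0 s 0 w) p| <= 1 by exact: normr_cosI.
have bM p q : `|cosI (dX r 0 w) p * cosI (dY s 0 w) q| <= 1.
  by rewrite normrM -[leRHS]mulr1 ler_pM// normr_cosI.
have -> : 18 = 9 + 9 :> R by ring.
by apply: lerD; apply: sqr_le9; rewrite ?normrN.
Qed.

(** The chosen conditional expectations agree almost surely with the explicit frozen integrals, and
    the squared modulus is the sum of the squares of the two parts. *)
Lemma expectation_cond_diff r s :
  ('E_Q[fun w => (complex.ComplexField.Normc.normc
    (cond_diff X Y dim e xi dim' e' eta r s w) ^+ 2)%R] = (\int[Q]_w cov_sqr r s w)%:E)%E.
Proof.
have iC : Q.-integrable setT (EFin \o cov_sqr r s).
  apply: (@integrable_bounded _ _ _ _ _ 18); first exact: measurable_cov_sqr.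
  by move=> w; rewrite ger0_norm ?cov_sqr_ge0// cov_sqr_le.
rewrite unlock -EFin_Rintegral//.
have aX p := cond_exp_ae (sG _) (@Gm _) (is_cond_exp_cosIX gs e r 0 p).
have aY p := cond_exp_ae (sG _) (@Gm _) (is_cond_exp_cosIY gs e' s 0 p).
have aXY p := cond_exp_ae (sG _) (@Gm _) (is_cond_exp_cosIXY gs e e' r 0 s 0 p).
apply: ae_eq_integral => //.
- apply/measurable_EFinP; rewrite (funext (cond_diff_sqrE r s)).
  by apply: measurable_sqr_cov; [exact: (mcXY r s 0).2|exact: (mcX r 0).2|exact: (mcX r (- h)).2
    |exact: (mcY s 0).2|exact: (mcY s (- h)).2|exact: (mcXY r s (- h)).2].
- exact: measurable_int iC.
apply: filterS3 (filterI (aX 0) (aX (- h))) (filterI (aY 0) (aY (- h)))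
  (filterI (aXY 0) (aXY (- h))) => w [X0 Xh] [Y0 Yh] [XY0 XYh] _.
by rewrite /= cond_diff_sqrE /ceX /ceY /ceXY X0 Xh Y0 Yh XY0 XYh.
Qed.

End gaussian_covariance.

(** * Positivity of the Gamma constant and of iterated integrals *)

(** Proved by comparing simple minorants, so that it applies to iterated integrals without
    discussing their measurability. *)
Lemma le_integral_cst d (T : measurableType d) (R : realType) (mu : {measure set T -> \bar R})
    (D A : set T) (f : T -> \bar R) (c : R) :
  measurable A -> A `<=` D -> 0 <= c -> (forall x, D x -> 0 <= f x)%E ->
  (forall x, A x -> c%:E <= f x)%E -> (c%:E * mu A <= \int[mu]_(x in D) f x)%E.
Proof.
move=> mA AD c0 f0 cf; rewrite -(integral_cst mu mA) !ge0_integralE//.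
apply: ge_ereal_sup => _ [g /= gc <-]; apply: ereal_sup_ubound; exists g => //= x.
apply: le_trans (gc x) _; rewrite !patchE.
case: (boolP (x \in A)) => [xA|_].
  by rewrite (mem_set (AD _ (set_mem xA))) cf//; exact: set_mem.
by case: ifPn => // /set_mem; exact: f0.
Qed.

Section gamma.
Context (R : realType).
Local Notation leb := (@lebesgue_measure R).

(** Finiteness has to be established as well, since the real-valued integral of a function with
    infinite integral would be 0. The substitution t = e^u bounds the integral by [mix_const b]. *)
Lemma Gamma_gt0 (b : R) : 0 < b < 1 -> 0 < Gamma (1 - b).
Proof.
move=> b01; have /andP[b0 b1] := b01.
pose f (t : R) : R := t `^ (1 - b - 1) * expR (- t).
have f_ge0 t : 0 <= f t by rewrite mulr_ge0 ?powR_ge0 ?expR_ge0.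
have mf : measurable_fun setT f.
  by apply: measurable_funM => //; apply: measurableT_comp.
have mEf : measurable_fun setT (EFin \o f) by exact/measurable_EFinP.
pose D : set R := `]0, +oo[%classic.
(* The substitution is made on compact intervals, which then increase to the half-line. *)
pose F (n : nat) : set R := `[expR (- n%:R), expR n%:R]%classic.
have DE : \bigcup_n F n = D.
  apply/seteqP; split => t; rewrite /D/= ?in_itv/= ?andbT.
    by move=> [n _]; rewrite /F/= in_itv/= => /andP[+ _]; apply: lt_le_trans; exact: expR_gt0.
  move=> t0; exists (Num.bound `|ln t|) => //; rewrite /F/= in_itv/= -[X in _ <= X <= _](lnK t0).
  have : `|ln t| <= (Num.bound `|ln t|)%:R by rewrite ltW// archi_boundP.
  by rewrite !ler_expR ler_norml.
have dE : (@expR R)^`()%classic = @expR R.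
  by apply/funext => u; rewrite derive1E derive_val.
(* This is y e^(-y) <= 1 - e^(-y) at y = e^u, that is, 1 + y <= e^y. *)
have fE u : f (expR u) * expR u <= mix b 1 u.
  have -> : f (expR u) * expR u = expR u * expR (- expR u) * expR (- (b * u)).
    rewrite /f -expRM (_ : u * (1 - b - 1) = - (b * u)); last by ring.
    by ring.
  rewrite /mix mul1r ler_wpM2r ?expR_ge0//; set y := expR u.
  have := expRxMexpNx_1 y; have := expR_ge1Dx y; have := expR_ge0 (- y).
  by move: (expR y) (expR (- y)) => p q; nra.
have cf (t : R) : 0 < t -> {for t, continuous f}.
  move=> t0; have [dp _] := is_derive1_powR (1 - b - 1) t0; apply: cvgM.
    have : differentiable (fun x : R => x `^ (1 - b - 1)) t by exact/derivable1_diffP.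
    by move=> /differentiable_continuous.
  apply: continuous_comp; last exact: continuous_expR.
  by apply: cvgN; exact: cvg_id.
have bound n : (\int[leb]_(t in F n) (f t)%:E <= (mix_const b)%:E)%E.
  have subst : (\int[leb]_(t in F n) (f t)%:E =
      \int[leb]_(u in `[(- n%:R)%R, n%:R]) (f (expR u) * expR u)%:E)%E.
    rewrite /F (@integration_by_substitution_increasing _ (@expR R) f (- n%:R) n%:R).
    - by rewrite dE.
    - by have : (0 : R) <= n%:R by []; lra.
    - by move=> x y _ _; rewrite ltr_expR.
    - by rewrite dE => x _; exact: continuous_expR.
    - rewrite dE; apply/cvg_ex; exists (expR (- n%:R)).
      by apply: cvg_at_right_filter; exact: continuous_expR.
    - rewrite dE; apply/cvg_ex; exists (expR n%:R).
      by apply: cvg_at_left_filter; exact: continuous_expR.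
    - split=> [x _||]; first exact: derivable_expR.
        by apply: cvg_at_right_filter; exact: continuous_expR.
      by apply: cvg_at_left_filter; exact: continuous_expR.
    - apply: continuous_in_subspaceT => t; rewrite inE/= in_itv/= => /andP[t0 _].
      by apply: cf; apply: lt_le_trans t0; exact: expR_gt0.
  have mmix : measurable_fun setT (mix b 1).
    by apply: continuous_measurable_fun; exact: continuous_mix.
  rewrite subst; apply: (@le_trans _ _ (\int[leb]_(u in `[(- n%:R)%R, n%:R]) (mix b 1 u)%:E)%E).
    apply: ge0_le_integral; first exact: measurable_itv.
    + by move=> u _; rewrite lee_fin mulr_ge0// expR_ge0.
    + apply/measurable_EFinP/measurable_funTS/measurable_funM => //.
      exact: (measurableT_comp mf).
    + by apply/measurable_EFinP/measurable_funTS.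
    + by move=> u _; rewrite lee_fin.
  rewrite /mix_const -EFin_Rintegral; last exact: integrable_mix.
  apply: ge0_subset_integral; [exact: measurable_itv|by []| | |by []].
  + exact/measurable_EFinP.
  + by move=> u _; rewrite lee_fin mix_ge0.
have ndF : nondecreasing_seq F.
  move=> i j ij; apply/subsetPset => t; rewrite /F/= !in_itv/= => /andP[t1 t2].
  by rewrite (le_trans _ t1) ?(le_trans t2)// ler_expR ?lerN2 ler_nat.
have mF n : measurable (F n) by exact: measurable_itv.
have mfF n : measurable_fun (F n) (EFin \o f) by exact: measurable_funTS.
have fF n t : F n t -> (0 <= (EFin \o f) t)%E by move=> _; rewrite lee_fin.
have fin : (\int[leb]_(t in D) (f t)%:E <= (mix_const b)%:E)%E.
  have cv := @ge0_nondecreasing_set_cvg_integral _ (measurableTypeR R) R F (EFin \o f) leb ndF mF mfF fF.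
  rewrite -DE -(cvg_lim _ cv)//; apply: lime_le; last by apply: nearW.
  by apply/cvg_ex; eexists; exact: cv.
rewrite /Gamma /Rintegral -/f -/D fine_gt0// (le_lt_trans fin (ltry _)) andbT.
(* The value of the integrand at t = 2, a lower bound on [1,2] because both factors decrease. *)
have pos : 0 < 2 `^ (1 - b - 1) * expR (- 2) :> R by rewrite mulr_gt0 ?powR_gt0 ?expR_gt0.
have lower : ((2 `^ (1 - b - 1) * expR (- 2))%:E * leb `[1%R, 2%R]%classic <=
    \int[leb]_(t in D) (f t)%:E)%E; last first.
  apply: lt_le_trans lower; rewrite lebesgue_measure_itv/= lte_fin ltr1n -EFinD -EFinM lte_fin.
  by rewrite mulr_gt0// subr_gt0 ltr1n.
apply: le_integral_cst; [exact: measurable_itv| |exact: ltW| |].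
- by move=> t; rewrite /D/= !in_itv/= andbT => /andP[t1 _]; exact: lt_le_trans t1.
- by move=> t _; rewrite lee_fin.
- move=> t /=; rewrite in_itv/= lee_fin => /andP[t1 t2].
  have t0 : 0 < t by exact: lt_le_trans t1.
  rewrite ler_pM ?powR_ge0 ?expR_ge0// ?ler_expR ?lerN2//.
  have -> : 1 - b - 1 = - b by ring.
  rewrite !powRN lef_pV2 ?posrE ?powR_gt0//.
  by apply: ge0_ler_powR; rewrite ?nnegrE// ltW.
Qed.

End gamma.

(** On the square [r0, r0+d] x [s0, s0+d] the integrand is at least the positive constant k, because
    the weight is smallest at the upper corner. *)
Lemma iterated_integral_gt0 (R : realType) (alpha : R) (f : R -> R -> R) (r0 s0 d c : R) :
  0 < alpha -> (forall r s, 0 <= f r s) -> 0 < r0 -> 0 < s0 -> 0 < d -> 0 < c ->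
  (forall r s, `|r - r0| <= d -> `|s - s0| <= d -> c <= f r s) ->
  (0 < \int[@lebesgue_measure R]_(s in `]0%R, +oo[) \int[@lebesgue_measure R]_(r in `]0%R, +oo[)
    (f r s * (r `^ (alpha + 1) * s `^ (alpha + 1))^-1)%:E)%E.
Proof.
move=> alpha_gt0 f0 r0_gt0 s0_gt0 d0 c0 fc.
pose weight r s : R := (r `^ (alpha + 1) * s `^ (alpha + 1))^-1.
have weight_ge0 r s : 0 <= weight r s by rewrite invr_ge0 mulr_ge0 ?powR_ge0.
have a1 : 0 <= alpha + 1 by rewrite addr_ge0// ltW.
have r0d : 0 < r0 + d by exact: addr_gt0.
have s0d : 0 < s0 + d by exact: addr_gt0.
have weight_le r s : 0 < r -> 0 < s -> r <= r0 + d -> s <= s0 + d ->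
    weight (r0 + d) (s0 + d) <= weight r s.
  move=> rp sp r2 s2; rewrite /weight lef_pV2 ?posrE ?mulr_gt0 ?powR_gt0//.
  have pr : r `^ (alpha + 1) <= (r0 + d) `^ (alpha + 1).
    by apply: ge0_ler_powR => //; rewrite nnegrE ltW.
  have ps : s `^ (alpha + 1) <= (s0 + d) `^ (alpha + 1).
    by apply: ge0_ler_powR => //; rewrite nnegrE ltW.
  exact: (ler_pM (powR_ge0 _ _) (powR_ge0 _ _) pr ps).
have w0 : 0 < weight (r0 + d) (s0 + d) by rewrite invr_gt0 mulr_gt0 ?powR_gt0.
pose k := c * weight (r0 + d) (s0 + d).
have k0 : 0 < k by exact: mulr_gt0.
have kE r s : r0 <= r <= r0 + d -> s0 <= s <= s0 + d -> k <= f r s * weight r s.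
  move=> /andP[r1 r2] /andP[s1 s2].
  have hrs : c <= f r s by apply: fc; rewrite ger0_norm ?subr_ge0// lerBlDl.
  apply: (ler_pM (ltW c0) (ltW w0) hrs).
  by apply: weight_le => //; [exact: lt_le_trans r1|exact: lt_le_trans s1].
pose itv (u : R) : set R := `[u, (u + d)%R]%classic.
have itvE (u : R) : @lebesgue_measure R (itv u) = d%:E.
  by rewrite lebesgue_measure_itv/= lte_fin ltrDl d0 -EFinD addrAC subrr add0r.
have itvP (u v : R) : itv u v -> u <= v <= u + d by rewrite /itv/= in_itv.
have itv0 (u : R) : 0 < u -> itv u `<=` `]0, +oo[.
  by move=> u0 v /itvP/andP[uv _]; rewrite /= in_itv/= andbT; exact: lt_le_trans uv.
have F0 r s : (0 <= (f r s * weight r s)%:E)%E.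
  by rewrite lee_fin; exact: mulr_ge0.
have inner_ge s : s0 <= s <= s0 + d -> ((k * d)%:E <=
    \int[@lebesgue_measure R]_(r in `]0%R, +oo[) (f r s * weight r s)%:E)%E.
  move=> ss; rewrite EFinM -(itvE r0); apply: le_integral_cst.
  - exact: measurable_itv.
  - exact: itv0.
  - exact: ltW.
  - by move=> r _; exact: F0.
  - by move=> r /itvP rr; rewrite lee_fin; exact: kE.
have kd0 : 0 < k * d by exact: mulr_gt0.
have : ((k * d)%:E * @lebesgue_measure R (itv s0) <=
    \int[@lebesgue_measure R]_(s in `]0%R, +oo[)
    \int[@lebesgue_measure R]_(r in `]0%R, +oo[) (f r s * weight r s)%:E)%E.
  apply: le_integral_cst.
  - exact: measurable_itv.
  - exact: itv0.
  - exact: ltW.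
  - by move=> s _; apply: integral_ge0 => r _; exact: F0.
  - by move=> s /itvP; exact: inner_ge.
by apply: lt_le_trans; rewrite itvE -EFinM lte_fin; exact: mulr_gt0.
Qed.

(** * The Gaussian form of distance covariance *)

Section distance_covariance_hilbert.
Context (R : realType) (H H' : hilbertType R) (alpha : R).
Hypotheses (sepH : separable H) (sepH' : separable H').
Hypotheses (alpha_gt0 : 0 < alpha) (alpha_lt2 : alpha < 2).
Context dS (S : measurableType dS) (Q : probability S R).
Variables (X : {RV Q >-> borel H}) (Y : {RV Q >-> borel H'}).
Variables (dim : option nat) (xi : nat -> {RV Q >-> R}).
Variables (dim' : option nat) (eta : nat -> {RV Q >-> R}).
Hypothesis gs : gaussian_setup X Y dim xi dim' eta.
Variables (e : nat -> H) (e' : nat -> H').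
Hypotheses (be : orthonormal_basis dim e) (be' : orthonormal_basis dim' e').
Local Notation leb := (@lebesgue_measure R).
Local Notation csqr := (cov_sqr X Y dim xi dim' eta e e').

Lemma cosI_cvg (f_ : nat -> S -> R) (f : S -> R) p :
  (forall n, measurable_fun setT (f_ n)) -> (forall w, f_ n w @[n --> \oo] --> f w) ->
  cosI Q (f_ n) p @[n --> \oo] --> cosI Q f p.
Proof.
move=> mf cf; apply: (@dominated_cvg _ _ _ Q _ _ (fun=> 1)).
- by move=> n; exact: measurable_cos_comp.
- move=> w; apply: continuous_cvg; first exact: continuous_cos.
  by apply: cvgD; [exact: cf|exact: cvg_cst].
- exact: integrable_probability_cst.
- by move=> n w; exact: normr_cos_le1.
Qed.

Let hv r s := \int[Q]_w csqr r s w.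

Let mC r s : measurable_fun setT (csqr r s).
Proof. exact: measurable_cov_sqr. Qed.

Let iC r s : Q.-integrable setT (EFin \o csqr r s).
Proof.
apply: (@integrable_bounded _ _ _ _ _ 18) => // w.
by rewrite ger0_norm ?cov_sqr_ge0// cov_sqr_le.
Qed.

Let hv_ge0 r s : 0 <= hv r s.
Proof. by apply: Rintegral_ge0 => w _; exact: cov_sqr_ge0. Qed.

Let hv_cvg (r_ s_ : nat -> R) r s :
  r_ n @[n --> \oo] --> r -> s_ n @[n --> \oo] --> s ->
  hv (r_ n) (s_ n) @[n --> \oo] --> hv r s.
Proof.
move=> cr cs.
have cX w w' : dotX X dim xi e (r_ n) 0 w w' @[n --> \oo] --> dotX X dim xi e r 0 w w'.
  by apply: cvgD; [exact: cvgMl|exact: cvg_cst].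
have cY w w' : dotY Y dim' eta e' (s_ n) 0 w w' @[n --> \oo] --> dotY Y dim' eta e' s 0 w w'.
  by apply: cvgD; [exact: cvgMl|exact: cvg_cst].
apply: (@dominated_cvg _ _ _ Q _ _ (fun=> 18)).
- by move=> n; exact: mC.
- move=> w.
  have cIX p : cosI Q (dotX X dim xi e (r_ n) 0 w) p @[n --> \oo] -->
      cosI Q (dotX X dim xi e r 0 w) p.
    apply: cosI_cvg => [n|w']; last exact: cX.
    exact: (@measurable_dotX _ _ _ _ _ _ X Y dim xi dim' eta).
  have cIY p : cosI Q (dotY Y dim' eta e' (s_ n) 0 w) p @[n --> \oo] -->
      cosI Q (dotY Y dim' eta e' s 0 w) p.
    apply: cosI_cvg => [n|w']; last exact: cY.
    exact: (@measurable_dotY _ _ _ _ _ _ X Y dim xi dim' eta).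
  have cIXY p : cosI Q (dotXY X Y dim xi dim' eta e e' (r_ n) 0 (s_ n) 0 w) p @[n --> \oo] -->
      cosI Q (dotXY X Y dim xi dim' eta e e' r 0 s 0 w) p.
    apply: cosI_cvg => [n|w']; first exact: measurable_dotXY.
    by apply: cvgD; [exact: cX|exact: cY].
  have csq (u_ : nat -> R) (u : R) : u_ n @[n --> \oo] --> u -> u_ n ^+ 2 @[n --> \oo] --> u ^+ 2.
    by move=> cu; rewrite expr2; under eq_fun do rewrite expr2; exact: cvgM.
  by apply: cvgD; apply: csq; apply: cvgB => //; [apply: cvgB|apply: cvgD]; exact: cvgM.
- exact: integrable_probability_cst.
- by move=> n w; rewrite ger0_norm ?cov_sqr_ge0// cov_sqr_le.
Qed.

(** Joint continuity of [hv] in sequential form ([hv_cvg]): otherwise points tending to (r0, s0)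
    would have values below half of the limit. *)
Let hv_lower r0 s0 : 0 < hv r0 s0 -> exists2 d, 0 < d &
  forall r s, `|r - r0| <= d -> `|s - s0| <= d -> hv r0 s0 / 2 <= hv r s.
Proof.
move=> h0; apply: contrapT => nd.
have bad n : exists rs : R * R, [/\ `|rs.1 - r0| <= n.+1%:R^-1,
    `|rs.2 - s0| <= n.+1%:R^-1 & hv rs.1 rs.2 < hv r0 s0 / 2].
  apply: contrapT => nb; apply: nd; exists n.+1%:R^-1; first by rewrite invr_gt0.
  move=> r s rd sd.
  by rewrite leNgt; apply/negP => hrs; apply: nb; exists (r, s).
have [rs rsP] := choice bad.
have cv (u_ : nat -> R) (u : R) : (forall n, `|u_ n - u| <= n.+1%:R^-1) ->
    u_ n @[n --> \oo] --> u.
  move=> uu; have c0 : u_ n - u @[n --> \oo] --> 0.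
    have ci := @cvg_invn R; apply/norm_cvg0P/(squeeze_cvgr _ (cvg_cst 0) ci).
    by apply: nearW => n; rewrite normr_ge0 uu.
  rewrite -[X in _ --> X]add0r; under eq_fun do rewrite -[u_ _](subrK u).
  by apply: cvgD => //; exact: cvg_cst.
have c1 : (rs n).1 @[n --> \oo] --> r0 by apply: cv => n; have [] := rsP n.
have c2 : (rs n).2 @[n --> \oo] --> s0 by apply: cv => n; have [] := rsP n.
have : hv r0 s0 <= hv r0 s0 / 2.
  have ch := hv_cvg c1 c2; rewrite -[leLHS](cvg_lim _ ch)//.
  apply: limr_le; first exact: cvgP ch.
  by apply: nearW => n; have [_ _ /ltW] := rsP n.
by lra.
Qed.

Let dcovHE : dcovH alpha X Y dim e xi dim' e' eta =
  ((c_alpha alpha ^+ 2)%:E * \int[leb]_(s in `]0%R, +oo[) \int[leb]_(r in `]0%R, +oo[)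
    (hv r s * (r `^ (alpha + 1) * s `^ (alpha + 1))^-1)%:E)%E.
Proof.
rewrite /dcovH; congr (_ * _)%E; apply: eq_integral => s _; apply: eq_integral => r _.
by rewrite (expectation_cond_diff gs) -EFinM.
Qed.

Let dcovH0_hv : dcovH alpha X Y dim e xi dim' e' eta = 0%E ->
  forall r s, 0 < r -> 0 < s -> hv r s = 0.
Proof.
move=> dc0 r0 s0 r0_gt0 s0_gt0; apply/eqP; apply: contraT => hn0.
have h0 : 0 < hv r0 s0 by rewrite lt_neqAle eq_sym hn0 hv_ge0.
have [d d0 hd] := hv_lower h0.
have h20 : 0 < hv r0 s0 / 2 by exact: divr_gt0.
have c0 : 0 < c_alpha alpha.
  have G0 : 0 < Gamma (1 - alpha / 2).
    by apply: Gamma_gt0; have ap := alpha_gt0; have a2 := alpha_lt2; lra.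
  by rewrite /c_alpha divr_gt0// mulr_gt0// powR_gt0.
have : (0 < dcovH alpha X Y dim e xi dim' e' eta)%E.
  rewrite dcovHE; apply: mule_gt0; first by rewrite lte_fin exprn_gt0.
  exact: (iterated_integral_gt0 alpha_gt0 hv_ge0 r0_gt0 s0_gt0 d0 h20 hd).
by rewrite dc0 ltxx.
Qed.

(** With r the square root of 2t and test vector -ra, the Gaussian functions of [cov0_gaussian]
    become the kernels required by [indep_gaussk]. *)
Let gaussk_sqrt (K : hilbertType R) t (x a : K) : 0 < t ->
  gaussk t x a = expR (- (`|Num.sqrt (2 * t) *: x + - (Num.sqrt (2 * t) *: a)| ^+ 2 / 2)).
Proof.
move=> t0; rewrite /gaussk -scalerBr normrZ exprMn real_normK ?num_real// sqr_sqrtr.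
  by congr (expR (- _)); field.
by rewrite mulr_ge0// ltW.
Qed.

Lemma dcovH0_indep : dcovH alpha X Y dim e xi dim' e' eta = 0%E <-> indep Q X Y.
Proof.
split=> [dc0|XY]; last first.
  rewrite dcovHE (_ : (fun s => _) = fun=> 0%E) ?integral0 ?mule0//.
  apply/funext => s; apply: integral0_eq => r _.
  rewrite /hv (_ : (fun w => _) = fun=> 0).
    by rewrite Rintegral_probability_cst mul0r.
  by apply/funext => w; exact: cov_indep.
have mX : measurable_fun setT (X : S -> borel H) by [].
have mY : measurable_fun setT (Y : S -> borel H') by [].
apply: (indep_gaussk sepH sepH' mX mY) => t u a b t0 u0.
pose r := Num.sqrt (2 * t); pose s := Num.sqrt (2 * u).
have r0 : 0 < r by rewrite sqrtr_gt0 mulr_gt0.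
have s0 : 0 < s by rewrite sqrtr_gt0 mulr_gt0.
have ae0 : {ae Q, forall w, csqr r s w = 0}.
  apply: Rintegral_eq0; [exact: cov_sqr_ge0|exact: iC|exact: dcovH0_hv].
have := cov0_gaussian gs be be' (- (r *: a)) (- (s *: b)) ae0.
have EX w : gaussk t (X w : H) a = gaussX X r (- (r *: a)) w by exact: gaussk_sqrt.
have EY w : gaussk u (Y w : H') b = gaussY Y s (- (s *: b)) w by exact: gaussk_sqrt.
under [in X in _ -> X]eq_Rintegral do rewrite EX EY.
move=> ->; congr (_ * _); apply: eq_Rintegral => w _; [exact: esym (EX w)|exact: esym (EY w)].
Qed.

End distance_covariance_hilbert.

(** * Assembly of the four equivalences *)

Lemma same_law_independent_RV (R : realType) dT (T : measurableType dT) (P : probability T R)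
    dS (S : measurableType dS) (Q : probability S R)
    dA (A : measurableType dA) dB (B : measurableType dB)
    (X : {RV P >-> A}) (Y : {RV P >-> B}) (X0 : {RV Q >-> A}) (Y0 : {RV Q >-> B}) :
  same_law P Q (pair_fun X Y) (pair_fun X0 Y0) -> indep Q X0 Y0 <-> independent_RV X Y.
Proof.
move=> XY0.
have PX U : measurable U -> P (X @^-1` U) = Q (X0 @^-1` U).
  by move=> mU; exact: (XY0 _ (measurable_preimage measurable_fst mU)).
have PY V : measurable V -> P (Y @^-1` V) = Q (Y0 @^-1` V).
  by move=> mV; exact: (XY0 _ (measurable_preimage measurable_snd mV)).
have PXY U V : measurable U -> measurable V ->
    P (X @^-1` U `&` Y @^-1` V) = Q (X0 @^-1` U `&` Y0 @^-1` V).
  by move=> mU mV; exact: (XY0 _ (measurableX mU mV)).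
split=> ind U V mU mV; first by rewrite PXY// PX// PY//; exact: ind.
by rewrite -PXY// -PX// -PY//; exact: ind.
Qed.

Theorem theorem6p6 (R : realType) (H H' : hilbertType R)
    (sepH : separable H) (sepH' : separable H')
    (alpha : R) (alpha_gt0 : 0 < alpha) (alpha_lt2 : alpha < 2)
    (dT : measure_display) (T : measurableType dT) (P : probability T R)
    (X : {RV P >-> borel H}) (Y : {RV P >-> borel H'}) :
  [/\ forall (dS : measure_display) (S : measurableType dS)
        (Q : probability S R)
        (Xs : nat -> {RV Q >-> borel H}) (Ys : nat -> {RV Q >-> borel H'}),
        independent_copies X Y Xs Ys ->
        (moment X (2 * alpha) < +oo)%E -> (moment Y (2 * alpha) < +oo)%E ->
        (dcov_star alpha Xs Ys = 0%E <-> independent_RV X Y),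
      forall (dS : measure_display) (S : measurableType dS)
        (Q : probability S R)
        (Xs : nat -> {RV Q >-> borel H}) (Ys : nat -> {RV Q >-> borel H'}),
        independent_copies X Y Xs Ys ->
        (moment X alpha < +oo)%E -> (moment Y alpha < +oo)%E ->
        (dcov_hat alpha Xs Ys = 0%E <-> independent_RV X Y),
      forall (dS : measure_display) (S : measurableType dS)
        (Q : probability S R)
        (Xs : nat -> {RV Q >-> borel H}) (Ys : nat -> {RV Q >-> borel H'}),
        independent_copies X Y Xs Ys ->
        (moment X alpha < +oo)%E -> (moment Y alpha < +oo)%E ->
        (dcov_tilde alpha Xs Ys = 0%E <-> independent_RV X Y) &
      forall (dS : measure_display) (S : measurableType dS)
        (Q : probability S R)
        (X0 : {RV Q >-> borel H}) (Y0 : {RV Q >-> borel H'})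
        (dim dim' : option nat) (e : nat -> H) (e' : nat -> H')
        (xi eta : nat -> {RV Q >-> R}),
        same_law P Q (pair_fun X Y) (pair_fun X0 Y0) ->
        orthonormal_basis dim e -> orthonormal_basis dim' e' ->
        gaussian_setup X0 Y0 dim xi dim' eta ->
        (dcovH alpha X0 Y0 dim e xi dim' e' eta = 0%E <-> independent_RV X Y)].
Proof.
split=> dS S Q.
- move=> Xs Ys copies mX mY; exact: dcov_star0.
- move=> Xs Ys copies mX mY; exact: dcov_hat0.
- move=> Xs Ys copies mX mY; exact: dcov_tilde0.
move=> X0 Y0 dim dim' e e' xi eta XY0 be be' gs.
rewrite (dcovH0_indep sepH sepH' alpha_gt0 alpha_lt2 gs be be').
exact: same_law_independent_RV.
Qed.
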